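(* Let $E=\bigcup_{j=1}^N E_j$, where $E_1,\ldots,E_N\subseteq\mathbb{C}$ are mutually exterior simply connected compact sets (none a single point), let $\mathcal{L}$ and $\Phi:\widehat{\mathbb{C}}\setminus E\to\mathcal{L}$ be the corresponding lemniscatic domain and lemniscatic map, let $(\alpha_j)_{j=1}^\infty$ be an admissible sequence of foci of $\mathcal{L}$, and let $b_k$, $k\ge0$, be the Faber--Walsh polynomials for $E$ and $(\alpha_j)_{j=1}^\infty$. Let $z_0\in\mathbb{C}\setminus E$ and let $\sigma_0>1$ be such that $z_0\in\Gamma_{\sigma_0}$. Then $$R_{z_0}(E)=\frac{1}{\sigma_0}\quad\text{and}\quad R_{z_0}\big(\overline{\operatorname{int}(\Gamma_\sigma)}\big)=\frac{\sigma}{\sigma_0}\quad\text{for } 1<\sigma\le\sigma_0,$$ and the Faber--Walsh polynomials for $E$ satisfy $$\lim_{k\to\infty}\left(\frac{\|b_k\|_E}{|b_k(z_0)|}\right)^{1/k}=\frac{1}{\sigma_0}=R_{z_0}(E),$$ $$\lim_{k\to\infty}\left(\frac{\|b_k\|_{\Gamma_\sigma}}{|b_k(z_0)|}\right)^{1/k}=\frac{\sigma}{\sigma_0}\quad\text{for any }\sigma>1.$$ Hence the normalized Faber--Walsh polynomials $b_k(z)/b_k(z_0)\in\mathcal{P}_k(z_0)$ are asymptotically optimal (with respect to $z_0$) on $E$, and on $\overline{\operatorname{int}(\Gamma_\sigma)}$ whenever $1<\sigma\le\sigma_0$.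
   Context: $\widehat{\mathbb{C}}=\mathbb{C}\cup\{\infty\}$. A ''simply connected compact set'' is a connected compact subset of $\mathbb{C}$ with connected complement; ''mutually exterior'' means pairwise disjoint. $\|\cdot\|_S$ is the maximum norm on the compact set $S$. Lemniscatic domain: for $N\ge1$, pairwise distinct $a_1,\ldots,a_N\in\mathbb{C}$ (the foci), real $m_1,\ldots,m_N>0$ with $\sum_j m_j=1$, and $\mu>0$, the set $\mathcal{L}=\{w\in\widehat{\mathbb{C}}:|U(w)|>\mu\}$ with $U(w)=\prod_{j=1}^N(w-a_j)^{m_j}$. Lemniscatic map (theorem of Walsh): for $E=\bigcup_{j=1}^N E_j$ with $E_1,\ldots,E_N\subseteq\mathbb{C}$ mutually exterior simply connected compact sets (none a single point) and $\mathcal{K}=\widehat{\mathbb{C}}\setminus E$, there exist a unique lemniscatic domain $\mathcal{L}=\{w\in\widehat{\mathbb{C}}:|U(w)|>\mu\}$, $U(w)=\prod_{j=1}^N(w-a_j)^{m_j}$, with $\mu$ equal to the logarithmic capacity of $E$, and a unique bijective conformal map $\Phi:\mathcal{K}\to\mathcal{L}$ with $\Phi(z)=z+\mathcal{O}(1/z)$ near infinity, called the lemniscatic map of $E$. Green's function with pole at infinity of $\mathcal{K}$: $g_{\mathcal{K}}(z)=\log|U(\Phi(z))|-\log\mu$. For $\sigma>1$, $\Gamma_\sigma=\{z\in\mathcal{K}:g_{\mathcal{K}}(z)=\log\sigma\}$, and $\operatorname{int}(\Gamma_\sigma)=E\cup\{z\in\mathcal{K}:g_{\mathcal{K}}(z)<\log\sigma\}$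 is its interior. Admissible sequences: a sequence $(\alpha_j)_{j\ge1}$ chosen from the foci $a_1,\ldots,a_N$ such that there is a constant $A>0$ with $|N_{k,j}-km_j|\le A$ for all $k\ge1$ and $1\le j\le N$, where $N_{k,j}$ is the number of times $a_j$ appears among $\alpha_1,\ldots,\alpha_k$. Put $u_k(w)=\prod_{j=1}^k(w-\alpha_j)$, $u_0=1$. Faber--Walsh polynomials: the $k$th Faber--Walsh polynomial for $E$ and $(\alpha_j)$ is $$b_k(z)=\frac{1}{2\pi i}\int_{\Gamma_\lambda}\frac{u_k(\Phi(\zeta))}{\zeta-z}\,d\zeta,$$ for any $\lambda>1$ such that $z$ lies in the interior of the positively oriented $\Gamma_\lambda$; it is a monic polynomial of degree $k$ (independent of $\lambda$). Quotients with denominator $b_k(z_0)$ are considered for all sufficiently large $k$, for which $b_k(z_0)\ne0$. Asymptotic convergence factor: for a compact set $S\subseteq\mathbb{C}$ and $z_0\in\mathbb{C}$ let $\mathcal{P}_k(z_0)=\{1+\sum_{j=1}^k c_j(z-z_0)^j:c_1,\ldots,c_k\in\mathbb{C}\}$ and $$R_{z_0}(S)=\limsup_{k\to\infty}\Big(\min_{p\in\mathcal{P}_k(z_0)}\|p\|_S\Big)^{1/k}.$$ A sequence of polynomials $p_k\in\mathcal{P}_k(z_0)$ is called asymptotically optimal on $S$ and with respect to $z_0$ if $\lim_{k\to\infty}\|p_k\|_S^{1/k}=R_{z_0}(S)$. *)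

(* Defs.v *)
From HB Require Import structures.
From mathcomp Require Import all_boot all_order all_algebra.
From mathcomp Require Import complex.
From mathcomp Require Import all_classical all_reals all_analysis.

Set Implicit Arguments.
Unset Strict Implicit.
Unset Printing Implicit Defensive.

Import Order.TTheory GRing.Theory Num.Theory.
Import numFieldNormedType.Exports.

Local Open Scope classical_set_scope.
Local Open Scope ring_scope.

(* The ascription gives R[i] the topology of its norm; [derivable f z 1] for
   [f : C R -> C R] is then complex differentiability at [z]. *)
Definition C (R : realType) : numClosedFieldType := R[i].

Section Capacity.
Context {R : realType}.

Definition modulus (z : C R) : R := complex.Re `|z|.

Definition borelC := g_sigma_algebraType (@open (C R)).

Definition log_kernel (z w : C R) : \bar R :=
  if z == w then +oo%E else (- ln (modulus (z - w)))%:E.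

Definition log_energy (E : set (C R)) (nu : probability borelC R) : \bar R :=
  (\int[nu]_(z in E) \int[nu]_(w in E) log_kernel z w)%E.

Definition log_capacity (E : set (C R)) : \bar R :=
  expeR (- ereal_inf [set log_energy E nu |
                       nu in [set nu : probability borelC R | nu E = 1%E]])%E.

End Capacity.

Section ContourIntegral.
Context {R : realType}.
Implicit Types (g : R -> C R) (f : C R -> C R).

Definition cderive1 g (t : R) : C R :=
  Complex (derive1 (fun s => complex.Re (g s) : R) t)
          (derive1 (fun s => complex.Im (g s) : R) t).

Definition C1 g : Prop :=
  [/\ forall t, derivable (fun s => complex.Re (g s) : R) t 1,
      forall t, derivable (fun s => complex.Im (g s) : R) t 1
    & continuous (cderive1 g)].

(* [g] restricted to each closed piece of a subdivision of [0, 1] is the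
   restriction of a C^1 map. *)
Definition piecewise_C1 g : Prop :=
  exists2 s : seq R, itv_partition 0 1 s &
    forall i, (i < size s)%N -> exists2 h, C1 h &
      forall t, nth 0 (0 :: s) i <= t <= nth 0 (0 :: s) i.+1 -> g t = h t.

Definition closed_Jordan_curve g : Prop :=
  [/\ piecewise_C1 g, g 0 = g 1 & {in `[0, 1[ &, injective g}].

Definition curve_integral g f : C R :=
  let h := fun t => f (g t) * cderive1 g t in
  Complex (\int[lebesgue_measure]_(t in `[0, 1]) complex.Re (h t))%R
          (\int[lebesgue_measure]_(t in `[0, 1]) complex.Im (h t))%R.

Definition contour_integral n (g : 'I_n -> R -> C R) f : C R :=
  \sum_(l < n) curve_integral (g l) f.

Definition two_pi_i : C R := Complex 0 (2 * pi).

(* The curves [g l] trace [Gamma], the boundary of the bounded open set [D],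
   positively with respect to [D].  Different curves may touch at finitely many
   points, as happens when a level curve passes through a critical point. *)
Definition positive_parametrization (Gamma D : set (C R)) n
    (g : 'I_n -> R -> C R) : Prop :=
  [/\ forall l, closed_Jordan_curve (g l),
      \bigcup_l (g l @` `[0, 1]) = Gamma,
      forall l l', l != l' -> finite_set (g l @` `[0, 1] `&` g l' @` `[0, 1]),
      forall z, D z -> contour_integral g (fun x => (x - z)^-1) = two_pi_i
    & forall z, ~ D z -> ~ Gamma z ->
        contour_integral g (fun x => (x - z)^-1) = 0].

Definition is_oriented_integral (Gamma D : set (C R)) f (v : C R) : Prop :=
  exists n, exists2 g : 'I_n -> R -> C R,
    positive_parametrization Gamma D g & v = contour_integral g f.

End ContourIntegral.

Section Lemniscatic.
Context {R : realType} {N : nat}.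
Implicit Types (E : set (C R)) (a : 'I_N -> C R) (m : 'I_N -> R) (mu : R).

Definition nondegenerate_simply_connected_compact E : Prop :=
  [/\ compact E, connected E, connected (~` E)
    & exists z w, [/\ E z, E w & z != w]].

(* |U|, which unlike U itself is single-valued. *)
Definition absU a m (w : C R) : R :=
  \prod_(j < N) (modulus (w - a j)) `^ (m j).

Definition lemniscatic_domain a m mu :
    set (one_point_compactification (C R)) :=
  [set w | if w is Some w' then mu < absU a m w' else True].

(* The lemniscatic map is [omap Phi] on the Riemann sphere: the normalization
   at infinity makes it fix infinity, and it contains conformality there. *)
Record is_lemniscatic_map E a m mu (Phi : C R -> C R) : Prop := {
  foci_distinct : injective a;
  weights_gt0 : forall j, 0 < m j;
  weights_sum1 : \sum_(j < N) m j = 1;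
  mu_gt0 : 0 < mu;
  mu_capacity : mu%:E = log_capacity E;
  Phi_holomorphic : forall z, ~ E z -> derivable Phi z 1;
  Phi_bijective :
    set_bij (~` (Some @` E) : set (one_point_compactification (C R)))
            (lemniscatic_domain a m mu) (omap Phi);
  Phi_normalized : exists M r : R, 0 < r /\
    forall z, r < modulus z -> modulus (Phi z - z) <= M / modulus z
}.

Definition green a m mu (Phi : C R -> C R) (z : C R) : R :=
  ln (absU a m (Phi z)) - ln mu.

Definition level_curve E a m mu Phi (sigma : R) : set (C R) :=
  [set z | ~ E z /\ green a m mu Phi z = ln sigma].

Definition level_interior E a m mu Phi (sigma : R) : set (C R) :=
  E `|` [set z | ~ E z /\ green a m mu Phi z < ln sigma].

(* Sequences are indexed from 0: [alpha i] is alpha_(i+1). *)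
Definition focus_count a (alpha : nat -> C R) (k : nat) (j : 'I_N) : nat :=
  (\sum_(i < k) (alpha i == a j))%N.

Definition admissible a m (alpha : nat -> C R) : Prop :=
  (forall i, exists j, alpha i = a j) /\
  exists2 A : R, 0 < A & forall (k : nat) (j : 'I_N), (1 <= k)%N ->
    `| (focus_count a alpha k j)%:R - k%:R * m j | <= A.

Definition node_poly (alpha : nat -> C R) (k : nat) (w : C R) : C R :=
  \prod_(i < k) (w - alpha i).

Definition faber_walsh E a m mu Phi (alpha : nat -> C R)
    (b : nat -> C R -> C R) : Prop :=
  forall (k : nat) (z : C R) (lambda : R), 1 < lambda ->
    level_interior E a m mu Phi lambda z ->
    exists2 v,
      is_oriented_integral (level_curve E a m mu Phi lambda)
        (level_interior E a m mu Phi lambda)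
        (fun x => node_poly alpha k (Phi x) / (x - z)) v
      & b k z = two_pi_i^-1 * v.

End Lemniscatic.

Section AsymptoticConvergence.
Context {R : realType}.
Implicit Types (S : set (C R)).

Definition max_norm S (f : C R -> C R) : R := sup [set modulus (f z) | z in S].

Definition normalized_polys (k : nat) (z0 : C R) : set (C R -> C R) :=
  [set p | exists c : nat -> C R,
    p = fun z => 1 + \sum_(1 <= j < k.+1) c j * (z - z0) ^+ j].

(* The infimum is a minimum when [S] is compact, and is at most 1, as
   1 is in [normalized_polys k z0]; so the upper limit is that of a bounded
   sequence. *)
Definition min_norm S (z0 : C R) (k : nat) : R :=
  inf [set max_norm S p | p in normalized_polys k z0].

Definition convergence_factor (z0 : C R) S : R :=
  limn_sup (fun k => min_norm S z0 k `^ k%:R^-1).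

(* Membership is only required for large [k], so that quotients by a value
   that is nonzero for large [k] are covered. *)
Definition asymptotically_optimal (z0 : C R) S (p : nat -> C R -> C R) : Prop :=
  (\forall k \near \oo, normalized_polys k z0 (p k)) /\
  (fun k => max_norm S (p k) `^ k%:R^-1) @ \oo --> convergence_factor z0 S.

End AsymptoticConvergence.

(* Main.v *)
Require Import Defs.
From mathcomp Require Import all_boot all_order all_algebra.
From mathcomp Require Import complex ring lra.
From mathcomp Require Import all_classical all_reals all_analysis.
Import Order.TTheory GRing.Theory Num.Theory.
Import numFieldNormedType.Exports.
Set Implicit Arguments.
Unset Strict Implicit.
Unset Printing Implicit Defensive.
Local Open Scope classical_set_scope.
Local Open Scope ring_scope.

(** Both halves of the statement rest on one representation.  Write [u_k] for
    [node_poly alpha k] and [T f z] for the integral of [f w / (w - z)] over a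
    level curve.  The function [u_k o Phi] is holomorphic off [E] and of size
    [|z| ^ k] at infinity, so it is a polynomial of degree at most [k] plus a
    function vanishing at infinity, and Cauchy's theorem in the exterior of [E]
    ([cauchy_exterior]) identifies the polynomial part with [b k] and the
    remainder with a Cauchy integral ([faber_walsh_representation]): inside the
    level curve [T (u_k o Phi) = 2 pi i b_k], outside it
    [T (u_k o Phi) = 2 pi i (b_k - u_k o Phi)].

    Growth of [b k].  On the level curve [l] the modulus of [u_k o Phi] is
    [(mu * l) ^ k] up to constants independent of [k], since the node counts
    differ boundedly from [k * m j] ([node_poly_on_compact]).  The representation
    then bounds [b k] on a closed sublevel set [s] by a constant times
    [(mu * l) ^ k] for every [l > s] ([faber_walsh_le]), and at a point of level
    [s] the term [u_k (Phi z)] dominates the Cauchy integral over a lower level,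
    so that [|b_k z|] has exact order [(mu * s) ^ k] ([faber_walsh_growth]).
    Taking k-th roots of the quotients gives the upper bounds on all limits and,
    on the level curves, the lower bounds as well.

    Optimality.  The lower bound is the Bernstein--Walsh inequality: a polynomial
    [p] of degree at most [k] with [|p| <= B] on the level curve [s] satisfies
    [|p z0| <= (s0 / s) ^ k * B].  Usually this is a maximum principle; here the
    function [p ^ n / u_(k n) o Phi] is expressed through its Cauchy integral and
    the resulting constants disappear with n-th roots ([bernstein_walsh]).
    Letting [s] decrease to [1] gives the inequality on [E] itself.  Hence every
    normalized polynomial has norm at least [(1 / s0) ^ k] on [E], and at least
    [(s' / s0) ^ k] on the closed interior of the level curve [s] for [s' < s],
    rates that the normalized [b k] attain
    ([asymptotically_optimal_of_bounds]).

    Complex analysis is developed from complex differentiability alone.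
    Goursat's theorem for rectangles, with one exceptional point, yields Cauchy's
    formula on squares; holomorphic functions are therefore locally quotients of
    Cauchy transforms, which makes divided differences holomorphic and bounded
    ([derivable_dq], [dq_bounded]).  Following Dixon, the contour integral of
    [(f w - f z) / (w - z)] is then holomorphic even for [z] on the contour
    ([derivable_cauchy_kernel]); it extends to an entire function through the
    region enclosed by the contour, and Liouville's theorem identifies it.  Only
    the winding numbers of the contour enter this argument, which are
    what a positive parametrization prescribes. *)

(** * Complex modulus and difference quotients *)

Section Modulus.
Context {R : realType}.
Implicit Types (z w : C R).

Lemma normC_modulus z : `|z| = (modulus z)%:C%C :> C R.
Proof. by rewrite /modulus normc_def. Qed.

Lemma modulus_ge0 z : 0 <= modulus z.
Proof. by rewrite -ler0c -normC_modulus normr_ge0. Qed.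

Lemma modulusD z w : modulus (z + w) <= modulus z + modulus w.
Proof. by rewrite -lecR rmorphD /= -!normC_modulus ler_normD. Qed.

Lemma modulusM z w : modulus (z * w) = modulus z * modulus w.
Proof. by apply: complexI; rewrite rmorphM /= -!normC_modulus normrM. Qed.

Lemma modulusN z : modulus (- z) = modulus z.
Proof. by rewrite /modulus normrN. Qed.

Lemma modulusB z w : modulus (z - w) = modulus (w - z).
Proof. by rewrite /modulus distrC. Qed.

Lemma modulus0 : modulus (0 : C R) = 0.
Proof. by rewrite /modulus normr0. Qed.

Lemma modulus1 : modulus (1 : C R) = 1.
Proof. by rewrite /modulus normr1. Qed.

Lemma modulus_eq0 z : (modulus z == 0) = (z == 0).
Proof. by rewrite -(inj_eq (@complexI R)) -normC_modulus normr_eq0. Qed.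

Lemma modulus_gt0 z : (0 < modulus z) = (z != 0).
Proof. by rewrite lt_def modulus_eq0 modulus_ge0 andbT. Qed.

Lemma modulusV z : modulus z^-1 = (modulus z)^-1.
Proof. by apply: complexI; rewrite fmorphV /= -!normC_modulus normfV. Qed.

Lemma modulusX z n : modulus (z ^+ n) = modulus z ^+ n.
Proof. by elim: n => [|n IH]; rewrite ?expr0 ?modulus1// !exprS modulusM IH. Qed.

Lemma modulus_sum (I : Type) (r : seq I) (P : pred I) (F : I -> C R) :
  modulus (\sum_(i <- r | P i) F i) <= \sum_(i <- r | P i) modulus (F i).
Proof.
elim/big_rec2: _ => [|i x y _ h]; first by rewrite modulus0.
by apply: le_trans (modulusD _ _) _; rewrite lerD2l.
Qed.

Lemma modulus_real (x : R) : modulus (x%:C%C : C R) = `|x|.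
Proof. by rewrite /modulus normc_def /= expr0n addr0 sqrtr_sqr. Qed.

Lemma Re_le_modulus z : `|complex.Re z| <= modulus z.
Proof. by rewrite -lecR -normC_modulus normc_ge_Re. Qed.

Lemma Im_le_modulus z : `|complex.Im z| <= modulus z.
Proof.
rewrite /modulus normc_def /= -sqrtr_sqr ler_wsqrtr// lerDr sqr_ge0//.
Qed.

Lemma modulus_le_ReIm z : modulus z <= `|complex.Re z| + `|complex.Im z|.
Proof.
case: z => x y /=.
have -> : (Complex x y : C R) = x%:C%C + 'i%C * y%:C%C by exact: (complexE (Complex x y)).
apply: (le_trans (modulusD _ _)); rewrite modulusM !modulus_real.
suff -> : modulus ('i%C : C R) = 1 by rewrite mul1r.
by rewrite /modulus normc_def /= expr0n /= add0r expr1n sqrtr1.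
Qed.

Lemma modulusBl z w : modulus z - modulus w <= modulus (z - w).
Proof. by rewrite lerBlDr; apply: le_trans (modulusD _ _); rewrite subrK. Qed.

Lemma modulus_dist x z w : modulus (z - w) <= modulus (z - x) + modulus (x - w).
Proof. by apply: le_trans (modulusD _ _); rewrite addrA subrK. Qed.

(** The norm of [C R] takes values in [C R] itself; this and the next
    lemmas turn its topology into epsilon-delta statements over [R]. *)
Lemma nbhs_modulusP z (P : set (C R)) :
  nbhs z P <-> exists2 e : R, 0 < e & forall w, modulus (w - z) < e -> P w.
Proof.
split.
- rewrite -nbhs_ballE => -[e /= e0 eP].
  have eE : e = (complex.Re e)%:C%C by rewrite RRe_real// gtr0_real.
  exists (complex.Re e); first by rewrite -ltcR -eE.
  move=> w wz; apply: eP; rewrite /ball/= /ball_ /= eE distrC normC_modulus.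
  by rewrite ltcR.
- move=> [e e0 eP]; rewrite -nbhs_ballE; exists (e%:C)%C; first by rewrite /= ltcR.
  by move=> w; rewrite /ball/= /ball_/= normC_modulus ltcR modulusB; exact: eP.
Qed.

Lemma continuous_modulusP (f : C R -> C R) z :
  {for z, continuous f} <->
  forall e : R, 0 < e -> exists2 d : R, 0 < d &
    forall w, modulus (w - z) < d -> modulus (f w - f z) < e.
Proof.
split.
- move=> cf e e0.
  have /cf : nbhs (f z) [set y | modulus (y - f z) < e].
    by apply/nbhs_modulusP; exists e.
  by move=> /nbhs_modulusP[d d0 dP]; exists d.
- move=> H P /nbhs_modulusP[e e0 eP].
  have [d d0 dP] := H e e0.
  by apply/nbhs_modulusP; exists d => // w /dP /eP.
Qed.

Lemma continuous_modulus : continuous (modulus : C R -> R).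
Proof.
move=> z P /nbhs_ballP[e /= e0 eP].
apply/nbhs_modulusP; exists e => // w wz; apply: eP.
apply: le_lt_trans wz; rewrite ler_norml; apply/andP; split.
  by rewrite lerNl opprB; apply: modulusBl.
by rewrite modulusB; apply: modulusBl.
Qed.

Lemma open_modulusP (A : set (C R)) :
  open A <-> forall z, A z -> exists2 e : R, 0 < e & forall w, modulus (w - z) < e -> A w.
Proof.
rewrite openE; split=> [H z /H|H z /H]; first by move/nbhs_modulusP.
by move=> h; apply/nbhs_modulusP.
Qed.

(** Caratheodory's criterion.  All derivatives below come from an exact formula
    for the difference quotient, so that only its continuity has to be checked. *)
Lemma caratheodory (f q : C R -> C R) z :
  (\forall w \near z, f w - f z = (w - z) * q w) ->
  {for z, continuous q} -> is_derive z 1 f (q z).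
Proof.
move=> /nbhs_modulusP[e e0 eP] /continuous_modulusP cq.
have cv : h^-1 *: (f (h *: (1 : C R) + z) - f z) @[h --> (0 : C R)^'] --> q z.
  apply/cvgrPdist_lt => eps eps0.
  have epsE : eps = (complex.Re eps)%:C%C by rewrite RRe_real// gtr0_real.
  have [d d0 dP] : exists2 d : R, 0 < d & forall w, modulus (w - z) < d ->
      modulus (q w - q z) < complex.Re eps by apply: cq; rewrite -ltcR -epsE.
  rewrite near_withinE; apply/nbhs_modulusP.
  exists (Num.min d e) => [|h]; first by rewrite lt_min d0 e0.
  rewrite subr0 lt_min => /andP[hd he] h0.
  rewrite epsE normC_modulus ltcR modulusB [h%:A]mulr1.
  rewrite eP ?addrK// /GRing.scale /= mulKf//.
  by apply: dP; rewrite addrK.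
by apply: DeriveDef; [apply/cvg_ex; exists (q z)|apply: cvg_lim cv].
Qed.

(** The divided difference [f[z, w]], completed on the diagonal by the
    derivative, where it is continuous as soon as [f] is differentiable. *)
Definition dq (f : C R -> C R) z w : C R :=
  if w == z then 'D_1 f z else (f w - f z) / (w - z).

Lemma dqxx f z : dq f z z = 'D_1 f z.
Proof. by rewrite /dq eqxx. Qed.

Lemma dqE f z w : f w - f z = (w - z) * dq f z w.
Proof.
rewrite /dq; case: eqVneq => [->|wz]; first by rewrite !subrr mul0r.
by rewrite mulrC divfK// subr_eq0.
Qed.

Lemma dq_continuous f z : derivable f z 1 -> {for z, continuous (dq f z)}.
Proof.
move=> df; apply/continuous_modulusP => e e0.
have : h^-1 *: (f (h *: (1 : C R) + z) - f z) @[h --> (0 : C R)^'] --> 'D_1 f z by [].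
move/cvgrPdist_lt => /(_ e%:C%C); rewrite ltcR => /(_ e0).
rewrite near_withinE => /nbhs_modulusP[d d0 dP]; exists d => // w wz.
rewrite dqxx /dq; case: eqVneq => [_|wz0]; first by rewrite subrr modulus0.
have := dP (w - z); rewrite subr0 subr_eq0 => /(_ wz wz0).
by rewrite normC_modulus ltcR modulusB [(w - z)%:A]mulr1 subrK mulrC.
Qed.

Lemma derivable_continuous (f : C R -> C R) z : derivable f z 1 -> {for z, continuous f}.
Proof. by move=> df; apply: differentiable_continuous; apply/derivable1_diffP. Qed.

End Modulus.

(** * Complex-valued integrals on an interval *)

Section ComplexIntegral.
Context {R : realType}.
Implicit Types (a b c : R) (h : R -> C R).

Definition cint a b h : C R :=
  Complex (\int[lebesgue_measure]_(t in `[a, b]) complex.Re (h t))%R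
          (\int[lebesgue_measure]_(t in `[a, b]) complex.Im (h t))%R.

(** The class of integrands: along a piecewise C1 curve the velocity jumps at
    the corners, so that continuity cannot be required. *)
Definition bounded_measurable a b h : Prop :=
  [/\ measurable_fun `[a, b] (fun t => complex.Re (h t) : R),
      measurable_fun `[a, b] (fun t => complex.Im (h t) : R)
    & exists M, forall t, a <= t <= b -> modulus (h t) <= M].

Lemma bounded_measurable_integrable a b (f : R -> R) :
  measurable_fun `[a, b] f -> (exists M, forall t, a <= t <= b -> `|f t| <= M) ->
  (lebesgue_measure : measure _ R).-integrable `[a, b] (EFin \o f).
Proof.
move=> mf [M hM]; apply: measurable_bounded_integrable => //=.
  by rewrite lebesgue_measure_itv/=; case: ifP => _; rewrite ?ltry// -EFinD ltry.
exists M; split; first exact: num_real.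
by move=> x Mx t /=; rewrite in_itv /= => /hM /le_trans; apply; apply: ltW.
Qed.

Lemma bounded_measurable_Re a b h : bounded_measurable a b h ->
  (lebesgue_measure : measure _ R).-integrable `[a, b] (EFin \o (fun t => complex.Re (h t) : R)).
Proof.
move=> [mr _ [M hM]]; apply: bounded_measurable_integrable => //; exists M => t /hM.
by apply: le_trans; apply: Re_le_modulus.
Qed.

Lemma bounded_measurable_Im a b h : bounded_measurable a b h ->
  (lebesgue_measure : measure _ R).-integrable `[a, b] (EFin \o (fun t => complex.Im (h t) : R)).
Proof.
move=> [_ mi [M hM]]; apply: bounded_measurable_integrable => //; exists M => t /hM.
by apply: le_trans; apply: Im_le_modulus.
Qed.

Lemma bounded_measurableM a b h1 h2 : bounded_measurable a b h1 ->
  bounded_measurable a b h2 -> bounded_measurable a b (fun t => h1 t * h2 t).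
Proof.
move=> [r1 i1 [M1 H1]] [r2 i2 [M2 H2]]; split.
- rewrite (_ : (fun _ => _) = ((fun t => complex.Re (h1 t) : R) \* (fun t => complex.Re (h2 t) : R))
      \- ((fun t => complex.Im (h1 t) : R) \* (fun t => complex.Im (h2 t) : R))); last first.
    by apply: funext => t /=; case: (h1 t) (h2 t) => [? ?] [? ?].
  by apply: measurable_realfun.measurable_funB; apply: measurable_realfun.measurable_funM.
- rewrite (_ : (fun _ => _) = ((fun t => complex.Re (h1 t) : R) \* (fun t => complex.Im (h2 t) : R))
      \+ ((fun t => complex.Im (h1 t) : R) \* (fun t => complex.Re (h2 t) : R))); last first.
    by apply: funext => t /=; case: (h1 t) (h2 t) => [? ?] [? ?].
  by apply: measurable_realfun.measurable_funD; apply: measurable_realfun.measurable_funM.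
- exists (M1 * M2) => t tab; rewrite modulusM.
  by apply: ler_pM; [exact: modulus_ge0|exact: modulus_ge0|apply: H1|apply: H2].
Qed.

Lemma bounded_measurable_cst a b (z : C R) : bounded_measurable a b (fun=> z).
Proof. by split; [exact: measurable_cst|exact: measurable_cst|exists (modulus z)]. Qed.

Lemma itv_cc_split a b c : a <= c -> c <= b -> `[a, b]%classic = `[a, c] `|` `[c, b].
Proof.
move=> ac cb; apply/seteqP; split=> t; rewrite /= !in_itv /=.
- by move=> /andP[at_ tb]; case: (leP t c) => tc; [left; rewrite at_|right; rewrite (ltW tc) tb].
- case=> /andP[at_ tb]; apply/andP; split => //; first exact: le_trans cb.
  exact: le_trans at_.
Qed.

Lemma bounded_measurable_cat a b c h : a <= c -> c <= b ->
  bounded_measurable a c h -> bounded_measurable c b h -> bounded_measurable a b h.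
Proof.
move=> ac cb [r1 i1 [M1 H1]] [r2 i2 [M2 H2]]; split.
- by rewrite (itv_cc_split ac cb); apply/measurable_funU.
- by rewrite (itv_cc_split ac cb); apply/measurable_funU.
- exists (Num.max M1 M2) => t /andP[at_ tb]; rewrite le_max.
  case: (leP t c) => tc; first by rewrite H1// at_ tc.
  by rewrite H2 ?orbT// tb (ltW tc).
Qed.

Lemma continuous_Re : continuous (fun z : C R => complex.Re z : R).
Proof.
move=> z P /nbhs_ballP[e /= e0 eP].
apply/nbhs_modulusP; exists e => // w wz; apply: eP.
apply: le_lt_trans wz; rewrite modulusB.
by apply: le_trans (Re_le_modulus _); case: z w => [? ?] [? ?].
Qed.

Lemma continuous_Im : continuous (fun z : C R => complex.Im z : R).
Proof.
move=> z P /nbhs_ballP[e /= e0 eP].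
apply/nbhs_modulusP; exists e => // w wz; apply: eP.
apply: le_lt_trans wz; rewrite modulusB.
by apply: le_trans (Im_le_modulus _); case: z w => [? ?] [? ?].
Qed.

Lemma continuous_bounded_measurable a b h :
  {within `[a, b], continuous h} -> bounded_measurable a b h.
Proof.
move=> ch; split.
- apply: measurable_realfun.subspace_continuous_measurable_fun => //.
  by apply: within_continuous_comp ch => z _; apply: continuous_Re.
- apply: measurable_realfun.subspace_continuous_measurable_fun => //.
  by apply: within_continuous_comp ch => z _; apply: continuous_Im.
- have [ab|ba] := leP a b; last first.
    by exists 0 => t /andP[at_ tb]; have := lt_le_trans ba (le_trans at_ tb); rewrite ltxx.
  have cm : {within `[a, b], continuous (modulus \o h)}.
    by apply: within_continuous_comp ch => z _; apply: continuous_modulus.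
  have [c cab cP] := EVT_max ab cm.
  by exists (modulus (h c)) => t tab; apply: cP; rewrite in_itv.
Qed.

Lemma eq_cint a b h1 h2 : (forall t, a <= t <= b -> h1 t = h2 t) ->
  cint a b h1 = cint a b h2.
Proof.
by move=> e; congr Complex; apply: eq_Rintegral => t; rewrite inE /= in_itv /= => /e ->.
Qed.

Lemma cintD a b h1 h2 : bounded_measurable a b h1 -> bounded_measurable a b h2 ->
  cint a b (fun t => h1 t + h2 t) = cint a b h1 + cint a b h2.
Proof.
move=> b1 b2; rewrite /cint /=; apply/eqP; rewrite eq_complex /=; apply/andP; split; apply/eqP.
- rewrite -RintegralD//=; [|exact: bounded_measurable_Re..].
  by apply: eq_Rintegral => t _; case: (h1 t) (h2 t) => [? ?] [? ?].
- rewrite -RintegralD//=; [|exact: bounded_measurable_Im..].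
  by apply: eq_Rintegral => t _; case: (h1 t) (h2 t) => [? ?] [? ?].
Qed.

Lemma cintM a b (z : C R) h : bounded_measurable a b h ->
  cint a b (fun t => z * h t) = z * cint a b h.
Proof.
move=> bh; have ir := bounded_measurable_Re bh; have ii := bounded_measurable_Im bh.
have iZ (x : R) (f : R -> R) : (lebesgue_measure : measure _ R).-integrable `[a, b] (EFin \o f) ->
    (lebesgue_measure : measure _ R).-integrable `[a, b] (EFin \o (fun t => x * f t)).
  move=> fi; rewrite (_ : EFin \o _ = (fun t => (x%:E * (EFin \o f) t)%E))//.
  exact: integrableZl.
case: z => x y; rewrite /cint /=; apply/eqP; rewrite eq_complex /=; apply/andP; split; apply/eqP.
- rewrite -!RintegralZl//= -RintegralB//=; [|exact: iZ..].
  by apply: eq_Rintegral => t _; case: (h t) => [? ?].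
- rewrite -!RintegralZl//= -RintegralD//=; [|exact: iZ..].
  by apply: eq_Rintegral => t _; case: (h t) => [? ?] /=.
Qed.

Lemma fine_lebesgue_itv a b : a <= b ->
  fine (lebesgue_measure (`[a, b]%classic : set R)) = b - a.
Proof.
move=> ab; rewrite lebesgue_measure_itv/= lte_fin.
by case: ltgtP ab => //= -> _; rewrite subrr.
Qed.

Lemma cint_cst a b (z : C R) : a <= b -> cint a b (fun=> z) = (b - a)%:C%C * z.
Proof.
move=> ab; rewrite /cint !Rintegral_cst// fine_lebesgue_itv//.
case: z => x y /=; apply/eqP; rewrite eq_complex /=; apply/andP; split; apply/eqP; ring.
Qed.

Lemma Rintegral_le_bound a b (f : R -> R) (B : R) : a <= b ->
  (lebesgue_measure : measure _ R).-integrable `[a, b] (EFin \o f) ->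
  (forall t, a <= t <= b -> `|f t| <= B) ->
  `| (\int[lebesgue_measure]_(t in `[a, b]) f t)%R | <= B * (b - a).
Proof.
move=> ab fi fB.
apply: le_trans (le_normr_Rintegral _ fi) _ => //.
have -> : B * (b - a) = (\int[lebesgue_measure]_(t in `[a, b]) (fun=> B) t)%R.
  by rewrite Rintegral_cst// fine_lebesgue_itv.
apply: le_Rintegral => //.
- by rewrite (_ : EFin \o _ = abse \o (EFin \o f))//; apply: integrable_abse.
- apply: bounded_measurable_integrable => //; by exists `|B|.
Qed.

Lemma Rintegral_ge (a b B : R) (f : R -> R) : a <= b ->
  (lebesgue_measure : measure _ R).-integrable `[a, b] (EFin \o f) ->
  (forall t, a <= t <= b -> B <= f t) ->
  B * (b - a) <= (\int[lebesgue_measure]_(t in `[a, b]) f t)%R.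
Proof.
move=> ab fi fB.
have -> : B * (b - a) = (\int[lebesgue_measure]_(t in `[a, b]) (fun=> B) t)%R.
  by rewrite Rintegral_cst// fine_lebesgue_itv.
apply: le_Rintegral => //.
apply: bounded_measurable_integrable => //; by exists `|B|.
Qed.

Lemma Rintegral_le (a b B : R) (f : R -> R) : a <= b ->
  (lebesgue_measure : measure _ R).-integrable `[a, b] (EFin \o f) ->
  (forall t, a <= t <= b -> f t <= B) ->
  (\int[lebesgue_measure]_(t in `[a, b]) f t)%R <= B * (b - a).
Proof.
move=> ab fi fB.
have -> : B * (b - a) = (\int[lebesgue_measure]_(t in `[a, b]) (fun=> B) t)%R.
  by rewrite Rintegral_cst// fine_lebesgue_itv.
apply: le_Rintegral => //.
apply: bounded_measurable_integrable => //; by exists `|B|.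
Qed.

Lemma cint_le a b h B : a <= b -> bounded_measurable a b h ->
  (forall t, a <= t <= b -> modulus (h t) <= B) ->
  modulus (cint a b h) <= 2 * B * (b - a).
Proof.
move=> ab bh hB; apply: le_trans (modulus_le_ReIm _) _ => /=.
rewrite mulrAC mulr2n mulrDl mul1r mulrDl mulrC; apply: lerD; apply: Rintegral_le_bound => //.
- exact: bounded_measurable_Re.
- by move=> t /hB; apply: le_trans; apply: Re_le_modulus.
- exact: bounded_measurable_Im.
- by move=> t /hB; apply: le_trans; apply: Im_le_modulus.
Qed.

Lemma Rintegral_cat a b c (f : R -> R) : a <= c -> c <= b ->
  (lebesgue_measure : measure _ R).-integrable `[a, b] (EFin \o f) ->
  (\int[lebesgue_measure]_(t in `[a, b]) f t =
  \int[lebesgue_measure]_(t in `[a, c]) f t + \int[lebesgue_measure]_(t in `[c, b]) f t)%R.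
Proof.
move=> ac cb fi.
have sp : `[a, b]%classic = `[a, c] `|` `]c, b].
  rewrite (itv_cc_split ac cb); apply/seteqP; split=> t; rewrite /= !in_itv /=.
    case=> [tac|/andP[]]; first by left.
    by rewrite le_eqVlt => /orP[/eqP <- _|-> ->]; [left; rewrite ac lexx|right].
  by case=> [|/andP[/ltW -> ->]]; [left|right].
have fi' := fi; rewrite sp in fi'.
have fi2 : (lebesgue_measure : measure _ R).-integrable `]c, b] (EFin \o f).
  by apply: integrableS fi => //; rewrite sp; apply: subsetUr.
rewrite sp Rintegral_setU//.
- by congr (_ + _); apply: Rintegral_itv_obnd_cbnd.
- apply/disj_setPS => t; rewrite /= !in_itv /= => -[/andP[_ tc] /andP[ct _]].
  by have := le_lt_trans tc ct; rewrite ltxx.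
Qed.

Lemma cint_cat a b c h : a <= c -> c <= b -> bounded_measurable a b h ->
  cint a b h = cint a c h + cint c b h.
Proof.
move=> ac cb bh; apply/eqP; rewrite eq_complex /=; apply/andP; split; apply/eqP.
- by apply: Rintegral_cat => //; exact: bounded_measurable_Re.
- by apply: Rintegral_cat => //; exact: bounded_measurable_Im.
Qed.

End ComplexIntegral.

(** * Integrals along contours as bounded linear functionals *)

Section ContourFunctional.
Context {R : realType}.
Implicit Types (G : set (C R)) (L : (C R -> C R) -> C R) (f g : C R -> C R).

Definition continuous_at_points G f := forall x, G x -> {for x, continuous f}.

(** What the Cauchy theory uses of an integral along a contour [G].  Both the
    boundaries of rectangles and the given parametrized level curves satisfy it,
    so that the properties of Cauchy transforms are proved once. *)
Record contour_functional G L : Prop := {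
  cf_compact : compact G;
  cf_add : forall f g, continuous_at_points G f -> continuous_at_points G g ->
    L (fun x => f x + g x) = L f + L g;
  cf_scale : forall (c : C R) f, continuous_at_points G f -> L (fun x => c * f x) = c * L f;
  cf_bound : exists2 V : R, 0 < V & forall f B, 0 <= B -> continuous_at_points G f ->
    (forall x, G x -> modulus (f x) <= B) -> modulus (L f) <= V * B }.

Lemma path_functional (a b : R) (p w : R -> C R) : a <= b ->
  {within `[a, b], continuous p} -> bounded_measurable a b w ->
  contour_functional (p @` `[a, b]) (fun f => cint a b (fun t => f (p t) * w t)).
Proof.
move=> ab cp bw.
have bm f : continuous_at_points (p @` `[a, b]) f ->
    bounded_measurable a b (fun t => f (p t)).
  move=> cf; apply: continuous_bounded_measurable.
  apply: (@within_continuous_comp _ _ _ `[a, b] p f) cp => x; rewrite inE; exact: cf.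
split.
- by apply: continuous_compact => //; apply: segment_compact.
- move=> f g cf cg; rewrite -cintD; [|by apply: bounded_measurableM => //; exact: bm..].
  by apply: eq_cint => t _; rewrite mulrDl.
- move=> c f cf; rewrite -cintM; last by apply: bounded_measurableM => //; exact: bm.
  by apply: eq_cint => t _; rewrite mulrA.
- have [_ _ [M hM]] := bw.
  exists (2 * (1 + `|M|) * (1 + (b - a))).
    have : 0 < 1 + `|M| by rewrite ltr_pwDl.
    have : 0 < 1 + (b - a) by rewrite ltr_pwDl// subr_ge0.
    by move=> h1 h2; rewrite !mulr_gt0.
  move=> f B B0 cf fB; apply: (@le_trans _ _ (2 * (B * `|M|) * (b - a))).
    apply: cint_le => //; first by apply: bounded_measurableM => //; exact: bm.
    move=> t tab; rewrite modulusM; apply: ler_pM; rewrite ?modulus_ge0//.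
      by apply: fB; exists t => //=; rewrite in_itv.
    by apply: le_trans (hM _ tab) _; rewrite ler_norm.
  have ba0 : 0 <= b - a by rewrite subr_ge0.
  have M0 : 0 <= `|M| by [].
  by nra.
Qed.

Lemma contour_functional_sum n (G : 'I_n -> set (C R)) (L : 'I_n -> (C R -> C R) -> C R) :
  (forall l, contour_functional (G l) (L l)) ->
  contour_functional (\bigcup_l G l) (fun f => \sum_(l < n) L l f).
Proof.
move=> H.
have cs f : continuous_at_points (\bigcup_l G l) f -> forall l, continuous_at_points (G l) f.
  by move=> cf l x Glx; apply: cf; exists l.
split.
- rewrite (_ : \bigcup_l G l = \big[setU/set0]_(l < n) G l).
    by apply: bigsetU_compact => l _; apply: cf_compact (H l).
  rewrite -bigcup_seq; apply: eq_bigcupl; split=> // l _.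
  by rewrite /= mem_index_enum.
- move=> f g /cs cf /cs cg; rewrite -big_split; apply: eq_bigr => l _.
  by rewrite (cf_add (H l)).
- move=> c f /cs cf; rewrite mulr_sumr; apply: eq_bigr => l _.
  by rewrite (cf_scale (H l)).
- have /choice[V HV] : forall l, exists V : R, 0 < V /\ forall f B, 0 <= B ->
      continuous_at_points (G l) f ->
      (forall x, G l x -> modulus (f x) <= B) -> modulus (L l f) <= V * B.
    by move=> l; have [V V0 HV] := cf_bound (H l); exists V.
  exists (1 + \sum_(l < n) V l).
    by rewrite ltr_pwDl// sumr_ge0// => l _; apply: ltW; have [] := HV l.
  move=> f B B0 cf fB; apply: le_trans (modulus_sum _ _ _) _.
  rewrite mulrDl mul1r mulr_suml -[leLHS]add0r; apply: lerD => //.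
  apply: ler_sum => l _; have [_ HVl] := HV l; apply: HVl => //; first exact: cs.
  by move=> x Gx; apply: fB; exists l.
Qed.

Lemma contour_functionalU G1 L1 G2 L2 :
  contour_functional G1 L1 -> contour_functional G2 L2 ->
  contour_functional (G1 `|` G2) (fun f => L1 f + L2 f).
Proof.
move=> H1 H2.
have cs f : continuous_at_points (G1 `|` G2) f ->
    continuous_at_points G1 f /\ continuous_at_points G2 f.
  by move=> cf; split=> x Gx; apply: cf; [left|right].
split.
- by apply: compactU; [exact: cf_compact H1|exact: cf_compact H2].
- move=> f g /cs[f1 f2] /cs[g1 g2].
  by rewrite (cf_add H1)// (cf_add H2)// addrACA.
- by move=> c f /cs[f1 f2]; rewrite (cf_scale H1)// (cf_scale H2)// mulrDr.
- have [V1 V10 HV1] := cf_bound H1; have [V2 V20 HV2] := cf_bound H2.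
  exists (V1 + V2) => [|f B B0 cf fB]; first exact: addr_gt0.
  apply: le_trans (modulusD _ _) _; rewrite mulrDl; apply: lerD.
    by apply: HV1 => // x Gx; [apply: cf|apply: fB]; left.
  by apply: HV2 => // x Gx; [apply: cf|apply: fB]; right.
Qed.

Lemma contour_functionalZ G L (c : C R) :
  contour_functional G L -> contour_functional G (fun f => c * L f).
Proof.
move=> H; split.
- exact: cf_compact H.
- by move=> f g cf cg; rewrite (cf_add H)// mulrDr.
- by move=> d f cf; rewrite (cf_scale H)// mulrCA.
- have [V V0 HV] := cf_bound H; exists (modulus c * V + V).
    by rewrite ltr_wpDl// mulr_ge0 ?modulus_ge0 ?ltW.
  move=> f B B0 cf fB; rewrite modulusM; have := HV f B B0 cf fB.
  have := modulus_ge0 c; have := modulus_ge0 (L f); nra.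
Qed.

End ContourFunctional.

(** * Piecewise C1 curves *)

Section PiecewiseC1.
Context {R : realType}.
Implicit Types (g h : R -> C R).

Lemma continuous_ReIm h t :
  {for t, continuous (fun s => complex.Re (h s) : R)} ->
  {for t, continuous (fun s => complex.Im (h s) : R)} -> {for t, continuous h}.
Proof.
move=> /cvgrPdist_lt cr /cvgrPdist_lt ci P /nbhs_modulusP[e e0 eP].
have e20 : 0 < e / 2 by rewrite divr_gt0.
apply: filterS2 (cr _ e20) (ci _ e20) => s /=.
rewrite distrC [in X in _ -> X -> _]distrC => h1 h2.
apply: eP; apply: le_lt_trans (modulus_le_ReIm _) _.
have -> : complex.Re (h s - h t) = complex.Re (h s) - complex.Re (h t).
  by case: (h s) (h t) => [? ?] [? ?].
have -> : complex.Im (h s - h t) = complex.Im (h s) - complex.Im (h t).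
  by case: (h s) (h t) => [? ?] [? ?].
move: h1 h2; lra.
Qed.

Lemma C1_continuous h : C1 h -> continuous h.
Proof.
move=> [dr di _] t; apply: continuous_ReIm.
- by apply: differentiable_continuous; apply/derivable1_diffP; exact: dr.
- by apply: differentiable_continuous; apply/derivable1_diffP; exact: di.
Qed.

Lemma near_eq_cderive1 g h t : (\forall s \near t, g s = h s) ->
  cderive1 g t = cderive1 h t.
Proof.
move=> gh; rewrite /cderive1 !derive1E; congr Complex; apply: near_eq_derive;
  by near=> s; congr (_ _); near: s.
Unshelve. all: by end_near. Qed.

(** Two functions that agree inside an interval may differ at its ends, as
    the derivatives of a curve and of its C1 pieces do. *)
Lemma bounded_measurable_open (a b : R) h1 h2 : (forall t, a < t < b -> h1 t = h2 t) ->
  bounded_measurable a b h1 -> bounded_measurable a b h2.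
Proof.
move=> e; have [ab|ba] := ltP a b; last first.
  move=> _; split.
  - have [->|ab] := eqVneq a b; first by rewrite set_itv1; exact: measurable_fun_set1.
    by rewrite set_itv_ge ?bnd_simp ?lt_geF ?lt_neqAle ?ba 1?eq_sym ?ab//;
      exact: measurable_fun_set0.
  - have [->|ab] := eqVneq a b; first by rewrite set_itv1; exact: measurable_fun_set1.
    by rewrite set_itv_ge ?bnd_simp ?lt_geF ?lt_neqAle ?ba 1?eq_sym ?ab//;
      exact: measurable_fun_set0.
  - exists (modulus (h2 a)) => t /andP[at_ tb].
    by have -> : t = a by apply/le_anti; rewrite at_ (le_trans tb ba).
have sp : `[a, b]%classic = [set a] `|` (`]a, b[ `|` [set b]).
  apply/seteqP; split=> t; rewrite /= !in_itv /=.
    move=> /andP[]; rewrite le_eqVlt => /orP[/eqP <-|at_]; first by left.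
    by rewrite le_eqVlt => /orP[/eqP ->|tb]; right; [right|left; rewrite at_].
  by case=> [->|[/andP[/ltW -> /ltW ->]|->]]; rewrite ?lexx ?ltW.
have m1 (f1 f2 : R -> R) : (forall t, a < t < b -> f1 t = f2 t) ->
    measurable_fun `[a, b] f1 -> measurable_fun `[a, b] f2.
  move=> f12; rewrite sp => /measurable_funU => H.
  have [//|//|_ ] := H; first exact: measurableU.
  move=> /measurable_funU H2; have [//|//|m1 _] := H2.
  apply/measurable_funU => //; first exact: measurableU.
  split; first exact: measurable_fun_set1.
  apply/measurable_funU => //; split; last exact: measurable_fun_set1.
  by apply: eq_measurable_fun m1 => t; rewrite inE /= in_itv; exact: f12.
move=> [mr mi [M hM]]; split.
- by apply: m1 mr => t /e ->.
- by apply: m1 mi => t /e ->.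
- exists (Num.max M (Num.max (modulus (h2 a)) (modulus (h2 b)))) => t /andP[].
  rewrite le_eqVlt => /orP[/eqP <-|at_]; first by rewrite !le_max lexx !orbT.
  rewrite le_eqVlt => /orP[/eqP ->|tb]; first by rewrite !le_max lexx !orbT.
  by rewrite -e ?at_// le_max hM// !ltW.
Qed.

(** By induction on the subdivision, gluing one closed piece at a time. *)
Lemma piecewise_C1P g : piecewise_C1 g ->
  {within `[0, 1], continuous g} /\ bounded_measurable 0 1 (cderive1 g).
Proof.
move=> [s [ps /eqP sl] Hs].
pose p i := nth 0 (0 :: s) i.
have pS i : (i < size s)%N -> p i < p i.+1 by move=> si; exact: (pathP 0 ps).
suff H i : (i <= size s)%N -> [/\ 0 <= p i, {within `[0, p i], continuous g}
    & bounded_measurable 0 (p i) (cderive1 g)].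
  have [_ cg bg] := H _ (leqnn _).
  have p1 : p (size s) = 1 by rewrite -sl; exact: (nth_last 0 (0 :: s)).
  by rewrite p1 in cg bg.
elim: i => [_|i IH si].
  split=> //=.
    by rewrite set_itv1; exact: continuous_subspace1.
  apply: (@bounded_measurable_open _ _ (fun=> 0)); last exact: bounded_measurable_cst.
  by move=> t /andP[t0 t1]; have := lt_trans t0 t1; rewrite ltxx.
have [pi0 cg bg] := IH (ltnW si).
have lp := pS i si.
have [h Ch gh] := Hs i si.
split; first exact: le_trans (ltW lp).
- rewrite (itv_cc_split pi0 (ltW lp)); apply: withinU_continuous;
    [exact: itv_closed|exact: itv_closed|exact: cg|].
  apply: (@subspace_eq_continuous _ _ _ h); first by move=> t; rewrite inE /= in_itv => /gh.
  by apply: continuous_subspaceT; exact: C1_continuous.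
- apply: bounded_measurable_cat pi0 (ltW lp) bg _.
  apply: (@bounded_measurable_open _ _ (cderive1 h)).
    move=> t tp; apply/esym/near_eq_cderive1.
    have : t \in `]p i, p i.+1[ by rewrite in_itv.
    move=> /near_in_itvoo; apply: filterS => u; rewrite in_itv /= => /andP[u1 u2].
    by apply: gh; rewrite !ltW.
  apply: continuous_bounded_measurable; apply: continuous_subspaceT.
  by case: Ch.
Qed.

Lemma contour_integral_functional n (g : 'I_n -> R -> C R) :
  (forall l, closed_Jordan_curve (g l)) ->
  contour_functional (\bigcup_l (g l @` `[0, 1])) (contour_integral g).
Proof.
move=> Hg; apply: contour_functional_sum => l.
have [/piecewise_C1P[cg bg] _ _] := Hg l.
exact: path_functional.
Qed.

End PiecewiseC1.

(** * Goursat's theorem for rectangles *)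

Section Rectangles.
Context {R : realType}.
Implicit Types (a b c d x y : R) (f g : C R -> C R).

Definition rect a b c d : set (C R) :=
  [set z | a <= complex.Re z <= b /\ c <= complex.Im z <= d].

Definition rectint a b c d f : C R :=
  cint a b (fun x => f (Complex x c)) + (-1) * cint a b (fun x => f (Complex x d))
  + ('i%C * cint c d (fun y => f (Complex b y))
     + (- 'i%C) * cint c d (fun y => f (Complex a y))).

Definition rect_boundary a b c d : set (C R) :=
  ((fun x => Complex x c) @` `[a, b]) `|` ((fun x => Complex x d) @` `[a, b])
  `|` (((fun y => Complex b y) @` `[c, d]) `|` ((fun y => Complex a y) @` `[c, d])).

Lemma rect_boundary_sub a b c d : a <= b -> c <= d -> rect_boundary a b c d `<=` rect a b c d.
Proof.
move=> ab cd z [[|]|[|]] [t /=]; rewrite in_itv /= => tab <-; split=> //=;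
  by rewrite ?lexx ?ab ?cd.
Qed.

Lemma continuous_horizontal c : continuous (fun x : R => Complex x c : C R).
Proof.
by move=> x; apply: continuous_ReIm => /=; [exact: cvg_id|exact: cvg_cst].
Qed.

Lemma continuous_vertical c : continuous (fun x : R => Complex c x : C R).
Proof.
by move=> x; apply: continuous_ReIm => /=; [exact: cvg_cst|exact: cvg_id].
Qed.

Lemma edge_functional a b (p : R -> C R) : a <= b -> continuous p ->
  contour_functional (p @` `[a, b]) (fun f => cint a b (fun t => f (p t))).
Proof.
move=> ab cp.
rewrite (_ : (fun _ => _) = (fun f => cint a b (fun t => f (p t) * (fun=> 1) t))).
  by apply: path_functional => //; [exact: continuous_subspaceT|exact: bounded_measurable_cst].
by apply: funext => f; apply: eq_cint => t _; rewrite mulr1.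
Qed.

Lemma rect_functional a b c d : a <= b -> c <= d ->
  contour_functional (rect_boundary a b c d) (rectint a b c d).
Proof.
move=> ab cd; apply: contour_functionalU; apply: contour_functionalU.
- by apply: edge_functional => //; exact: continuous_horizontal.
- by apply: contour_functionalZ; apply: edge_functional => //; exact: continuous_horizontal.
- by apply: contour_functionalZ; apply: edge_functional => //; exact: continuous_vertical.
- by apply: contour_functionalZ; apply: edge_functional => //; exact: continuous_vertical.
Qed.

Lemma continuous_at_points_sub (G H : set (C R)) f : G `<=` H ->
  continuous_at_points H f -> continuous_at_points G f.
Proof. by move=> GH cf x /GH; exact: cf. Qed.

Lemma edge_bounded_measurable a b (p : R -> C R) f : continuous p ->
  continuous_at_points (p @` `[a, b]) f -> bounded_measurable a b (fun t => f (p t)).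
Proof.
move=> cp cf; apply: continuous_bounded_measurable.
apply: (@within_continuous_comp _ _ _ `[a, b] p f); last exact: continuous_subspaceT.
by move=> x; rewrite inE; exact: cf.
Qed.

Lemma bounded_measurable_bottom a b c d f : continuous_at_points (rect_boundary a b c d) f ->
  bounded_measurable a b (fun x => f (Complex x c)).
Proof.
move=> cf; apply: (edge_bounded_measurable (@continuous_horizontal c)).
by apply: continuous_at_points_sub cf => z zE; left; left.
Qed.

Lemma bounded_measurable_top a b c d f : continuous_at_points (rect_boundary a b c d) f ->
  bounded_measurable a b (fun x => f (Complex x d)).
Proof.
move=> cf; apply: (edge_bounded_measurable (@continuous_horizontal d)).
by apply: continuous_at_points_sub cf => z zE; left; right.
Qed.

Lemma bounded_measurable_left a b c d f : continuous_at_points (rect_boundary a b c d) f ->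
  bounded_measurable c d (fun y => f (Complex a y)).
Proof.
move=> cf; apply: (edge_bounded_measurable (@continuous_vertical a)).
by apply: continuous_at_points_sub cf => z zE; right; right.
Qed.

Lemma bounded_measurable_right a b c d f : continuous_at_points (rect_boundary a b c d) f ->
  bounded_measurable c d (fun y => f (Complex b y)).
Proof.
move=> cf; apply: (edge_bounded_measurable (@continuous_vertical b)).
by apply: continuous_at_points_sub cf => z zE; right; left.
Qed.

Lemma rectint_split_Re a b c d x f : a <= x -> x <= b -> c <= d ->
  continuous_at_points (rect a b c d) f ->
  rectint a b c d f = rectint a x c d f + rectint x b c d f.
Proof.
move=> ax xb cd /(continuous_at_points_sub (rect_boundary_sub (le_trans ax xb) cd)) cf.
rewrite /rectint (cint_cat ax xb (bounded_measurable_bottom cf))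
  (cint_cat ax xb (bounded_measurable_top cf)).
ring.
Qed.

Lemma rectint_split_Im a b c d y f : a <= b -> c <= y -> y <= d ->
  continuous_at_points (rect a b c d) f ->
  rectint a b c d f = rectint a b c y f + rectint a b y d f.
Proof.
move=> ab cy yd /(continuous_at_points_sub (rect_boundary_sub ab (le_trans cy yd))) cf.
rewrite /rectint (cint_cat cy yd (bounded_measurable_left cf))
  (cint_cat cy yd (bounded_measurable_right cf)).
ring.
Qed.

Lemma rectint_le a b c d f B : a <= b -> c <= d ->
  continuous_at_points (rect_boundary a b c d) f ->
  (forall z, rect_boundary a b c d z -> modulus (f z) <= B) ->
  modulus (rectint a b c d f) <= 4 * B * ((b - a) + (d - c)).
Proof.
move=> ab cd cf fB.
have mi : modulus ('i%C : C R) = 1.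
  by rewrite /modulus normc_def /= expr0n /= add0r expr1n sqrtr1.
have h1 : modulus (cint a b (fun x => f (Complex x c))) <= 2 * B * (b - a).
  apply: cint_le => //; first exact: bounded_measurable_bottom cf.
  by move=> t tab; apply: fB; left; left; exists t => //=; rewrite in_itv.
have h2 : modulus (cint a b (fun x => f (Complex x d))) <= 2 * B * (b - a).
  apply: cint_le => //; first exact: bounded_measurable_top cf.
  by move=> t tab; apply: fB; left; right; exists t => //=; rewrite in_itv.
have h3 : modulus (cint c d (fun x => f (Complex b x))) <= 2 * B * (d - c).
  apply: cint_le => //; first exact: bounded_measurable_right cf.
  by move=> t tab; apply: fB; right; left; exists t => //=; rewrite in_itv.
have h4 : modulus (cint c d (fun x => f (Complex a x))) <= 2 * B * (d - c).
  apply: cint_le => //; first exact: bounded_measurable_left cf.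
  by move=> t tab; apply: fB; right; right; exists t => //=; rewrite in_itv.
apply: le_trans (modulusD _ _) _.
apply: le_trans (lerD (modulusD _ _) (modulusD _ _)) _.
rewrite !modulusM !modulusN mi modulus1 !mul1r.
move: h1 h2 h3 h4; move: (modulus _) (modulus _) (modulus _) (modulus _) => u v s t; lra.
Qed.

Lemma continuous_affine (u v : C R) : continuous (fun z : C R => u + v * z).
Proof.
move=> z; apply: (@continuousD _ _ _ (fun=> u) (fun z => v * z)).
  exact: cst_continuous.
by apply: (@continuousM _ _ (fun=> v) id); [exact: cst_continuous|exact: cvg_id].
Qed.

(** On opposite edges an affine function differs by a constant, and the two
    constants contribute opposite multiples of the area. *)
Lemma rectint_affine a b c d (u v : C R) : a <= b -> c <= d ->
  rectint a b c d (fun z => u + v * z) = 0.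
Proof.
move=> ab cd.
have cf : continuous_at_points (rect_boundary a b c d) (fun z : C R => u + v * z).
  by move=> z _; exact: continuous_affine.
have e1 : cint a b (fun x => u + v * Complex x c) =
    cint a b (fun x => u + v * Complex x d) + (b - a)%:C%C * (v * ('i%C * (c - d)%:C%C)).
  rewrite -cint_cst// -cintD; [|exact: (bounded_measurable_top cf)|exact: bounded_measurable_cst].
  apply: eq_cint => t _; rewrite -addrA -mulrDr; congr (_ + _ * _).
  by apply/eqP; rewrite eq_complex /=; apply/andP; split; apply/eqP; ring.
have e2 : cint c d (fun y => u + v * Complex b y) =
    cint c d (fun y => u + v * Complex a y) + (d - c)%:C%C * (v * (b - a)%:C%C).
  rewrite -cint_cst// -cintD; [|exact: (bounded_measurable_left cf)|exact: bounded_measurable_cst].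
  apply: eq_cint => t _; rewrite -addrA -mulrDr; congr (_ + _ * _).
  by apply/eqP; rewrite eq_complex /=; apply/andP; split; apply/eqP; ring.
rewrite /rectint e1 e2 -[d - c]opprB rmorphN /=; ring.
Qed.

Lemma rect_sub a b c d a' b' c' d' : a <= a' -> b' <= b -> c <= c' -> d' <= d ->
  rect a' b' c' d' `<=` rect a b c d.
Proof.
move=> aa bb cc dd z [/andP[h1 h2] /andP[h3 h4]].
by split; rewrite (le_trans _ h1, le_trans _ h3)// (le_trans h2, le_trans h4).
Qed.

Lemma rect_modulus a b c d z w : rect a b c d z -> rect a b c d w ->
  modulus (z - w) <= (b - a) + (d - c).
Proof.
case: z w => [zx zy] [wx wy] [/= /andP[h1 h2] /andP[h3 h4]] [/= /andP[h5 h6] /andP[h7 h8]].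
apply: le_trans (modulus_le_ReIm _) _ => /=.
by apply: lerD; rewrite ler_norml; lra.
Qed.

(** The integrals around the four quarters add up to the integral around the
    rectangle, so that one of them has at least a quarter of its modulus. *)
Lemma rectint_quarter x y s t f (e : R) : 0 <= s -> 0 <= t ->
  continuous_at_points (rect x (x + s) y (y + t)) f ->
  e <= modulus (rectint x (x + s) y (y + t) f) ->
  exists x' y', [/\ x <= x' <= x + s / 2, y <= y' <= y + t / 2 &
    e / 4 <= modulus (rectint x' (x' + s / 2) y' (y' + t / 2) f)].
Proof.
move=> s0 t0 cf he.
have sub x' y' : x <= x' <= x + s / 2 -> y <= y' <= y + t / 2 ->
    continuous_at_points (rect x' (x' + s / 2) y' (y' + t / 2)) f.
  move=> h1 h2; apply: continuous_at_points_sub cf; apply: rect_sub; lra.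
have hx0 : x <= x <= x + s / 2 by lra.
have hx1 : x <= x + s / 2 <= x + s / 2 by lra.
have hy0 : y <= y <= y + t / 2 by lra.
have hy1 : y <= y + t / 2 <= y + t / 2 by lra.
have hx2 : x <= x + s / 2 by lra.
have hx3 : x + s / 2 <= x + s by lra.
have hy2 : y <= y + t / 2 by lra.
have hy3 : y + t / 2 <= y + t by lra.
have E : rectint x (x + s) y (y + t) f =
    rectint x (x + s / 2) y (y + t / 2) f +
    rectint x (x + s / 2) (y + t / 2) (y + t / 2 + t / 2) f +
    (rectint (x + s / 2) (x + s / 2 + s / 2) y (y + t / 2) f +
     rectint (x + s / 2) (x + s / 2 + s / 2) (y + t / 2) (y + t / 2 + t / 2) f).
  have -> : x + s / 2 + s / 2 = x + s by lra.
  have -> : y + t / 2 + t / 2 = y + t by lra.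
  have cl : continuous_at_points (rect x (x + s / 2) y (y + t)) f.
    by apply: continuous_at_points_sub cf; apply: rect_sub.
  have cr : continuous_at_points (rect (x + s / 2) (x + s) y (y + t)) f.
    by apply: continuous_at_points_sub cf; apply: rect_sub.
  have yt : y <= y + t by rewrite lerDl.
  have e1 := rectint_split_Re hx2 hx3 yt cf.
  by rewrite e1 (rectint_split_Im hx2 hy2 hy3 cl) (rectint_split_Im hx3 hy2 hy3 cr).
have := le_trans he (le_trans (eq_ind _ (fun z => modulus z <= _) (le_trans (modulusD _ _)
  (lerD (modulusD _ _) (modulusD _ _))) _ (esym E)) (lexx _)).
case: (leP (e / 4) (modulus (rectint x (x + s / 2) y (y + t / 2) f))) => h1.
  by move=> _; exists x, y.
case: (leP (e / 4) (modulus (rectint x (x + s / 2) (y + t / 2) (y + t / 2 + t / 2) f))) => h2.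
  by move=> _; exists x, (y + t / 2).
case: (leP (e / 4) (modulus (rectint (x + s / 2) (x + s / 2 + s / 2) y (y + t / 2) f))) => h3.
  by move=> _; exists (x + s / 2), y.
move=> h; exists (x + s / 2), (y + t / 2); split=> //.
rewrite leNgt; apply/negP => h4.
have := le_lt_trans h (ltrD (ltrD h1 h2) (ltrD h3 h4)).
by rewrite -!mulrDl ltr_pdivlMr//; move: (e) => e'; lra.
Qed.

Lemma nested_limit (u s : nat -> R) :
  (forall n, u n <= u n.+1 /\ u n.+1 + s n.+1 <= u n + s n) -> (forall n, 0 <= s n) ->
  exists x, forall n, u n <= x <= u n + s n.
Proof.
move=> H s0.
have up n k : u n <= u (n + k)%N /\ u (n + k)%N + s (n + k)%N <= u n + s n.
  elim: k => [|k [h1 h2]]; first by rewrite addn0.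
  by have [h3 h4] := H (n + k)%N; rewrite addnS; split; [exact: le_trans h3|exact: le_trans h2].
have cross n k : u n <= u k + s k.
  case: (leqP n k) => nk.
    by have [] := up n (k - n)%N; rewrite subnKC// => h1 _; apply: le_trans h1 _; rewrite lerDl.
  have [_] := up k (n - k)%N; rewrite subnKC 1?ltnW// => h2.
  by apply: le_trans h2; rewrite lerDl.
exists (sup (range u)) => n; apply/andP; split.
  apply: ub_le_sup; last by exists n.
  by exists (u 0%N + s 0%N) => _ [k _ <-].
apply: ge_sup; first by exists (u 0%N); exists 0%N.
by move=> _ [k _ <-].
Qed.

(** Goursat: if the integral around the rectangle were nonzero, repeated
    quartering would produce rectangles shrinking to a point whose integrals
    decay no faster than their areas, while the first order expansion of the
    function at that point makes them negligible with respect to their areas. *)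
Lemma goursat a b c d f : a <= b -> c <= d ->
  (forall z, rect a b c d z -> derivable f z 1) -> rectint a b c d f = 0.
Proof.
move=> ab cd df.
have cf : continuous_at_points (rect a b c d) f.
  by move=> z /df; exact: derivable_continuous.
apply/eqP; rewrite -modulus_eq0; apply/negP => /negP I0.
set eta := modulus _ in I0.
have eta0 : 0 < eta by rewrite lt_def I0 modulus_ge0.
pose s n := (b - a) / 2 ^+ n; pose t n := (d - c) / 2 ^+ n.
have s0 n : 0 <= s n by rewrite divr_ge0 ?exprn_ge0// subr_ge0.
have t0 n : 0 <= t n by rewrite divr_ge0 ?exprn_ge0// subr_ge0.
have sS n : s n.+1 = s n / 2 by rewrite /s exprSr invfM mulrA.
have tS n : t n.+1 = t n / 2 by rewrite /t exprSr invfM mulrA.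
pose inv n (p : R * R) := [/\ a <= p.1, p.1 + s n <= b, c <= p.2, p.2 + t n <= d &
  eta / 4 ^+ n <= modulus (rectint p.1 (p.1 + s n) p.2 (p.2 + t n) f)].
have step n p : exists q : R * R, inv n p -> inv n.+1 q /\
    (p.1 <= q.1 /\ q.1 + s n.+1 <= p.1 + s n) /\ (p.2 <= q.2 /\ q.2 + t n.+1 <= p.2 + t n).
  have [[h1 h2 h3 h4 h5]|] := pselect (inv n p); last by exists p.
  have cfn : continuous_at_points (rect p.1 (p.1 + s n) p.2 (p.2 + t n)) f.
    by apply: continuous_at_points_sub cf; exact: rect_sub.
  have [x [y [hx hy hxy]]] := rectint_quarter (s0 n) (t0 n) cfn h5.
  exists (x, y) => _; rewrite /inv /= sS tS exprSr invfM mulrA.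
  have := s0 n; have := t0 n; split; [split => //; lra|split; lra].
have /choice[F HF] : forall np : nat * (R * R), exists q : R * R, inv np.1 np.2 -> inv np.1.+1 q /\
    (np.2.1 <= q.1 /\ q.1 + s np.1.+1 <= np.2.1 + s np.1) /\
    (np.2.2 <= q.2 /\ q.2 + t np.1.+1 <= np.2.2 + t np.1) by case=> n p; exact: step.
pose u := fix u n := if n is k.+1 then F (k, u k) else (a, c).
have Hu n : inv n (u n).
  elim: n => [|n IH]; last by have [] := HF (n, u n) IH.
  rewrite /inv /= /s /t !expr0 !divr1 !lexx !subrKC; split=> //.
have [x Hx] : exists x, forall n, (u n).1 <= x <= (u n).1 + s n.
  by apply: nested_limit => // n; have [_ []] := HF (n, u n) (Hu n).
have [y Hy] : exists y, forall n, (u n).2 <= y <= (u n).2 + t n.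
  by apply: nested_limit => // n; have [_ []] := HF (n, u n) (Hu n).
pose p : C R := Complex x y.
have pn n : rect (u n).1 ((u n).1 + s n) (u n).2 ((u n).2 + t n) p by split=> /=.
have pr : rect a b c d p.
  have [h1 h2 h3 h4 _] := Hu 0%N; exact: rect_sub (pn 0%N).
have K0 : 0 <= (b - a) + (d - c) by lra.
set K := (b - a) + (d - c) in K0.
(* This tolerance makes the final bound smaller than [eta / 4 ^+ n]. *)
have [del del0 Hdel] := (continuous_modulusP _ _).1 (dq_continuous (df _ pr))
  (eta / (8 * (1 + K ^+ 2)))
  ltac:(by rewrite divr_gt0// mulr_gt0// ltr_wpDr// sqr_ge0).
set eps := eta / _ in Hdel.
have [n nK] : exists n, K / 2 ^+ n < del.
  have [n Kn] : exists n : nat, K / del < n%:R.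
    by exists (Num.bound (K / del)); apply: archi_boundP; rewrite divr_ge0// ltW.
  exists n; rewrite ltr_pdivrMr ?exprn_gt0// mulrC -ltr_pdivrMr//.
  by apply: lt_le_trans Kn _; rewrite -natrX ler_nat ltnW// ltn_expl.
have [h1 h2 h3 h4 h5] := Hu n.
have stn : s n + t n = K / 2 ^+ n by rewrite /s /t /K -mulrDl.
pose D := 'D_1 f p.
pose g z := (z - p) * (dq f p z - D).
(* The affine part has integral [0]; the rest is small relative to [z - p]. *)
have fEz z : f z = (f p - D * p + D * z) + g z.
  by rewrite /g -[LHS](subrK (f p)) (dqE f p z); ring.
have cfn : continuous_at_points (rect (u n).1 ((u n).1 + s n) (u n).2 ((u n).2 + t n)) f.
  by apply: continuous_at_points_sub cf; exact: rect_sub.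
have ca : continuous_at_points (rect (u n).1 ((u n).1 + s n) (u n).2 ((u n).2 + t n))
    (fun z => f p - D * p + D * z).
  by move=> z _; exact: continuous_affine.
have cg : continuous_at_points (rect (u n).1 ((u n).1 + s n) (u n).2 ((u n).2 + t n)) g.
  have -> : g = (fun z => f z - (f p - D * p + D * z)).
    by apply: funext => z; rewrite [f z]fEz; ring.
  by by move=> z zr; apply: (@continuousB _ _ _ f); [exact: cfn|exact: ca].
have bs := @rect_boundary_sub (u n).1 ((u n).1 + s n) (u n).2 ((u n).2 + t n)
  ltac:(by rewrite lerDl) ltac:(by rewrite lerDl).
have : modulus (rectint (u n).1 ((u n).1 + s n) (u n).2 ((u n).2 + t n) f) <=
    4 * (eps * (K / 2 ^+ n)) * (K / 2 ^+ n).
  have -> : f = (fun z => (f p - D * p + D * z) + g z) by exact: funext.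
  rewrite (cf_add (rect_functional _ _)) ?lerDl//; last 2 first.
  - exact: continuous_at_points_sub bs ca.
  - exact: continuous_at_points_sub bs cg.
  rewrite rectint_affine ?lerDl// add0r.
  have -> : 4 * (eps * (K / 2 ^+ n)) * (K / 2 ^+ n) = 4 * (eps * (K / 2 ^+ n)) *
      (((u n).1 + s n - (u n).1) + ((u n).2 + t n - (u n).2)).
    by congr (_ * _); rewrite -stn; ring.
  apply: rectint_le; [by rewrite lerDl|by rewrite lerDl| |].
    exact: continuous_at_points_sub bs cg.
  move=> z /bs zr.
  have zp : modulus (z - p) <= K / 2 ^+ n.
    rewrite -stn; apply: le_trans (rect_modulus zr (pn n)) _; rewrite le_eqVlt.
    by apply/orP; left; apply/eqP; ring.
  rewrite /g modulusM mulrC; apply: ler_pM; rewrite ?modulus_ge0//.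
  by rewrite ltW// /D -dqxx; apply: Hdel; exact: le_lt_trans nK.
move=> h6; have := le_trans h5 h6; rewrite /eps.
have -> : 4 * (eta / (8 * (1 + K ^+ 2)) * (K / 2 ^+ n)) * (K / 2 ^+ n) =
    (eta / 4 ^+ n) * (K ^+ 2 / (2 * (1 + K ^+ 2))).
  have -> : (4 : R) ^+ n = 2 ^+ n * 2 ^+ n by rewrite -exprMn; congr (_ ^+ _); ring.
  have : 1 + K ^+ 2 != 0 by rewrite gt_eqF// ltr_wpDr// sqr_ge0.
  have : (2 : R) ^+ n != 0 by rewrite expf_neq0.
  by move=> h7 h8; field; rewrite h7 h8.
rewrite -[leLHS]mulr1 ler_pM2l ?divr_gt0 ?exprn_gt0//.
rewrite ler_pdivlMr ?mulr_gt0 ?ltr_wpDr ?sqr_ge0// => h7.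
have := sqr_ge0 K; lra.
Qed.

End Rectangles.

(** * Cauchy transforms *)

Section CauchyTransform.
Context {R : realType}.
Implicit Types (G : set (C R)) (L : (C R -> C R) -> C R) (f g h : C R -> C R).

Lemma compact_complex_closed G : compact G -> closed G.
Proof. by apply: compact_closed; exact: norm_hausdorff. Qed.

Lemma continuous_on_compact_bounded G f : compact G -> continuous_at_points G f ->
  exists2 M : R, 0 < M & forall x, G x -> modulus (f x) <= M.
Proof.
move=> cG cf.
have : compact ((modulus \o f) @` G).
  apply: continuous_compact => //; apply: continuous_in_subspaceT => x; rewrite inE => Gx.
  by apply: continuous_comp; [exact: cf|exact: continuous_modulus].
move=> /compact_bounded[M [_ HM]]; exists (`|M| + 1); first by rewrite ltr_wpDl.
move=> x Gx; have := HM (`|M| + 1); rewrite (le_lt_trans (ler_norm M)) ?ltrDl// => /(_ isT).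
by move=> /(_ (modulus (f x))); rewrite /= ger0_norm ?modulus_ge0//; apply; exists x.
Qed.

(** A single radius controls the distance to [G] of all points near [z], which
    makes the estimates on Cauchy transforms locally uniform. *)
Lemma ball_off_compact G z : compact G -> ~ G z ->
  exists2 d : R, 0 < d & forall z' w, modulus (z' - z) < d -> G w -> d <= modulus (w - z').
Proof.
move=> /compact_complex_closed cG Gz.
have /open_modulusP/(_ _ Gz)[e e0 He] : open (~` G) by rewrite openC.
exists (e / 2); first by rewrite divr_gt0.
move=> z' w z'z Gw; rewrite leNgt; apply/negP => wz'.
apply: (He w) => //; apply: le_lt_trans (modulus_dist z' _ _) _; lra.
Qed.

Lemma continuous_inv_sub z w : w != z -> {for w, continuous (fun x : C R => (x - z)^-1)}.
Proof.
move=> wz; apply: (@continuousV _ _ (fun x => x - z)); first by rewrite subr_eq0.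
by apply: (@continuousB _ _ _ id (fun=> z)); [exact: cvg_id|exact: cst_continuous].
Qed.

Lemma continuous_at_points_quot G h z : ~ G z -> continuous_at_points G h ->
  continuous_at_points G (fun w => h w / (w - z)).
Proof.
move=> Gz ch w Gw; apply: (@continuousM _ _ h); first exact: ch.
by apply: continuous_inv_sub; apply/eqP => wz; apply: Gz; rewrite -wz.
Qed.

Lemma continuous_at_points_cst G (c : C R) : continuous_at_points G (fun=> c).
Proof. by move=> w _; exact: cst_continuous. Qed.

Lemma continuous_at_pointsD G f g : continuous_at_points G f ->
  continuous_at_points G g -> continuous_at_points G (fun w => f w + g w).
Proof.
by move=> cf cg w Gw; apply: (@continuousD _ _ _ f g w (cf w Gw) (cg w Gw)).
Qed.

Lemma continuous_at_pointsZ G f (c : C R) : continuous_at_points G f ->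
  continuous_at_points G (fun w => c * f w).
Proof.
by move=> cf w Gw; apply: (@continuousM _ _ (fun=> c) f w (@cst_continuous _ _ c w) (cf w Gw)).
Qed.

Lemma cf_eq G L f g : contour_functional G L -> continuous_at_points G f ->
  continuous_at_points G g -> (forall x, G x -> f x = g x) -> L f = L g.
Proof.
move=> HL cf cg fg.
have cg' := continuous_at_pointsZ (c := -1) cg.
have cfg := continuous_at_pointsD cf cg'.
have [V V0 HV] := cf_bound HL.
have := HV (fun x => f x + -1 * g x) 0 (lexx _) cfg.
rewrite mulr0 (cf_add HL cf cg') (cf_scale HL _ cg) mulN1r => H.
apply/eqP; rewrite -subr_eq0 -modulus_eq0 eq_le modulus_ge0 andbT; apply: H => x Gx.
by rewrite fg// mulN1r subrr modulus0.
Qed.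

Definition cauchy_transform L h z := L (fun w => h w / (w - z)).

(** The partial fraction identity
    [1 / (w - z') - 1 / (w - z) = (z' - z) / ((w - z) (w - z'))], integrated. *)
Lemma cauchy_transformB G L h z z' : contour_functional G L -> continuous_at_points G h ->
  ~ G z -> ~ G z' -> cauchy_transform L h z' - cauchy_transform L h z =
    (z' - z) * cauchy_transform L (fun w => h w / (w - z)) z'.
Proof.
move=> HL ch Gz Gz'; rewrite /cauchy_transform.
have c1 := continuous_at_points_quot Gz ch.
have c2 := continuous_at_points_quot Gz' ch.
have c3 := continuous_at_points_quot Gz' c1.
have c4 := continuous_at_pointsZ (c := z' - z) c3.
rewrite (cf_eq HL c2 (continuous_at_pointsD c4 c1)).
  by rewrite (cf_add HL c4 c1) (cf_scale HL _ c3) addrK.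
move=> w Gw.
have wz : w - z != 0 by rewrite subr_eq0; apply/eqP => wz; apply: Gz; rewrite -wz.
have wz' : w - z' != 0 by rewrite subr_eq0; apply/eqP => wzE; apply: Gz'; rewrite -wzE.
by field; rewrite wz wz'.
Qed.

Lemma cauchy_transform_le G L h z (d M : R) : contour_functional G L ->
  continuous_at_points G h -> 0 < d -> 0 <= M ->
  (forall w, G w -> d <= modulus (w - z)) -> (forall w, G w -> modulus (h w) <= M) ->
  forall V, (forall f B, 0 <= B -> continuous_at_points G f ->
    (forall x, G x -> modulus (f x) <= B) -> modulus (L f) <= V * B) ->
  modulus (cauchy_transform L h z) <= V * (M / d).
Proof.
move=> HL ch d0 M0 Hd HM V HV; apply: HV; first by rewrite divr_ge0// ltW.
  apply: continuous_at_points_quot => // Gz; have := Hd _ Gz.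
  by rewrite subrr modulus0 leNgt d0.
move=> w Gw; rewrite modulusM modulusV; apply: ler_pM; rewrite ?invr_ge0 ?modulus_ge0//.
  exact: HM.
by rewrite lef_pV2 ?posrE ?Hd// (lt_le_trans d0)// Hd.
Qed.

Lemma cauchy_transform_lipschitz G L h z : contour_functional G L ->
  continuous_at_points G h -> ~ G z ->
  exists K d : R, [/\ 0 < K, 0 < d & forall w w', modulus (w - z) < d -> modulus (w' - z) < d ->
    modulus (cauchy_transform L h w' - cauchy_transform L h w) <= K * modulus (w' - w)].
Proof.
move=> HL ch Gz.
have [M M0 HM] := continuous_on_compact_bounded (cf_compact HL) ch.
have [V V0 HV] := cf_bound HL.
have [d d0 Hd] := ball_off_compact (cf_compact HL) Gz.
exists (V * (M / d / d)), d; split=> //; first by rewrite !(mulr_gt0, divr_gt0)// invr_gt0.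
move=> w w' wz wz'.
have Gw : ~ G w by move=> /(Hd w w wz); rewrite subrr modulus0 leNgt d0.
have Gw' : ~ G w' by move=> /(Hd w' w' wz'); rewrite subrr modulus0 leNgt d0.
rewrite (cauchy_transformB HL ch Gw Gw') modulusM mulrC ler_wpM2r ?modulus_ge0//.
have c1 := continuous_at_points_quot Gw ch.
have Md0 : 0 <= M / d by rewrite divr_ge0// ltW.
apply: (cauchy_transform_le HL c1 d0 Md0 _ _ HV).
- by move=> x Gx; exact: Hd Gx.
- move=> x Gx; rewrite modulusM modulusV; apply: ler_pM; rewrite ?invr_ge0 ?modulus_ge0//.
    exact: HM.
  by rewrite lef_pV2 ?posrE ?(Hd w)// (lt_le_trans d0)// (Hd w).
Qed.

Lemma cauchy_transform_continuous G L h z : contour_functional G L ->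
  continuous_at_points G h -> ~ G z -> {for z, continuous (cauchy_transform L h)}.
Proof.
move=> HL ch Gz; have [K [d [K0 d0 H]]] := cauchy_transform_lipschitz HL ch Gz.
apply/continuous_modulusP => e e0; exists (Num.min d (e / K)).
  by rewrite lt_min d0 divr_gt0.
move=> w; rewrite lt_min => /andP[wd we].
apply: le_lt_trans (H z w _ wd) _; first by rewrite subrr modulus0.
by rewrite mulrC -ltr_pdivlMr.
Qed.

Lemma is_derive_cauchy_transform G L h z : contour_functional G L ->
  continuous_at_points G h -> ~ G z ->
  is_derive z 1 (cauchy_transform L h) (cauchy_transform L (fun w => h w / (w - z)) z).
Proof.
move=> HL ch Gz.
apply: (caratheodory (q := cauchy_transform L (fun w => h w / (w - z)))); last first.
  exact: cauchy_transform_continuous HL (continuous_at_points_quot Gz ch) Gz.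
have [d d0 Hd] := ball_off_compact (cf_compact HL) Gz.
apply/nbhs_modulusP; exists d => // w wz; apply: (cauchy_transformB HL ch Gz).
by move=> /(Hd w w wz); rewrite subrr modulus0 leNgt d0.
Qed.

Lemma cauchy_transform_infty G L h : contour_functional G L ->
  continuous_at_points G h -> forall e : R, 0 < e -> exists2 r : R, 0 < r &
    forall z, r < modulus z -> ~ G z /\ modulus (cauchy_transform L h z) < e.
Proof.
move=> HL ch e e0.
have [M M0 HM] := continuous_on_compact_bounded (cf_compact HL) ch.
have [r r0 Hr] := continuous_on_compact_bounded (f := id) (cf_compact HL) (fun x _ => @cvg_id _ _).
have [V V0 HV] := cf_bound HL.
pose d := V * M / e + 1.
have d0 : 0 < d by rewrite ltr_wpDl// divr_ge0 ?mulr_ge0 ?ltW.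
exists (r + d) => [|z rz]; first exact: addr_gt0.
have Hd w : G w -> d <= modulus (w - z).
  move=> Gw; rewrite modulusB; apply: le_trans (modulusBl _ _).
  have := Hr _ Gw => /=; lra.
split; first by move=> /Hd; rewrite subrr modulus0 leNgt d0.
apply: le_lt_trans (cauchy_transform_le HL ch d0 (ltW M0) Hd HM HV) _.
by rewrite mulrA ltr_pdivrMr// [ltRHS]mulrC -ltr_pdivrMr// ltrDl.
Qed.

End CauchyTransform.

(** * Local theory of holomorphic functions *)

Section LocalTheory.
Context {R : realType}.
Implicit Types (f g h : C R -> C R) (Om : set (C R)).

Lemma derivable_affine_sub (z w : C R) : derivable (fun x : C R => x - z) w 1.
Proof. have : is_derive w 1 (fun x : C R => x - z) ((fun=> 1) w).
  apply: caratheodory; last exact: cst_continuous.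
  by apply: (filterS _ (@filterT _ (nbhs w) _)) => x _; rewrite mulr1; ring.
by case. Qed.

Lemma derivable_funV (f : C R -> C R) (z : C R) : f z != 0 -> derivable f z 1 ->
  derivable (fun w => (f w)^-1) z 1.
Proof. by move=> fz df; exact: derivableV. Qed.

Lemma derivable_funM (f g : C R -> C R) (z : C R) : derivable f z 1 -> derivable g z 1 ->
  derivable (fun w => f w * g w) z 1.
Proof. by move=> df dg; exact: (@derivableM _ _ f g z 1 df dg). Qed.

Lemma derivable_quot f (z w c : C R) : w != z -> derivable f w 1 ->
  derivable (fun x => (f x - c) / (x - z)) w 1.
Proof.
move=> wz df; apply: (@derivableM _ _ (fun x => f x - c) (fun x => (x - z)^-1)).
  exact: (@derivableB _ _ _ f (fun=> c) w 1 df (derivable_cst _ _ _)).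
by apply: derivableV; [rewrite subr_eq0|exact: derivable_affine_sub].
Qed.

Lemma near_neq (z w : C R) : w != z -> \forall x \near w, x != z.
Proof.
move=> wz; apply/nbhs_modulusP; exists (modulus (z - w)).
  by rewrite modulus_gt0 subr_eq0 eq_sym.
by move=> x; apply: contraTneq => ->; rewrite ltxx.
Qed.

Lemma derivable_dq_off f (z w : C R) : w != z -> derivable f w 1 -> derivable (dq f z) w 1.
Proof.
move=> wz df; have H := derivable_quot (c := f z) wz df.
apply: (@near_eq_derivable _ _ _ (fun x => (f x - f z) / (x - z)) (dq f z) w 1 _ H).
by apply: filterS (near_neq wz) => x xz; rewrite /dq (negbTE xz).
Qed.

Lemma dq_continuous_at f (z w : C R) : derivable f z 1 -> derivable f w 1 ->
  {for w, continuous (dq f z)}.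
Proof.
move=> dfz dfw; have [->|wz] := eqVneq w z; first exact: dq_continuous.
by apply: derivable_continuous; exact: derivable_dq_off.
Qed.

(** An isolated point at which a continuous function need not be
    differentiable does not affect Goursat's theorem: the integral equals the
    one around an arbitrarily small square centred at that point. *)
Lemma goursat_except (a b c d : R) f (p : C R) :
  a < complex.Re p < b -> c < complex.Im p < d ->
  continuous_at_points (rect a b c d) f ->
  (forall z, rect a b c d z -> z != p -> derivable f z 1) ->
  rectint a b c d f = 0.
Proof.
case: p => px py /= /andP[ax xb] /andP[cy yd] cf df.
(* Cut off the four strips around the square of half side [e] centred at [p]. *)
have shrink e : 0 < e -> a <= px - e -> px + e <= b -> c <= py - e -> py + e <= d ->
    rectint a b c d f = rectint (px - e) (px + e) (py - e) (py + e) f.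
  move=> e0 h1 h2 h3 h4.
  have k1 : px - e <= b by lra.
  have k2 : px - e <= px + e by lra.
  have k3 : py - e <= d by lra.
  have k4 : py - e <= py + e by lra.
  have cd : c <= d by lra.
  have k5 : c <= py + e by lra.
  have zero a' b' c' d' : a <= a' -> b' <= b -> c <= c' -> d' <= d -> a' <= b' -> c' <= d' ->
      [|| px < a', b' < px, py < c' | d' < py] -> rectint a' b' c' d' f = 0.
    move=> l1 l2 l3 l4 l5 l6 out; apply: goursat => // z zr; apply: df.
      exact: rect_sub zr.
    apply/eqP => zE; move: zr out; rewrite zE => -[/= /andP[m1 m2] /andP[m3 m4]].
    by rewrite !ltNge m1 m2 m3 m4.
  rewrite (rectint_split_Re h1 k1 cd cf).
  rewrite (zero a (px - e)) ?lexx//; last by rewrite !(ltrBlDr, ltrDl) e0 ?orbT.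
  have cf1 : continuous_at_points (rect (px - e) b c d) f.
    by apply: continuous_at_points_sub cf; apply: rect_sub.
  rewrite add0r (rectint_split_Re k2 h2 cd cf1).
  rewrite (zero (px + e) b) ?lexx//; [|lra|by rewrite ltrDl e0].
  have cf2 : continuous_at_points (rect (px - e) (px + e) c d) f.
    by apply: continuous_at_points_sub cf; apply: rect_sub.
  rewrite addr0 (rectint_split_Im k2 h3 k3 cf2).
  rewrite (zero (px - e) (px + e) c (py - e)) ?lexx//; last by rewrite !(ltrBlDr, ltrDl) e0 ?orbT.
  have cf3 : continuous_at_points (rect (px - e) (px + e) (py - e) d) f.
    by apply: continuous_at_points_sub cf; apply: rect_sub.
  rewrite add0r (rectint_split_Im k2 k4 h4 cf3).
  by rewrite (zero (px - e) (px + e) (py + e) d) ?addr0 ?lexx// !ltrDl e0 !orbT.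
pose p : C R := Complex px py.
have pr : rect a b c d p by split; rewrite /= !ltW.
have [del del0 Hdel] := (continuous_modulusP _ _).1 (cf _ pr) 1 ltr01.
apply/eqP; rewrite -modulus_eq0; apply/negP => /negP I0.
set eta := modulus _ in I0.
have eta0 : 0 < eta by rewrite lt_def I0 modulus_ge0.
pose B := modulus (f p) + 1.
have B0 : 0 < B by rewrite ltr_wpDl// modulus_ge0.
pose e := Num.min (Num.min (Num.min (px - a) (b - px)) (Num.min (py - c) (d - py)))
   (Num.min (del / 8) (eta / (32 * B))).
have e0 : 0 < e by rewrite !lt_min !subr_gt0 ax xb cy yd !divr_gt0// mulr_gt0.
have : e <= e by [].
rewrite {2}/e !le_min => /andP[/andP[/andP[e1 e2] /andP[e3 e4]] /andP[e5 e6]].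
have : eta <= 4 * B * (((px + e) - (px - e)) + ((py + e) - (py - e))).
  rewrite /eta (shrink e e0); [|clear -e1; lra|clear -e2; lra|clear -e3; lra|clear -e4; lra].
  have sub : rect (px - e) (px + e) (py - e) (py + e) `<=` rect a b c d.
    by apply: rect_sub; [clear -e1; lra|clear -e2; lra|clear -e3; lra|clear -e4; lra].
  have bs := @rect_boundary_sub _ (px - e) (px + e) (py - e) (py + e)
    ltac:(clear -e0; lra) ltac:(clear -e0; lra).
  apply: rectint_le; [clear -e0; lra|clear -e0; lra| |].
    exact: continuous_at_points_sub (subset_trans bs sub) cf.
  move=> z /bs zr; have : modulus (z - p) < del.
    apply: le_lt_trans (rect_modulus zr (_ : rect _ _ _ _ p)) _.
      by split => /=; clear -e0; lra.
    by clear -e0 e5 del0; lra.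
  by move=> /Hdel /ltW h; rewrite /B addrC -lerBlDr; apply: le_trans h; exact: modulusBl.
have -> : 4 * B * (((px + e) - (px - e)) + ((py + e) - (py - e))) = (32 * B) * e / 2 by field.
rewrite leNgt => /negP; apply.
have : (32 * B) * e <= eta by rewrite mulrC -ler_pdivlMr// mulr_gt0.
move=> h; apply: (@le_lt_trans _ _ (eta / 2)); first by rewrite ler_pM2r.
by rewrite ltr_pdivrMr// ltr_pMr// ltr1n.
Qed.

(** Cauchy's integral formula.  The integral of [(w - z)^-1] is kept as a
    factor; a lower bound for it at the centre of a square is enough to divide by it. *)
Lemma cauchy_rect (a b c d : R) f z :
  a < complex.Re z < b -> c < complex.Im z < d ->
  (forall w, rect a b c d w -> derivable f w 1) ->
  f z * cauchy_transform (rectint a b c d) (fun=> 1) z =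
    cauchy_transform (rectint a b c d) f z.
Proof.
move=> zab zcd df.
have [ab cd] : a <= b /\ c <= d by clear -zab zcd; split; lra.
have zr : rect a b c d z by clear -zab zcd; split; lra.
have HL := rect_functional ab cd.
have bs := rect_boundary_sub ab cd.
have Gz : ~ rect_boundary a b c d z.
  by clear -zab zcd; case=> -[|] [t /=] _ tz; move: zab zcd; rewrite -tz /= ?ltxx ?andbF.
have c0 : continuous_at_points (rect a b c d) (dq f z).
  by move=> w wr; apply: dq_continuous_at; exact: df.
have I0 : rectint a b c d (dq f z) = 0.
  by apply: (@goursat_except _ _ _ _ _ z) => // w wr wz; apply: derivable_dq_off => //; exact: df.
have cf : continuous_at_points (rect_boundary a b c d) f.
  by move=> w /bs/df; exact: derivable_continuous.
have c1 := continuous_at_points_quot Gz (@continuous_at_points_cst R _ 1).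
have cz := continuous_at_pointsZ (c := f z) c1.
have cq := continuous_at_points_sub bs c0.
rewrite /cauchy_transform (cf_eq HL (continuous_at_points_quot Gz cf)
  (continuous_at_pointsD cz cq)).
  by rewrite (cf_add HL cz cq) I0 addr0 (cf_scale HL _ c1).
move=> w Gw.
have wz : w != z by apply/eqP => wz; apply: Gz; rewrite -wz.
have := wz; rewrite -subr_eq0 => wz0.
rewrite /dq (negbTE wz); field; exact: wz0.
Qed.

Definition square (p : C R) (r : R) := rect (complex.Re p - r) (complex.Re p + r)
  (complex.Im p - r) (complex.Im p + r).
Definition square_boundary (p : C R) (r : R) := rect_boundary (complex.Re p - r) (complex.Re p + r)
  (complex.Im p - r) (complex.Im p + r).
Definition squareint (p : C R) (r : R) := rectint (complex.Re p - r) (complex.Re p + r)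
  (complex.Im p - r) (complex.Im p + r).

Lemma square_boundary_modulus p r w : 0 < r -> square_boundary p r w -> r <= modulus (w - p).
Proof.
case: p => x y r0 H; move: H => -[|] [|] [t /= _ <-].
- by apply: le_trans (Im_le_modulus _) => /=; rewrite addrAC subrr add0r normrN gtr0_norm.
- by apply: le_trans (Im_le_modulus _) => /=; rewrite addrAC subrr add0r gtr0_norm.
- by apply: le_trans (Re_le_modulus _) => /=; rewrite addrAC subrr add0r gtr0_norm.
- by apply: le_trans (Re_le_modulus _) => /=; rewrite addrAC subrr add0r normrN gtr0_norm.
Qed.

Lemma square_functional p (r : R) : 0 < r ->
  contour_functional (square_boundary p r) (squareint p r).
Proof. by move=> r0; apply: rect_functional; rewrite lerD2l ge0_cp ?ltW. Qed.

Lemma square_modulus p r w : square p r w -> modulus (w - p) <= 2 * r.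
Proof.
case: p w => [x y] [u v] [/= h1 h2]; apply: le_trans (modulus_le_ReIm _) _ => /=.
rewrite mulr2n mulrDl mul1r; apply: lerD; rewrite ler_norml; lra.
Qed.

(** On each of the four edges the imaginary part of [dw / (w - p)] is at least
    [1 / (2 r)] per unit of length, and the edges have length [2 r]. *)
Lemma squareint_inv_ge4 p (r : R) : 0 < r ->
  4 <= complex.Im (cauchy_transform (squareint p r) (fun=> 1) p).
Proof.
case: p => x y r0.
set p : C R := Complex x y.
have Gp : ~ square_boundary p r p.
  by move=> /(square_boundary_modulus r0); rewrite subrr modulus0 leNgt r0.
have c1 : continuous_at_points (square_boundary p r) (fun w : C R => 1 / (w - p)).
  exact: continuous_at_points_quot Gp (@continuous_at_points_cst _ _ 1).
have inv_le (u v : R) : 0 < u -> `|v| <= u -> (2 * u)^-1 <= u / (u ^+ 2 + v ^+ 2).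
  move=> u0 vu; rewrite -[leLHS]mul1r ler_pdivrMr ?mulr_gt0// mulrAC ler_pdivlMr; last first.
    by rewrite ltr_wpDr ?sqr_ge0// exprn_gt0.
  have : v ^+ 2 <= u ^+ 2 by rewrite -[v ^+ 2]real_normK ?num_real// lerXn2r ?nnegrE// ltW.
  have -> : u * (2 * u) = 2 * u ^+ 2 by ring.
  by move: (v ^+ 2) (u ^+ 2) => V U; lra.
have r2 : x - r <= x + r by rewrite lerD2l ge0_cp ?ltW.
have r3 : y - r <= y + r by rewrite lerD2l ge0_cp ?ltW.
have len (t : R) : (2 * r)^-1 * (t + r - (t - r)) = 1 by field; rewrite gt_eqF.
have bm (q : R -> C R) (a b : R) : continuous q ->
    (q @` `[a, b]) `<=` square_boundary p r ->
    bounded_measurable a b (fun t => 1 / (q t - p)).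
  move=> cq qs; apply: (edge_bounded_measurable cq (f := fun w => 1 / (w - p))).
  exact: continuous_at_points_sub c1.
have b1 : 1 <= complex.Im (cint (x - r) (x + r) (fun t => 1 / (Complex t (y - r) - p))).
  rewrite -(len x); apply: Rintegral_ge => //.
    apply: bounded_measurable_Im; apply: bm; first exact: continuous_horizontal.
    by move=> z [t ht <-]; left; left; exists t.
  move=> t ht; rewrite div1r /=.
  have -> : y - r - y = - r by rewrite addrAC subrr add0r.
  rewrite sqrrN mulNr opprK addrC; apply: inv_le => //; rewrite ler_norml; clear -ht; lra.
have b2 : complex.Im (cint (x - r) (x + r) (fun t => 1 / (Complex t (y + r) - p))) <= -1.
  rewrite -(len x) -mulNr; apply: Rintegral_le => //.
    apply: bounded_measurable_Im; apply: bm; first exact: continuous_horizontal.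
    by move=> z [t ht <-]; left; right; exists t.
  move=> t ht; rewrite div1r /=.
  have -> : y + r - y = r by rewrite addrAC subrr add0r.
  rewrite lerN2 addrC; apply: inv_le => //; rewrite ler_norml; clear -ht; lra.
have b3 : 1 <= complex.Re (cint (y - r) (y + r) (fun t => 1 / (Complex (x + r) t - p))).
  rewrite -(len y); apply: Rintegral_ge => //.
    apply: bounded_measurable_Re; apply: bm; first exact: continuous_vertical.
    by move=> z [t ht <-]; right; left; exists t.
  move=> t ht; rewrite div1r /=.
  have -> : x + r - x = r by rewrite addrAC subrr add0r.
  apply: inv_le => //; rewrite ler_norml; clear -ht; lra.
have b4 : complex.Re (cint (y - r) (y + r) (fun t => 1 / (Complex (x - r) t - p))) <= -1.
  rewrite -(len y) -mulNr; apply: Rintegral_le => //.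
    apply: bounded_measurable_Re; apply: bm; first exact: continuous_vertical.
    by move=> z [t ht <-]; right; right; exists t.
  move=> t ht; rewrite div1r /=.
  have -> : x - r - x = - r by rewrite addrAC subrr add0r.
  rewrite sqrrN !mulNr lerN2; apply: inv_le => //; rewrite ler_norml; clear -ht; lra.
rewrite /cauchy_transform /squareint /rectint.
have ImD (z w : C R) : complex.Im (z + w) = complex.Im z + complex.Im w by case: z w => ? ? [].
have Imi (z : C R) : complex.Im ('i%C * z) = complex.Re z.
  by case: z => u v /=; rewrite mul0r mul1r add0r.
have ImN (z : C R) : complex.Im (- z) = - complex.Im z by case: z.
rewrite !ImD mulN1r ImN mulNr ImN !Imi /=.
move: b1 b2 b3 b4; rewrite /=.
move: (\int[_]_(t in _) _)%R (\int[_]_(t in _) _)%R (\int[_]_(t in _) _)%R (\int[_]_(t in _) _)%R.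
move=> i1 i2 i3 i4; lra.
Qed.

(** On a small square centred at [z] Cauchy's formula reads [f W = A] with
    Cauchy transforms [W] and [A], where [W] is nonzero at the centre and hence
    near it. *)
Lemma local_representation Om f z : open Om -> Om z ->
  (forall w, Om w -> derivable f w 1) ->
  exists G L (d : R), [/\ contour_functional G L, continuous_at_points G f, 0 < d &
    forall w, modulus (w - z) < d -> [/\ Om w, ~ G w, cauchy_transform L (fun=> 1) w != 0 &
      f w * cauchy_transform L (fun=> 1) w = cauchy_transform L f w]].
Proof.
move=> /open_modulusP oOm Omz df; have [e e0 He] := oOm _ Omz.
pose r := e / 4; have r0 : 0 < r by rewrite divr_gt0.
have sq w : square z r w -> Om w.
  move=> /square_modulus wz; apply: He; apply: le_lt_trans wz _; rewrite /r; clear -e0; lra.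
have HL := square_functional z r0.
have bs : square_boundary z r `<=` square z r.
  by apply: rect_boundary_sub; rewrite lerD2l ge0_cp ?ltW.
have cf : continuous_at_points (square_boundary z r) f.
  by move=> w /bs/sq/df; exact: derivable_continuous.
have Gz : ~ square_boundary z r z.
  by move=> /(square_boundary_modulus r0); rewrite subrr modulus0 leNgt r0.
have c1 := @continuous_at_points_cst R (square_boundary z r) 1.
have [d d0 Hd] := (continuous_modulusP _ _).1 (cauchy_transform_continuous HL c1 Gz) 1 ltr01.
exists (square_boundary z r), (squareint z r), (Num.min d r); split=> //.
  by rewrite lt_min d0 r0.
move=> w; rewrite lt_min => /andP[wd wr].
have [h1 h2] : (complex.Re z - r < complex.Re w < complex.Re z + r) /\
    (complex.Im z - r < complex.Im w < complex.Im z + r).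
  have := le_lt_trans (Re_le_modulus _) wr; have := le_lt_trans (Im_le_modulus _) wr.
  clear; case: z w => [x y] [u v] /=; rewrite !ltr_norml.
  by move=> /andP[? ?] /andP[? ?]; split; lra.
split.
- by apply: sq; clear -h1 h2; split; lra.
- by move=> /(square_boundary_modulus r0); rewrite leNgt wr.
- rewrite -modulus_eq0 gt_eqF//.
  have := Hd _ wd; rewrite modulusB => H.
  have := le_lt_trans (modulusBl _ _) H.
  have := le_trans (ler_norm _) (Im_le_modulus (cauchy_transform (squareint z r) (fun=> 1) z)).
  have := squareint_inv_ge4 z r0.
  move: (modulus _) (modulus _) => m1 m2; lra.
- by apply: cauchy_rect => // x xr; apply: df; exact: sq.
Qed.

(** Dividing out a zero of a holomorphic function leaves a holomorphic
    function: near [z] both [f] and [dq f z] are quotients of Cauchy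
    transforms, which are differentiable there. *)
Lemma derivable_dq Om f z w : open Om -> (forall w, Om w -> derivable f w 1) ->
  Om z -> Om w -> derivable (dq f z) w 1.
Proof.
move=> oOm df Omz Omw.
have [->|wz] := eqVneq w z; last exact: derivable_dq_off wz (df _ Omw).
have [G [L [d [HL cf d0 H]]]] := local_representation oOm Omz df.
have [_ Gz Wz _] : [/\ Om z, ~ G z, cauchy_transform L (fun=> 1) z != 0 &
      f z * cauchy_transform L (fun=> 1) z = cauchy_transform L f z].
  by apply: H; rewrite subrr modulus0.
have c1 := @continuous_at_points_cst R G 1.
have cfq := continuous_at_points_quot Gz cf.
have c1q := continuous_at_points_quot Gz c1.
have dT h : continuous_at_points G h -> derivable (cauchy_transform L h) z 1.
  by move=> ch; have /@ex_derive := is_derive_cauchy_transform HL ch Gz.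
pose W := cauchy_transform L (fun=> 1).
pose A := cauchy_transform L (fun w => f w / (w - z)).
pose B := cauchy_transform L (fun w => 1 / (w - z)).
apply: (@near_eq_derivable _ _ _ (fun w => (A w - f z * B w) * (W w)^-1)); last first.
  apply: (@derivableM _ _ (fun w => A w - f z * B w)).
    apply: (@derivableB _ _ _ A (fun w => f z * B w) z 1 (dT _ cfq)).
    exact: (@derivableM _ _ (fun=> f z) B z 1 (derivable_cst _ _ _) (dT _ c1q)).
  exact: derivableV (dT _ c1).
apply/nbhs_modulusP; exists d => // x xd.
have [_ Gx Wx fWx] := H _ xd.
have dA := cauchy_transformB HL cf Gz Gx.
have dB := cauchy_transformB HL c1 Gz Gx.
have [_ _ _ fWz] : [/\ Om z, ~ G z, cauchy_transform L (fun=> 1) z != 0 &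
      f z * cauchy_transform L (fun=> 1) z = cauchy_transform L f z].
  by apply: H; rewrite subrr modulus0.
apply: (mulIf Wx); rewrite divfK//.
have [->|xz] := eqVneq x z.
  (* the product rule for [f * W], which is a Cauchy transform near [z] *)
  rewrite dqxx.
  have e1 : 'D_1 (cauchy_transform L f) z = 'D_1 (f * W) z.
    apply: near_eq_derive; apply/nbhs_modulusP; exists d => // y yd.
    by have [_ _ _ <-] := H _ yd.
  have e2 := @deriveM _ _ f W z 1 (df _ Omz) (dT _ c1).
  have /@derive_val e3 := is_derive_cauchy_transform HL cf Gz.
  have /@derive_val e4 := is_derive_cauchy_transform HL c1 Gz.
  have -> : A z = f z * 'D_1 W z + W z * 'D_1 f z by rewrite /A -e3 e1 e2.
  have -> : B z = 'D_1 W z by exact: esym e4.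
  rewrite -/(W z); move: (f z) ('D_1 W z) (W z) ('D_1 f z) => u v s t; ring.
have xz0 : x - z != 0 by rewrite subr_eq0.
apply: (mulfI xz0); rewrite mulrA -dqE mulrBr mulrCA -dA -dB -fWx -fWz.
by move: (f x) (f z) (cauchy_transform L _ x) (cauchy_transform L _ z) => u v s t; ring.
Qed.

(** From [f W = A] with Lipschitz [A] and [W], where [W] stays away from [0]:
    [(f w' - f w) W w' = (A w' - A w) - f w (W w' - W w)]. *)
Lemma locally_lipschitz Om f z : open Om -> (forall w, Om w -> derivable f w 1) -> Om z ->
  exists K d : R, [/\ 0 < K, 0 < d & forall w w', modulus (w - z) < d -> modulus (w' - z) < d ->
    modulus (f w' - f w) <= K * modulus (w' - w)].
Proof.
move=> oOm df Omz.
have [G [L [d [HL cf d0 H]]]] := local_representation oOm Omz df.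
have [_ Gz Wz _] : [/\ Om z, ~ G z, cauchy_transform L (fun=> 1) z != 0 &
      f z * cauchy_transform L (fun=> 1) z = cauchy_transform L f z].
  by apply: H; rewrite subrr modulus0.
have c1 := @continuous_at_points_cst R G 1.
have [K1 [d1 [K10 d10 H1]]] := cauchy_transform_lipschitz HL cf Gz.
have [K2 [d2 [K20 d20 H2]]] := cauchy_transform_lipschitz HL c1 Gz.
have [d3 d30 H3] := (continuous_modulusP _ _).1 (derivable_continuous (df _ Omz)) 1 ltr01.
set W := cauchy_transform L (fun=> 1) in Wz H H2 *.
pose c := modulus (W z) / 2; have c0 : 0 < c by rewrite divr_gt0// modulus_gt0.
have [d4 d40 H4] := (continuous_modulusP _ _).1 (cauchy_transform_continuous HL c1 Gz) c c0.
pose F := modulus (f z) + 1.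
have F0 : 0 < F by rewrite ltr_wpDl// modulus_ge0.
exists ((K1 + F * K2) / c), (Num.min (Num.min d d1) (Num.min d2 (Num.min d3 d4))).
split; first by rewrite divr_gt0// addr_gt0// mulr_gt0.
  by rewrite !lt_min d0 d10 d20 d30 d40.
move=> w w'; rewrite !lt_min => /andP[/andP[wd wd1] /andP[wd2 /andP[wd3 wd4]]].
move=> /andP[/andP[wd' wd1'] /andP[wd2' /andP[wd3' wd4']]].
have [_ _ _ fW] := H _ wd; have [_ _ _ fW'] := H _ wd'.
have fw : modulus (f w) <= F.
  rewrite /F addrC -lerBlDr; apply: le_trans (ltW (H3 _ wd3)); exact: modulusBl.
have cW : c <= modulus (W w').
  have := H4 _ wd4'; rewrite -/W modulusB => h.
  have := le_trans (modulusBl _ _) (ltW h); rewrite /c; clear.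
  move: (modulus _) (modulus _) => u v; lra.
rewrite mulrAC ler_pdivlMr//.
apply: le_trans (_ : modulus (f w' - f w) * modulus (W w') <= _).
  by rewrite ler_wpM2l ?modulus_ge0.
rewrite -modulusM.
have -> : (f w' - f w) * W w' = (cauchy_transform L f w' - cauchy_transform L f w)
    - f w * (W w' - W w) by rewrite -fW -fW'; ring.
apply: le_trans (modulusD _ _) _; rewrite modulusN modulusM mulrDl; apply: lerD.
  exact: H1.
rewrite -mulrA; apply: ler_pM; rewrite ?modulus_ge0//.
exact: H2.
Qed.

End LocalTheory.

(** * Holomorphy of the Cauchy kernel across the contour *)

Section CauchyKernel.
Context {R : realType}.
Implicit Types (f q : C R -> C R) (Om G : set (C R)) (L : (C R -> C R) -> C R).

(** Moving the base point of a divided difference: this is the identity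
    [f[z', w] = f[z, w] + (z' - z) f[z, z', w]]. *)
Lemma dq_move Om f z z' w : open Om -> (forall w, Om w -> derivable f w 1) ->
  Om z -> Om z' ->
  dq f z' w = dq f z w + (z' - z) * dq (dq f z) z' w.
Proof.
move=> oOm df Omz Omz'; set q := dq f z.
have E x : f x - f z' = (x - z') * (q x + (z' - z) * dq q z' x).
  have e1 := dqE f z x; have e2 := dqE f z z'; have e3 := dqE q z' x; rewrite -/q in e1 e2.
  rewrite mulrDr mulrCA -e3 -[f x](subrK (f z)) e1 -[f z'](subrK (f z)) e2.
  by move: (f z) (q x) (q z') => u v s; ring.
have cq : {for z', continuous (dq q z')}.
  by apply: dq_continuous; exact: derivable_dq oOm df Omz Omz'.
have [->|wz'] := eqVneq w z'; last first.
  have wz0 : w - z' != 0 by rewrite subr_eq0.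
  by apply: (mulfI wz0); rewrite -dqE E.
have : is_derive z' 1 f ((fun x => q x + (z' - z) * dq q z' x) z').
  apply: (caratheodory (q := fun x => q x + (z' - z) * dq q z' x)).
    by apply: (filterS _ (@filterT _ (nbhs z') _)) => x _; exact: E.
  apply: (@continuousD _ _ _ q (fun x => (z' - z) * dq q z' x)).
    by apply: derivable_continuous; exact: derivable_dq oOm df Omz Omz'.
  by apply: (@continuousM _ _ (fun=> z' - z) (dq q z') z' (@cst_continuous _ _ _ _) cq).
by move=> [_ <-]; rewrite dqxx.
Qed.

Lemma dq_diag_le f z (K d : R) : 0 < d -> derivable f z 1 ->
  (forall w, modulus (w - z) < d -> modulus (f w - f z) <= K * modulus (w - z)) ->
  modulus (dq f z z) <= K.
Proof.
move=> d0 df H; apply/ler_addgt0Pr => e e0.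
have [d1 d10 H1] := (continuous_modulusP _ _).1 (dq_continuous df) e e0.
(* By continuity the diagonal value is a limit of values at nearby points [w]. *)
pose t := Num.min d d1 / 2; pose w := z + (t%:C)%C.
have t0 : 0 < t by rewrite divr_gt0// lt_min d0.
have wz : modulus (w - z) = t by rewrite addrAC subrr add0r modulus_real gtr0_norm.
have tm : t < Num.min d d1 by rewrite ltr_pdivrMr// ltr_pMr ?ltr1n// lt_min d0.
have /andP[td td1] : (t < d) && (t < d1) by rewrite -lt_min.
have := H1 w; rewrite wz => /(_ td1); rewrite modulusB => h1.
have := H w; rewrite wz => /(_ td); rewrite dqE modulusM wz mulrC ler_pM2r// => h2.
have := le_trans (modulusBl _ _) (ltW h1).
move: h2; move: (modulus _) (modulus _) => u v; lra.
Qed.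

(** Close to [z] the divided difference is controlled by a Lipschitz constant,
    and away from [z] by a bound on [f] and on the distance. *)
Lemma dq_bounded Om f z G : open Om -> (forall w, Om w -> derivable f w 1) ->
  compact G -> G `<=` Om -> Om z ->
  exists d B : R, [/\ 0 < d, 0 <= B & forall z' w, modulus (z' - z) < d -> G w ->
    modulus (dq f z' w) <= B].
Proof.
move=> oOm df cG GOm Omz.
have [K [d [K0 d0 HK]]] := locally_lipschitz oOm df Omz.
have [e e0 He] := (open_modulusP Om).1 oOm _ Omz.
have cfG : continuous_at_points G f by move=> w /GOm/df; exact: derivable_continuous.
have [M M0 HM] := continuous_on_compact_bounded cG cfG.
have Mz0 := modulus_ge0 (f z).
pose B := K + (M + (modulus (f z) + K * d)) / (d / 2).
have d20 : 0 < d / 2 by rewrite divr_gt0.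
have Kd : 0 < K * d by rewrite mulr_gt0.
have F0 : 0 <= (M + (modulus (f z) + K * d)) / (d / 2).
  apply: divr_ge0; last exact: ltW.
  by rewrite addr_ge0 ?addr_ge0// ltW.
exists (Num.min (d / 2) e), B; split.
- by rewrite lt_min d20 e0.
- by rewrite addr_ge0// ltW.
move=> z' w; rewrite lt_min => /andP[z'd z'e] Gw.
have z'd1 : modulus (z' - z) < d by apply: lt_trans z'd _; rewrite ltr_pdivrMr// ltr_pMr// ltr1n.
have [wd|wd] := ltP (modulus (w - z)) d.
  apply: le_trans (_ : K <= _); last by rewrite lerDl.
  have [->|wz'] := eqVneq w z'.
    apply: (@dq_diag_le _ _ _ (d / 2)) => //; first exact: df (He _ z'e).
    move=> x xz'; apply: HK => //.
    apply: le_lt_trans (modulus_dist z' _ _) _.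
    move: xz' z'd; move: (modulus _) (modulus _) => u v; lra.
  have wz0 : 0 < modulus (w - z') by rewrite modulus_gt0 subr_eq0.
  by rewrite -(ler_pM2r wz0) mulrC -modulusM -dqE; apply: HK.
apply: le_trans (_ : (M + (modulus (f z) + K * d)) / (d / 2) <= _); last first.
  by rewrite lerDr// ltW.
have wz' : d / 2 <= modulus (w - z').
  have := modulus_dist z' w z; move: wd z'd.
  by move: (modulus _) (modulus _) (modulus _) => u v s; lra.
have wz0 : w != z'.
  by rewrite -subr_eq0 -modulus_gt0; exact: lt_le_trans wz'.
rewrite /dq (negbTE wz0) modulusM modulusV; apply: ler_pM; rewrite ?invr_ge0 ?modulus_ge0//.
  apply: le_trans (modulusD _ _) _; rewrite modulusN; apply: lerD; first exact: HM.
  have h : modulus (f z' - f z) <= K * d.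
    have zz : modulus (z - z) < d by rewrite subrr modulus0.
    apply: le_trans (HK z z' zz z'd1) _.
    by rewrite ler_pM2l// ltW.
  by rewrite -[f z'](subrK (f z)) addrC; apply: le_trans (modulusD _ _) _; rewrite lerD2l.
by rewrite lef_pV2 ?posrE//; exact: lt_le_trans wz'.
Qed.

Lemma continuous_at_points_dq Om G f z : G `<=` Om ->
  (forall w, Om w -> derivable f w 1) -> Om z -> continuous_at_points G (dq f z).
Proof. by move=> GOm df Omz w /GOm Omw; apply: dq_continuous_at; exact: df. Qed.

(** The function [z -> L (dq f z)] is holomorphic even across the contour.
    Its difference quotient at [z] is [L (dq q z')] for [q := dq f z], and
    moving the base point once more shows that this converges. *)
Lemma derivable_cauchy_kernel Om G L f z : open Om -> (forall w, Om w -> derivable f w 1) ->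
  contour_functional G L -> G `<=` Om -> Om z ->
  derivable (fun z => L (dq f z)) z 1.
Proof.
move=> oOm df HL GOm Omz.
have [e e0 He] := (open_modulusP Om).1 oOm _ Omz.
have move_base g z' : (forall w, Om w -> derivable g w 1) -> Om z' ->
    L (dq g z') = L (dq g z) + (z' - z) * L (dq (dq g z) z').
  move=> dg Omz'; have c1 := continuous_at_points_dq GOm dg Omz.
  have c2 := continuous_at_points_dq GOm (fun w Omw => derivable_dq oOm dg Omz Omw) Omz'.
  have c3 := continuous_at_pointsZ (c := z' - z) c2.
  rewrite (cf_eq HL (continuous_at_points_dq GOm dg Omz') (continuous_at_pointsD c1 c3)).
    by rewrite (cf_add HL c1 c3) (cf_scale HL _ c2).
  by move=> w _; exact: dq_move oOm dg Omz Omz'.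
pose q := dq f z; have dq' w : Om w -> derivable q w 1 by exact: derivable_dq oOm df Omz.
pose r := dq q z; have dr w : Om w -> derivable r w 1 by exact: derivable_dq oOm dq' Omz.
suff : is_derive z 1 (fun z => L (dq f z)) ((fun z' => L (dq q z')) z) by case.
apply: (caratheodory (q := fun z' => L (dq q z'))).
  apply/nbhs_modulusP; exists e => // z' /He Omz'.
  by rewrite (move_base f z' df Omz') addrC addKr.
have [V V0 HV] := cf_bound HL.
have [d [B [d0 B0 HB]]] := dq_bounded oOm dr (cf_compact HL) GOm Omz.
apply/continuous_modulusP => eps eps0.
have VB : 0 < V * B + 1 by rewrite ltr_wpDl// mulr_ge0// ltW.
exists (Num.min (Num.min e d) (eps / (V * B + 1))).
  by rewrite !lt_min e0 d0 divr_gt0.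
move=> z'; rewrite !lt_min => /andP[/andP[/He Omz' z'd] z'eps].
rewrite (move_base q z' dq' Omz') -/r addrC addKr modulusM.
have h : modulus (L (dq r z')) <= V * B.
  apply: HV => //; first exact: continuous_at_points_dq GOm dr Omz'.
  by move=> w Gw; exact: HB.
rewrite ltr_pdivlMr// in z'eps; apply: le_lt_trans z'eps.
by rewrite ler_wpM2l ?modulus_ge0// (le_trans h)// lerDl.
Qed.

End CauchyKernel.

(** * Liouville's theorem *)

Section Liouville.
Context {R : realType}.
Implicit Types (F : C R -> C R).

(** Cauchy's formula at the centre of a square, where the boundary has length
    [8 r] and distance [r] to the centre. *)
Lemma square_mean_bound F z (r B : R) : 0 < r -> (forall w, derivable F w 1) ->
  (forall w, r <= modulus (w - z) -> modulus (F w) <= B) ->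
  modulus (F z) <= 4 * B.
Proof.
move=> r0 dF FB.
have [h1 h2] : (complex.Re z - r < complex.Re z < complex.Re z + r) /\
    (complex.Im z - r < complex.Im z < complex.Im z + r).
  by rewrite !ltrDl !gtrDl !oppr_lt0 r0.
have Gz : ~ square_boundary z r z.
  by move=> /(square_boundary_modulus r0); rewrite subrr modulus0 leNgt r0.
have := cauchy_rect h1 h2 (fun w _ => dF w); rewrite -/(squareint z r) => E.
have W4 : 4 <= modulus (cauchy_transform (squareint z r) (fun=> 1) z).
  apply: le_trans (squareint_inv_ge4 z r0) _.
  by apply: le_trans (ler_norm _) _; exact: Im_le_modulus.
have T : modulus (cauchy_transform (squareint z r) F z) <= 16 * B.
  have -> : 16 * B = 4 * (B / r) * ((complex.Re z + r - (complex.Re z - r)) +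
      (complex.Im z + r - (complex.Im z - r))) by field; rewrite gt_eqF.
  apply: rectint_le; rewrite ?lerD2l ?ge0_cp ?(ltW r0)//.
    apply: continuous_at_points_quot Gz _ => w _; exact: derivable_continuous.
  move=> w /(square_boundary_modulus r0) wr.
  rewrite modulusM modulusV; apply: ler_pM; rewrite ?invr_ge0 ?modulus_ge0//; first exact: FB.
  by rewrite lef_pV2 ?posrE//; exact: lt_le_trans wr.
have : modulus (F z) * 4 <= 16 * B.
  apply: le_trans T; rewrite -E modulusM.
  by rewrite ler_wpM2l ?modulus_ge0.
move: (modulus _) => u; lra.
Qed.

(** The value at a point is bounded by the values on arbitrarily large squares. *)
Lemma entire_vanishing_at_infinity F : (forall w, derivable F w 1) ->
  (forall e : R, 0 < e -> exists2 r : R, 0 < r & forall w, r < modulus w -> modulus (F w) <= e) ->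
  forall z, F z = 0.
Proof.
move=> dF F0 z; apply/eqP; rewrite -modulus_eq0 eq_le modulus_ge0 andbT.
apply/ler_addgt0Pr => e e0; rewrite add0r.
have [r r0 Hr] := F0 (e / 4) ltac:(by rewrite divr_gt0).
have z0 := modulus_ge0 z.
have -> : e = 4 * (e / 4) by lra.
apply: (@square_mean_bound F z (r + modulus z + 1)) => //; first by lra.
move=> w wz; apply: Hr; have := modulusBl (w - z) (- z); rewrite opprK subrK modulusN.
move: wz; move: (modulus _) (modulus _) (modulus _) => u v s; lra.
Qed.

(** Liouville: divide out [F w - F 0] by [w] and decrease the growth. *)
Lemma entire_polynomial_growth k F (c r : R) : (forall w, derivable F w 1) -> 0 < r ->
  (forall w, r < modulus w -> modulus (F w) <= c * modulus w ^+ k) ->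
  exists q : {poly (C R)}, (size q <= k.+1)%N /\ forall z, F z = q.[z].
Proof.
elim: k F c r => [|k IH] F c r dF r0 HF.
  exists (F 0)%:P; split; first exact: leq_trans (size_polyC_leq1 _) _.
  move=> z; rewrite hornerC.
  have dG w : derivable (dq F 0) w 1.
    exact: (@derivable_dq R setT F 0 w openT (fun w _ => dF w)).
  apply/eqP; rewrite -subr_eq0 dqE (entire_vanishing_at_infinity dG) ?mulr0//.
  move=> e e0; have c0 := modulus_ge0 (F 0).
  exists (r + (`|c| + modulus (F 0)) / e).
    by rewrite ltr_wpDr// divr_ge0 ?addr_ge0// ltW.
  move=> w wr.
  have rw : r < modulus w.
    by apply: le_lt_trans wr; rewrite lerDl divr_ge0 ?addr_ge0// ltW.
  have w0 : 0 < modulus w by exact: lt_trans rw.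
  have wn0 : w != 0 by rewrite -modulus_gt0.
  rewrite /dq (negbTE wn0) subr0 modulusM modulusV ler_pdivrMr//.
  apply: le_trans (modulusD _ _) _; rewrite modulusN.
  have := HF _ rw; rewrite expr0 mulr1 => h.
  have : (`|c| + modulus (F 0)) / e <= modulus w.
    by apply: le_trans (ltW wr); rewrite lerDr ltW.
  rewrite ler_pdivrMr// mulrC => /(le_trans _); apply.
  by rewrite lerD2r; apply: le_trans h (ler_norm _).
have dG w : derivable (dq F 0) w 1.
  exact: (@derivable_dq R setT F 0 w openT (fun w _ => dF w)).
have c0 := modulus_ge0 (F 0).
have [||q [sq Hq]] := IH (dq F 0) (`|c| + modulus (F 0)) (r + 1) dG.
- by rewrite addr_gt0.
- move=> w wr.
  have w1 : 1 < modulus w by apply: lt_trans wr; rewrite ltrDr.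
  have rw : r < modulus w by apply: lt_trans wr; rewrite ltrDl.
  have w0 : 0 < modulus w by exact: lt_trans w1.
  have wn0 : w != 0 by rewrite -modulus_gt0.
  rewrite /dq (negbTE wn0) subr0 modulusM modulusV ler_pdivrMr//.
  apply: le_trans (modulusD _ _) _; rewrite modulusN.
  apply: le_trans (lerD (HF _ rw) (lexx _)) _.
  rewrite -mulrA -exprSr mulrDl; apply: lerD.
    by rewrite ler_wpM2r ?exprn_ge0 ?ler_norm// ltW.
  by rewrite ler_peMr// exprn_ege1// ltW.
exists (q * 'X + (F 0)%:P); split; last first.
  move=> z; have := dqE F 0 z; rewrite subr0 Hq => /eqP; rewrite subr_eq => /eqP ->.
  by rewrite !hornerE mulrC.
by rewrite size_MXaddC; case: ifP.
Qed.

End Liouville.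

(** * Cauchy's theorem in the exterior of a compact set *)

Section ExteriorCauchy.
Context {R : realType}.
Implicit Types (f : C R -> C R) (E D G : set (C R)) (L : (C R -> C R) -> C R).

(** Winding numbers are encoded by the values of an integral, the form in which
    Dixon's argument uses them; [c] is [2 pi i] for curves. *)
Record winds_around (D G : set (C R)) (L : (C R -> C R) -> C R) (c : C R) : Prop := {
  wa_functional : contour_functional G L;
  wa_neq0 : c != 0;
  wa_disjoint : forall z, D z -> ~ G z;
  wa_inside : forall z, D z -> cauchy_transform L (fun=> 1) z = c;
  wa_outside : forall z, ~ D z -> ~ G z -> cauchy_transform L (fun=> 1) z = 0 }.

(** The integral of [(w - z)^-1] depends continuously on [z] and distinguishes
    [D] from the rest of the complement of [G].  In particular the interior of a level
    curve is a neighbourhood of [E]. *)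
Lemma winds_around_open D G L c : winds_around D G L c -> open D.
Proof.
move=> [HL c0 DG Din Dout]; rewrite openE => z Dz.
have Gz := DG _ Dz.
have c1 := @continuous_at_points_cst R G 1.
have [d d0 Hd] := (continuous_modulusP _ _).1 (cauchy_transform_continuous HL c1 Gz)
  (modulus c) ltac:(by rewrite modulus_gt0).
have [e e0 He] := ball_off_compact (cf_compact HL) Gz.
apply/nbhs_modulusP; exists (Num.min d e); first by rewrite lt_min d0.
move=> w; rewrite lt_min => /andP[wd we]; apply: contrapT => Dw.
have Gw : ~ G w by move=> /(He w w we); rewrite subrr modulus0 leNgt e0.
by have := Hd _ wd; rewrite (Din _ Dz) (Dout _ Dw Gw) sub0r modulusN ltxx.
Qed.

(** A Cauchy transform vanishes at infinity, while it equals [c] on [D]. *)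
Lemma winds_around_bounded D G L c : winds_around D G L c ->
  exists2 r : R, 0 < r & forall z, r < modulus z -> ~ D z /\ ~ G z.
Proof.
move=> [HL c0 DG Din Dout].
have c1 := @continuous_at_points_cst R G 1.
have [r r0 Hr] := cauchy_transform_infty HL c1 (e := modulus c) ltac:(by rewrite modulus_gt0).
exists r => // z /Hr[Gz zc]; split=> // Dz.
by move: zc; rewrite Din// ltxx.
Qed.

(** Cauchy's theorem in the exterior of a compact set, after Dixon: the
    function equal to [L (dq f z) + c * f z] off [E] and to the Cauchy
    transform of [f] on [D] is entire, because both formulas agree on their
    common domain, and it grows like [f] at infinity. *)
Theorem cauchy_exterior E D G L c f k (M r : R) :
  closed E -> E `<=` D -> winds_around D G L c ->
  (forall z, ~ E z -> derivable f z 1) ->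
  (forall z, r < modulus z -> modulus (f z) <= M * modulus z ^+ k) ->
  exists q : {poly (C R)}, [/\ (size q <= k.+1)%N,
    forall z, D z -> cauchy_transform L f z = c * q.[z] &
    forall z, ~ D z -> ~ G z -> cauchy_transform L f z = c * (q.[z] - f z)].
Proof.
move=> cE ED wa df fM; have [HL c0 DG Din Dout] := wa.
have oD := winds_around_open wa.
pose Om := ~` E; have oOm : open Om by rewrite openC.
have GOm : G `<=` Om by move=> z Gz /ED/DG.
have cf : continuous_at_points G f by move=> z /GOm/df; exact: derivable_continuous.
have c1 := @continuous_at_points_cst R G 1.
have Ldq z : Om z -> ~ G z -> L (dq f z) =
    cauchy_transform L f z - f z * cauchy_transform L (fun=> 1) z.
  move=> Omz Gz.
  have cq := continuous_at_points_quot Gz cf.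
  have c1q := continuous_at_points_quot Gz c1.
  have c2 := continuous_at_pointsZ (c := - f z) c1q.
  rewrite (cf_eq HL (continuous_at_points_dq GOm df Omz) (continuous_at_pointsD cq c2)).
    by rewrite (cf_add HL cq c2) (cf_scale HL _ c1q) mulNr.
  move=> w Gw; have wz : w != z by apply/eqP => wz; apply: Gz; rewrite -wz.
  by rewrite /dq (negbTE wz) mulrBl mulNr mul1r.
pose F z := if `[< E z >] then cauchy_transform L f z else L (dq f z) + c * f z.
(* On [D] the winding number [c] cancels the correction term. *)
have FD z : D z -> F z = cauchy_transform L f z.
  move=> Dz; rewrite /F; case: asboolP => // Ez.
  by rewrite Ldq ?Din ?[f z * c]mulrC ?subrK//; exact: DG.
have Fout z : ~ D z -> ~ G z -> F z = cauchy_transform L f z + c * f z.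
  move=> Dz Gz; rewrite /F; case: asboolP => [/ED//|Ez].
  by rewrite Ldq// Dout// mulr0 subr0.
have dF z : derivable F z 1.
  have [Ez|Ez] := pselect (E z).
    apply: (@near_eq_derivable _ _ _ (cauchy_transform L f)).
      have /open_modulusP/(_ z (ED _ Ez))[e e0 He] := oD.
      by apply/nbhs_modulusP; exists e => // w /He /FD.
    by have /@ex_derive := is_derive_cauchy_transform HL cf (DG _ (ED _ Ez)).
  apply: (@near_eq_derivable _ _ _ (fun z => L (dq f z) + c * f z)).
    have /open_modulusP/(_ z Ez)[e e0 He] := oOm.
    apply/nbhs_modulusP; exists e => // w /He Ew.
    by rewrite /F; case: asboolP.
  apply: (@derivableD _ _ _ (fun z => L (dq f z)) (fun z => c * f z)).
    exact: derivable_cauchy_kernel oOm df HL GOm Ez.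
  exact: (@derivableM _ _ (fun=> c) f z 1 (derivable_cst _ _ _) (df _ Ez)).
have [r1 r10 Hr1] := winds_around_bounded wa.
have [r2 r20 Hr2] := cauchy_transform_infty HL cf ltr01.
pose rho := Num.max (Num.max r 1) (Num.max r1 r2).
have rho0 : 0 < rho by rewrite !lt_max ltr01 orbT.
have [|q0 [sq Hq]] := @entire_polynomial_growth R k F (1 + modulus c * M) rho dF rho0.
  move=> w; rewrite !gt_max => /andP[/andP[wr w1] /andP[/Hr1[Dw Gw] /Hr2[_ Tw]]].
  rewrite Fout//; apply: le_trans (modulusD _ _) _; rewrite mulrDl mul1r; apply: lerD.
    by apply: le_trans (ltW Tw) _; rewrite exprn_ege1// ltW.
  by rewrite modulusM -mulrA ler_wpM2l ?modulus_ge0// fM.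
exists (c^-1 *: q0); split.
- exact: leq_trans (size_scale_leq _ _) sq.
- by move=> z Dz; rewrite hornerZ mulrA divff// mul1r -Hq FD.
- move=> z Dz Gz; rewrite hornerZ mulrBr mulrA divff// mul1r -Hq Fout//.
  by rewrite addrK.
Qed.

End ExteriorCauchy.

(** * Compact sets in the plane *)

Section PlaneCompactness.
Context {R : realType}.
Implicit Types (G K : set (C R)).

Lemma bounded_closed_complex_compact K (r : R) : closed K ->
  (forall z, K z -> modulus z <= r) -> compact K.
Proof.
move=> cK Kr.
pose S := (fun p : R * R => Complex p.1 p.2 : C R) @` (`[- r, r] `*` `[- r, r]).
have cS : compact S.
  apply: continuous_compact; last by apply: compact_setX; exact: segment_compact.
  apply: continuous_subspaceT => -[x y] P /nbhs_modulusP[e e0 eP] /=.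
  have e20 : 0 < e / 2 by rewrite divr_gt0.
  apply/nbhs_ballP; exists (e / 2) => //= -[u v] [/= xu yv]; apply: eP.
  apply: le_lt_trans (modulus_le_ReIm _) _ => /=.
  by rewrite [e]splitr ltrD// distrC.
apply: (subclosed_compact cK cS) => -[x y] /Kr h.
exists (x, y) => //; split; rewrite /= in_itv /= -ler_norml.
  exact: le_trans (Re_le_modulus _) h.
exact: le_trans (Im_le_modulus _) h.
Qed.

Lemma compact_positive_lower_bound K (h : C R -> R) : compact K ->
  (forall x, K x -> {for x, continuous h}) -> (forall x, K x -> 0 < h x) ->
  exists2 e : R, 0 < e & forall x, K x -> e <= h x.
Proof.
move=> /compact_near_coveringP cK ch h0.
have [|e [Ke e0]] := @filter_ex _ (0^'+ : set_system R) _ _ (filterI (cK R 0^'+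
    (fun e x => e <= h x) _ _) (nbhs_right_gt 0)).
  move=> x Kx; have hx2 : 0 < h x / 2 by rewrite divr_gt0// h0.
  have c1 : \forall y \near x, h x / 2 < h y.
    have := ch _ Kx; move=> /cvgrPdist_lt/(_ _ hx2); apply: filterS => y.
    rewrite ltr_norml => /andP[_]; rewrite ltrBlDr -ltrBlDl; apply: le_lt_trans.
    by rewrite {2}[h x]splitr addrK.
  have c2 : \forall e \near (0^'+ : set_system R), e < h x / 2 by exact: nbhs_right_lt.
  exists ([set y | h x / 2 < h y], [set e | e < h x / 2]); first by split.
  by move=> [y e] [/= h1 h2]; apply/ltW/(lt_trans h2).
by exists e => //; exact: Ke.
Qed.

Lemma compact_closed_distance G K : compact G -> closed K -> (forall z, G z -> ~ K z) ->
  exists2 d : R, 0 < d & forall z w, G z -> K w -> d <= modulus (z - w).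
Proof.
move=> /compact_near_coveringP cG cK GK.
have oK : open (~` K) by rewrite openC.
have [|d [Gd d0]] := @filter_ex _ (0^'+ : set_system R) _ _ (filterI (cG R 0^'+
    (fun d z => forall w, K w -> d <= modulus (z - w)) _ _) (nbhs_right_gt 0)).
  move=> x Gx; have [e e0 He] := (open_modulusP _).1 oK x (GK _ Gx).
  have e2 : 0 < e / 2 by rewrite divr_gt0.
  exists ([set y | modulus (y - x) < e / 2], [set d | d < e / 2]).
    by split; [apply/nbhs_modulusP; exists (e / 2)|exact: nbhs_right_lt].
  move=> [y d] [/= yx de] w Kw; rewrite leNgt; apply/negP => yw.
  apply: (He w) => //; apply: le_lt_trans (modulus_dist y _ _) _.
  by rewrite [e]splitr ltrD// modulusB; exact: lt_trans de.
by exists d => // z w Gz; exact: Gd.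
Qed.

End PlaneCompactness.

(** * Limits of k-th roots *)

Section Roots.
Context {R : realType}.
Implicit Types (x : nat -> R).

Lemma absorb_constant (c s t : R) : 0 <= s < t ->
  \forall k \near \oo, c * s ^+ k <= t ^+ k.
Proof.
move=> /andP[s0 st]; have t0 : 0 < t := le_lt_trans s0 st.
have : `|s / t| < 1 by rewrite ger0_norm ?divr_ge0 ?(ltW t0)// ltr_pdivrMr// mul1r.
move=> /(cvg_geometric c)/cvgrPdist_lt/(_ 1 ltr01); apply: filterS => k.
rewrite sub0r normrN /geometric /= expr_div_n => /ltW /(le_trans (ler_norm _)).
by rewrite mulrA ler_pdivrMr ?exprn_gt0// mul1r.
Qed.

Lemma absorb_constant_lt (c s t : R) : 0 <= s < t -> 0 < c ->
  \forall k \near \oo, s ^+ k <= c * t ^+ k.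
Proof.
move=> st c0; apply: filterS (absorb_constant c^-1 st) => k.
by rewrite mulrC ler_pdivrMr// mulrC.
Qed.

Lemma powR_root (t : R) k : 0 <= t -> (0 < k)%N -> (t ^+ k) `^ k%:R^-1 = t.
Proof.
move=> t0 k0; rewrite -powR_mulrn// -powRrM divff ?powRr1// pnatr_eq0.
by rewrite -lt0n.
Qed.

(** Geometric bounds with arbitrary constants and ratios arbitrarily close to
    [l] determine the limit of the k-th roots, as constants are absorbed by an
    arbitrarily small increase of the ratio. *)
Lemma cvg_root x (l : R) : 0 < l ->
  (forall t, l < t -> exists c : R, \forall k \near \oo, x k <= c * t ^+ k) ->
  (forall t, 0 < t < l -> exists2 c : R, 0 < c & \forall k \near \oo, c * t ^+ k <= x k) ->
  (fun k => x k `^ k%:R^-1) @ \oo --> l.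
Proof.
move=> l0 up lo; apply/cvgrPdist_le => e e0.
pose t := l + e / 2.
have lt : l < t by rewrite ltrDl divr_gt0.
have te : 0 <= t < l + e.
  by rewrite ltrD2l ltr_pdivrMr// ltr_pMr// ltr1n andbT addr_ge0// ?divr_ge0// ltW.
(* The maximum with [l / 2] keeps the lower ratio positive. *)
pose s := Num.max (l - e) (l / 2).
have s0 : 0 < s by rewrite lt_max divr_gt0// orbT.
have sl : s < l by rewrite gt_max gtrDl oppr_lt0 e0 ltr_pdivrMr// ltr_pMr// ltr1n.
pose u := (s + l) / 2.
have su : 0 <= s < u by rewrite (ltW s0) /= /u; clear -s0 sl; lra.
have ul : 0 < u < l by rewrite /u; clear -s0 sl; lra.
have [c upc] := up _ lt; have [d d0 lod] := lo _ ul.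
near=> k.
have k0 : (0 < k)%N by near: k; exists 1%N.
have h1 : x k <= (l + e) ^+ k.
  apply: (@le_trans _ _ (c * t ^+ k)); first by near: k.
  by near: k; exact: absorb_constant.
have h2 : s ^+ k <= x k.
  apply: (@le_trans _ _ (d * u ^+ k)); last by near: k.
  by near: k; exact: absorb_constant_lt.
have le0 : 0 <= l + e by rewrite addr_ge0// ltW.
have xk0 : 0 <= x k by apply: le_trans h2; rewrite exprn_ge0// ltW.
have ik0 : 0 <= (k%:R^-1 : R) by rewrite invr_ge0 ler0n.
have := ge0_ler_powR ik0 _ _ h1; rewrite !nnegrE powR_root// => /(_ xk0 (exprn_ge0 _ le0)) r1.
have := ge0_ler_powR ik0 _ _ h2; rewrite !nnegrE powR_root ?(ltW s0)// =>
  /(_ (exprn_ge0 _ (ltW s0)) xk0) r2.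
rewrite distrC ler_norml lerBlDl r1 andbT lerBrDl.
by apply: le_trans r2; rewrite le_max lexx.
Unshelve. all: by end_near. Qed.

(** Otherwise a ratio strictly between [y] and [x] absorbs the constant [K]. *)
Lemma power_bounded_le (x y K : R) : 0 <= x -> 0 <= y ->
  (forall n, x ^+ n <= K * y ^+ n) -> x <= y.
Proof.
move=> x0 y0 H; rewrite leNgt; apply/negP => yx.
have K0 : 0 < K by have := H 0%N; rewrite !expr0 mulr1; exact: lt_le_trans.
pose z := (x + y) / 2.
have yz : 0 <= y < z by rewrite y0 /z; move: yx; lra.
have zx : z < x by rewrite /z; move: yx; lra.
have [n _ /(_ _ (leqnn n)) h] := absorb_constant K yz.
have xz : 0 <= z < x by rewrite zx andbT; case/andP: yz => h1 /ltW; exact: le_trans.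
have [m _ hm] := absorb_constant_lt xz (ltr01 : 0 < 1).
have [p _ hp] : \forall k \near \oo, x ^+ k <= z ^+ k.
  by apply: filterS (absorb_constant K yz) => k; exact: le_trans (H k).
have := hp p.+1 (leqnSn p); rewrite ler_pXn2r ?nnegrE//; last by case/andP: xz.
by rewrite leNgt zx.
Qed.

End Roots.

(** * Maximum norms of polynomials and asymptotic optimality *)

Section MaxNorm.
Context {R : realType}.
Implicit Types (S : set (C R)) (f : C R -> C R).

Lemma max_norm_le S f (B : R) : 0 <= B -> (forall z, S z -> modulus (f z) <= B) ->
  max_norm S f <= B.
Proof.
move=> B0 H; rewrite /max_norm; have [->|S0] := eqVneq S set0.
  by rewrite image_set0 sup0.
apply: ge_sup; first by have /set0P[z Sz] := S0; exists (modulus (f z)); exists z.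
by move=> _ [z Sz <-]; exact: H.
Qed.

Lemma le_max_norm S f (B : R) z : (forall z, S z -> modulus (f z) <= B) -> S z ->
  modulus (f z) <= max_norm S f.
Proof.
move=> H Sz; apply: ub_le_sup; last by exists z.
by exists B => _ [w Sw <-]; exact: H.
Qed.

Lemma max_norm_ge0 S f : 0 <= max_norm S f.
Proof.
rewrite /max_norm; have [H|H] := pselect (has_sup [set modulus (f z) | z in S]).
  case: (H) => -[y [z Sz _]] Hu.
  by apply: le_trans (modulus_ge0 (f z)) _; apply: ub_le_sup => //; exists z.
by rewrite sup_out.
Qed.

Lemma horner_bounded (q : {poly (C R)}) (r : R) :
  exists2 B : R, 0 <= B & forall z, modulus z <= r -> modulus q.[z] <= B.
Proof.
elim/poly_ind: q => [|q c [B B0 HB]].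
  by exists 0 => // z _; rewrite horner0 modulus0.
exists (B * `|r| + modulus c); first by rewrite addr_ge0 ?mulr_ge0 ?modulus_ge0.
move=> z zr; rewrite hornerMXaddC; apply: le_trans (modulusD _ _) _.
rewrite lerD2r modulusM; apply: ler_pM; rewrite ?modulus_ge0//; first exact: HB.
by apply: le_trans zr (ler_norm _).
Qed.

Lemma derivable_complex_id (z : C R) : derivable (fun w : C R => w) z 1.
Proof.
rewrite (_ : (fun w => w) = (fun w => w - 0)); first exact: derivable_affine_sub.
by apply: funext => w; rewrite subr0.
Qed.

Lemma derivable_complex_horner (q : {poly (C R)}) (z : C R) : derivable (horner q) z 1.
Proof.
elim/poly_ind: q => [|q c IH].
  rewrite (_ : horner 0 = fun=> 0); first exact: derivable_cst.
  by apply: funext => w; rewrite horner0.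
rewrite (_ : horner (q * 'X + c%:P) = horner q * (fun w => w) + (fun=> c)); last first.
  by apply: funext => w; rewrite hornerMXaddC.
apply: derivableD; last exact: derivable_cst.
by apply: derivableM; [exact: IH|exact: derivable_complex_id].
Qed.

Lemma horner_growth k (q : {poly (C R)}) : (size q <= k.+1)%N ->
  exists2 B : R, 0 <= B & forall z, 1 <= modulus z -> modulus q.[z] <= B * modulus z ^+ k.
Proof.
move=> sq; exists (\sum_(i < k.+1) modulus q`_i).
  by apply: sumr_ge0 => i _; exact: modulus_ge0.
move=> z z1; rewrite (horner_coef_wide _ sq); apply: le_trans (modulus_sum _ _ _) _.
rewrite mulr_suml; apply: ler_sum => i _.
rewrite modulusM modulusX ler_wpM2l ?modulus_ge0// ler_weXn2l//.
by rewrite -ltnS.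
Qed.

Lemma normalized_polysP k (z0 : C R) (p : C R -> C R) :
  normalized_polys k z0 p <->
  exists q : {poly (C R)}, [/\ (size q <= k.+1)%N, q.[z0] = 1 & forall z, p z = q.[z]].
Proof.
split.
  move=> [c ->]; exists (1 + \sum_(1 <= j < k.+1) (c j)%:P * ('X - z0%:P) ^+ j); split.
  - apply: leq_trans (size_polyD _ _) _; rewrite size_poly1 geq_max ltnS leq0n /=.
    rewrite big_nat; apply: (big_ind (fun s : {poly (C R)} => (size s <= k.+1)%N)).
    + by rewrite size_poly0.
    + by move=> u v hu hv; apply: leq_trans (size_polyD _ _) _; rewrite geq_max hu.
    + move=> j /andP[_ jk]; rewrite mul_polyC; apply: leq_trans (size_scale_leq _ _) _.
      by rewrite size_exp_XsubC.
  - rewrite !hornerE horner_sum big_nat big1 ?addr0// => j /andP[j1 _].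
    by rewrite !hornerE subrr expr0n gtn_eqF// mulr0.
  - move=> z; rewrite !hornerE horner_sum; congr (_ + _).
    by apply: eq_bigr => j _; rewrite !hornerE.
move=> [q [sq q1 pq]].
pose s := q \Po ('X + z0%:P).
have ss : (size s <= k.+1)%N by rewrite size_comp_poly2// size_XaddC.
exists (fun j => s`_j); apply: funext => z; rewrite pq.
have -> : q.[z] = s.[z - z0] by rewrite horner_comp !hornerE subrK.
rewrite (horner_coef_wide _ ss) big_ord_recl expr0 mulr1.
have -> : s`_0 = 1 by rewrite -horner_coef0 horner_comp !hornerE ?add0r.
by rewrite big_add1 big_mkord.
Qed.

Lemma min_norm_le S z0 k p : normalized_polys k z0 p -> min_norm S z0 k <= max_norm S p.
Proof.
move=> np; apply: inf_lbound; last by exists p.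
by exists 0 => _ [q _ <-]; exact: max_norm_ge0.
Qed.

Lemma le_min_norm S z0 k (B : R) :
  (forall p, normalized_polys k z0 p -> B <= max_norm S p) -> B <= min_norm S z0 k.
Proof.
move=> H; apply: lb_le_inf; last by move=> _ [p np <-]; exact: H.
exists (max_norm S (fun=> 1)); exists (fun=> 1) => //; exists (fun=> 0).
by apply: funext => z; rewrite big1 ?addr0// => j _; rewrite mul0r.
Qed.

(** If normalized polynomials [p k] attain the geometric lower bound valid for
    all normalized polynomials, then they are asymptotically optimal. *)
Lemma asymptotically_optimal_of_bounds S z0 (p : nat -> C R -> C R) (l : R) : 0 < l ->
  (\forall k \near \oo, normalized_polys k z0 (p k)) ->
  (forall t, 0 < t < l -> forall k q, normalized_polys k z0 q -> t ^+ k <= max_norm S q) ->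
  (forall t, l < t -> exists c : R, \forall k \near \oo, max_norm S (p k) <= c * t ^+ k) ->
  convergence_factor z0 S = l /\ asymptotically_optimal z0 S p.
Proof.
move=> l0 np lo up.
have cmin : (fun k => min_norm S z0 k `^ k%:R^-1) @ \oo --> l.
  apply: cvg_root => //.
    move=> t /up[c Hc]; exists c; near=> k; apply: le_trans (_ : max_norm S (p k) <= _).
      by apply: min_norm_le; near: k.
    by near: k.
  move=> t tl; exists 1 => //; apply: nearW => k; rewrite mul1r.
  by apply: le_min_norm => q; exact: lo.
have E : convergence_factor z0 S = l by exact: (cvg_limn_inf_sup cmin).2.
split=> //; split=> //; rewrite E; apply: cvg_root => //.
move=> t tl; exists 1 => //; apply: filterS np => k; rewrite mul1r.
exact: lo.
Unshelve. all: by end_near. Qed.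

End MaxNorm.

(** * The lemniscatic map and its Green's function *)

Section LemniscaticMap.
Context {R : realType} {N : nat} (E : set (C R)) (a : 'I_N -> C R) (m : 'I_N -> R)
  (mu : R) (Phi : C R -> C R).
Context (hPhi : is_lemniscatic_map E a m mu Phi).

(** By bijectivity [Phi z] lies in the lemniscatic domain. *)
Lemma absU_gt_mu z : ~ E z -> mu < absU a m (Phi z).
Proof.
move=> Ez; have [H _ _] := Phi_bijective hPhi.
by have := H (Some z); rewrite /lemniscatic_domain /=; apply=> -[w Ew [wz]]; apply: Ez; rewrite -wz.
Qed.

Lemma Phi_neq_focus z j : ~ E z -> Phi z != a j.
Proof.
move=> Ez; apply/eqP => zj; have := absU_gt_mu Ez.
rewrite /absU (bigD1 j)//= zj subrr modulus0 powR0 ?gt_eqF ?(weights_gt0 hPhi)// mul0r.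
by rewrite ltNge (ltW (mu_gt0 hPhi)).
Qed.

Lemma modulus_Phi_sub_gt0 z j : ~ E z -> 0 < modulus (Phi z - a j).
Proof. by move=> Ez; rewrite modulus_gt0 subr_eq0; exact: Phi_neq_focus. Qed.

Lemma absU_expR w : (forall j, w != a j) ->
  absU a m w = expR (\sum_(j < N) m j * ln (modulus (w - a j))).
Proof.
move=> wa; rewrite expR_sum; apply: eq_bigr => j _.
by rewrite /powR modulus_eq0 subr_eq0 (negbTE (wa j)).
Qed.

Lemma greenE z : ~ E z ->
  green a m mu Phi z = \sum_(j < N) m j * ln (modulus (Phi z - a j)) - ln mu.
Proof. by move=> Ez; rewrite /green absU_expR ?expRK// => j; exact: Phi_neq_focus. Qed.

Lemma green_gt0 z : ~ E z -> 0 < green a m mu Phi z.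
Proof.
move=> /absU_gt_mu h; have mu0 := mu_gt0 hPhi.
by rewrite subr_gt0 ltr_ln ?posrE// (lt_trans mu0).
Qed.

Lemma absU_level s z : ~ E z -> 0 < s -> green a m mu Phi z = ln s ->
  absU a m (Phi z) = mu * s.
Proof.
move=> Ez s0 /eqP; rewrite subr_eq addrC; have mu0 := mu_gt0 hPhi.
rewrite -lnM ?posrE// => /eqP/ln_inj; apply; rewrite ?posrE ?mulr_gt0//.
exact: lt_trans (absU_gt_mu Ez).
Qed.

Lemma continuous_green z : open (~` E) -> ~ E z -> {for z, continuous (green a m mu Phi)}.
Proof.
move=> /open_modulusP oE Ez; have [e e0 He] := oE _ Ez.
have cl j : {for z, continuous (fun w => m j * ln (modulus (Phi w - a j)))}.
  apply: (@continuousM _ _ (fun=> m j)); first exact: cst_continuous.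
  apply: (@continuous_comp _ _ _ (fun w => modulus (Phi w - a j)) (@ln R)); last first.
    by apply: continuous_ln; exact: modulus_Phi_sub_gt0.
  apply: (@continuous_comp _ _ _ (fun w => Phi w - a j) modulus); last exact: continuous_modulus.
  apply: (@continuousB _ _ _ Phi (fun=> a j)); last exact: cst_continuous.
  exact: derivable_continuous (Phi_holomorphic hPhi Ez).
have cs : {for z, continuous (fun w => \sum_(j < N) m j * ln (modulus (Phi w - a j)) - ln mu)}.
  apply: (@continuousB _ _ _ (fun w => \sum_(j < N) m j * ln (modulus (Phi w - a j)))
    (fun=> ln mu)).
    elim: (index_enum _) => [|j r IH].
      rewrite (_ : (fun _ => _) = fun=> 0); first exact: cst_continuous.
      by apply: funext => w; rewrite big_nil.
    rewrite (_ : (fun _ => _) = fun w => m j * ln (modulus (Phi w - a j)) +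
        \sum_(j <- r) m j * ln (modulus (Phi w - a j))).
      apply: (@continuousD _ _ _ (fun w => m j * ln (modulus (Phi w - a j)))
        (fun w => \sum_(j <- r) m j * ln (modulus (Phi w - a j)))); [exact: cl|exact: IH].
    by apply: funext => w; rewrite big_cons.
  exact: cst_continuous.
have near_eq : \forall w \near z, \sum_(j < N) m j * ln (modulus (Phi w - a j)) - ln mu =
    green a m mu Phi w.
  by apply/nbhs_modulusP; exists e => // w /He Ew; rewrite greenE.
rewrite /prop_for /continuous_at (greenE Ez).
exact: cvg_trans (near_eq_cvg near_eq) cs.
Qed.

(** [Phi z - z] vanishes at infinity and the foci are bounded. *)
Lemma Phi_growth (r0 : R) : (forall z, E z -> modulus z <= r0) ->
  exists2 r : R, 1 < r & forall z, r < modulus z ->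
    ~ E z /\ forall j, modulus z / 2 <= modulus (Phi z - a j) <= 2 * modulus z.
Proof.
move=> Er; have [M [r1 [r10 HM]]] := Phi_normalized hPhi.
pose A := \sum_(j < N) modulus (a j).
have A0 : 0 <= A by apply: sumr_ge0 => j _; exact: modulus_ge0.
exists (1 + `|r0| + r1 + 2 * (`|M| + A)).
  by rewrite -!addrA ltrDl ltr_wpDl// ltr_wpDr// mulr_ge0// addr_ge0.
move=> z zr; have M0 := normr_ge0 M; have r00 := normr_ge0 r0.
have z1 : 1 < modulus z by clear -zr r10 A0 M0 r00; lra.
split.
  by move=> /Er; have := ler_norm r0; clear -zr r10 A0 M0 r00; lra.
move=> j; have ja : modulus (a j) <= A.
  by rewrite /A (bigD1 j)//= lerDl sumr_ge0// => i _; exact: modulus_ge0.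
have h1 : modulus (Phi z - z) <= `|M|.
  apply: le_trans (HM z _) _; first by clear -zr r10 A0 M0 r00; lra.
  apply: le_trans (_ : `|M| / modulus z <= _).
    by rewrite ler_wpM2r ?invr_ge0 ?modulus_ge0// ler_norm.
  by rewrite ler_pdivrMr ?(lt_trans ltr01)// ler_peMr// ltW.
have h2 : modulus ((Phi z - a j) - z) <= `|M| + A.
  rewrite addrAC; apply: le_trans (modulusD _ _) _; rewrite modulusN; exact: lerD.
have h3 := modulusBl z (z - (Phi z - a j)).
have h4 := modulusBl (Phi z - a j) z.
rewrite subKr in h3; rewrite (modulusB z (Phi z - a j)) in h3.
move: h2 h3 h4 zr; clear -r10 A0 M0 r00.
move: (modulus _) (modulus _) (modulus _) => u v s; lra.
Qed.

(** On [K] each [Phi z - a j] and its inverse are continuous, hence bounded. *)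
Lemma log_Phi_bounded K : compact K -> (forall z, K z -> ~ E z) ->
  exists2 B : R, 0 <= B & forall z j, K z -> `|ln (modulus (Phi z - a j))| <= B.
Proof.
move=> cK KE.
have cPhi j : continuous_at_points K (fun z => Phi z - a j).
  move=> z /KE Ez; apply: (@continuousB _ _ _ Phi (fun=> a j)); last exact: cst_continuous.
  exact: derivable_continuous (Phi_holomorphic hPhi Ez).
have cPhiV j : continuous_at_points K (fun z => (Phi z - a j)^-1).
  move=> z Kz; apply: (@continuousV _ _ (fun z => Phi z - a j)); last exact: cPhi.
  by rewrite subr_eq0; exact: Phi_neq_focus (KE _ Kz).
have /choice[B HB] : forall j, exists B : R, 0 <= B /\
    forall z, K z -> `|ln (modulus (Phi z - a j))| <= B.
  move=> j; have [M M0 HM] := continuous_on_compact_bounded cK (cPhi j).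
  have [M' M'0 HM'] := continuous_on_compact_bounded cK (cPhiV j).
  exists (`|ln M| + `|ln M'|); split; first exact: addr_ge0.
  move=> z Kz; have x0 := modulus_Phi_sub_gt0 j (KE _ Kz).
  have h1 : ln (modulus (Phi z - a j)) <= ln M by rewrite ler_ln ?posrE// HM.
  have h2 : - ln (modulus (Phi z - a j)) <= ln M'.
    by rewrite -lnV ?posrE// -modulusV ler_ln ?posrE ?HM'// modulusV invr_gt0.
  have := ler_norm (ln M); have := ler_norm (ln M').
  have := normr_ge0 (ln M); have := normr_ge0 (ln M').
  move: h1 h2; rewrite ler_norml; clear; move: (ln _) (ln _) (ln _) => u v w; lra.
exists (\sum_(j < N) B j); first by apply: sumr_ge0 => j _; have [] := HB j.
move=> z j Kz; have [_ /(_ z Kz) h] := HB j; apply: le_trans h _.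
by rewrite (bigD1 j)//= lerDl sumr_ge0// => i _; have [] := HB i.
Qed.

Section NodePolynomials.
Context (alpha : nat -> C R) (halpha : admissible a m alpha).

Lemma ln_node_poly w k : (forall j, w != a j) ->
  ln (modulus (node_poly alpha k w)) =
  \sum_(j < N) (focus_count a alpha k j)%:R * ln (modulus (w - a j)) /\
  0 < modulus (node_poly alpha k w).
Proof.
move=> wa; elim: k => [|k [IH IH0]].
  rewrite /node_poly big_ord0 modulus1 ln1 big1// => j _.
  by rewrite /focus_count big_ord0 mul0r.
have [/(_ k)[j0 kj0] _] := halpha.
have x0 : 0 < modulus (w - alpha k) by rewrite modulus_gt0 subr_eq0 kj0.
rewrite /node_poly big_ord_recr /= modulusM -/(node_poly alpha k w); split; last exact: mulr_gt0.
rewrite lnM ?posrE// IH.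
have -> : ln (modulus (w - alpha k)) =
    \sum_(j < N) (alpha k == a j)%:R * ln (modulus (w - a j)).
  rewrite (bigD1 j0)//= kj0 eqxx mul1r big1 ?addr0// => j jj0.
  by rewrite (inj_eq (foci_distinct hPhi)) eq_sym (negbTE jj0) mul0r.
rewrite -big_split; apply: eq_bigr => j _ /=.
by rewrite /focus_count big_ord_recr /= natrD mulrDl.
Qed.

(** On a set where all [ln |w - a j|] are bounded, [|u_k|] and [|U| ^ k] agree
    up to a constant independent of [k]: this is what admissibility is for. *)
Lemma node_poly_compare (B : R) : 0 <= B ->
  exists2 c : R, 0 < c & forall w k, (forall j, w != a j) ->
    (forall j, `|ln (modulus (w - a j))| <= B) ->
    c^-1 * absU a m w ^+ k <= modulus (node_poly alpha k w) <= c * absU a m w ^+ k.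
Proof.
move=> B0; have [_ [A A0 HA]] := halpha.
exists (expR (\sum_(j < N) A * B)); first exact: expR_gt0.
move=> w k wa lB; have [lnu u0] := ln_node_poly k wa.
rewrite -expRN absU_expR// -expRM_natl -!expRD -[modulus _]lnK ?posrE// lnu !ler_expR.
set S := \sum_(j < N) m j * _; set T := \sum_(j < N) (focus_count a alpha k j)%:R * _.
have : `|T - k%:R * S| <= \sum_(j < N) A * B.
  rewrite /S /T mulr_sumr -sumrB; apply: le_trans (ler_norm_sum _ _ _) _.
  apply: ler_sum => j _; rewrite mulrA -mulrBl normrM; apply: ler_pM => //.
  (* Admissibility bounds the deviation for [1 <= k]; for [k = 0] it is [0]. *)
  case: k {lnu u0 S T} => [|k]; last exact: HA.
  by rewrite /focus_count big_ord0 mul0r subrr normr0 ltW.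
rewrite ler_norml; move: (\sum_(j < N) A * B) (k%:R * S) => u v; clear; lra.
Qed.

Lemma node_poly_on_compact K : compact K -> (forall z, K z -> ~ E z) ->
  exists2 c : R, 0 < c & forall z k, K z ->
    c^-1 * absU a m (Phi z) ^+ k <= modulus (node_poly alpha k (Phi z))
      <= c * absU a m (Phi z) ^+ k.
Proof.
move=> cK KE; have [B B0 HB] := log_Phi_bounded cK KE.
have [c c0 Hc] := node_poly_compare B0; exists c => // z k Kz; apply: Hc.
  by move=> j; exact: Phi_neq_focus (KE _ Kz).
by move=> j; exact: HB.
Qed.

Lemma node_poly_neq0 z k : ~ E z -> node_poly alpha k (Phi z) != 0.
Proof.
move=> Ez; rewrite -modulus_gt0.
by have [] := @ln_node_poly (Phi z) k (fun j => Phi_neq_focus j Ez).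
Qed.

Lemma derivable_node_poly z k : ~ E z ->
  derivable (fun z => node_poly alpha k (Phi z)) z 1.
Proof.
move=> Ez; elim: k => [|k IH].
  rewrite (_ : (fun z => node_poly alpha 0 (Phi z)) = fun=> 1); first exact: derivable_cst.
  by apply: funext => w; rewrite /node_poly big_ord0.
rewrite (_ : (fun z => node_poly alpha k.+1 (Phi z)) =
   (fun z => node_poly alpha k (Phi z)) * (Phi - (fun=> alpha k))); last first.
  by apply: funext => w; rewrite /node_poly big_ord_recr.
apply: derivableM; first exact: IH.
apply: derivableB; last exact: derivable_cst.
exact: Phi_holomorphic hPhi _ Ez.
Qed.

Lemma node_poly_growth (r : R) : 1 < r -> (forall z, r < modulus z ->
    ~ E z /\ forall j, modulus z / 2 <= modulus (Phi z - a j) <= 2 * modulus z) ->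
  forall z k, r < modulus z ->
    (modulus z / 2) ^+ k <= modulus (node_poly alpha k (Phi z)) <= (2 * modulus z) ^+ k.
Proof.
move=> r1 Hr z k zr; have [Ez H] := Hr z zr.
have z0 : 0 <= modulus z / 2 by rewrite divr_ge0// modulus_ge0.
have z20 : 0 <= 2 * modulus z by rewrite mulr_ge0// modulus_ge0.
elim: k => [|k /andP[IH1 IH2]].
  by rewrite /node_poly big_ord0 modulus1 !expr0 lexx.
have [/(_ k)[j kj] _] := halpha; have /andP[h1 h2] := H j.
rewrite /node_poly big_ord_recr /= modulusM !exprSr kj; apply/andP; split.
  by apply: ler_pM => //; exact: exprn_ge0.
by apply: ler_pM => //; exact: modulus_ge0.
Qed.

End NodePolynomials.
End LemniscaticMap.

(** * Faber--Walsh polynomials *)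

Section FaberWalsh.
Context {R : realType} {N : nat} (E : set (C R)) (a : 'I_N -> C R) (m : 'I_N -> R)
  (mu : R) (Phi : C R -> C R).
Context (hPhi : is_lemniscatic_map E a m mu Phi).
Context (alpha : nat -> C R) (halpha : admissible a m alpha).
Context (b : nat -> C R -> C R) (hb : faber_walsh E a m mu Phi alpha b).
Context (cE : closed E) (e0 : C R) (Ee0 : E e0).

Local Notation green := (green a m mu Phi).
Local Notation level_curve := (level_curve E a m mu Phi).
Local Notation level_interior := (level_interior E a m mu Phi).
Local Notation u := (fun k z => node_poly alpha k (Phi z)).
Local Notation winding l L := (winds_around (level_interior l) (level_curve l) L two_pi_i).

Let oE : open (~` E). Proof. by rewrite openC. Qed.

Lemma two_pi_i_neq0 : (two_pi_i : C R) != 0.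
Proof.
apply/eqP => /(congr1 (@complex.Im R)) /=; apply/eqP.
by rewrite mulf_neq0 ?pnatr_eq0// gt_eqF// pi_gt0.
Qed.

(** A positive parametrization prescribes the integrals of [(x - z)^-1], that
    is, the winding numbers. *)
Lemma winding_of_parametrization l n (g : 'I_n -> R -> C R) :
  positive_parametrization (level_curve l) (level_interior l) g ->
  winding l (contour_integral g).
Proof.
move=> [Jg Gg _ Din Dout].
have inv z : (fun w : C R => 1 / (w - z)) = (fun w => (w - z)^-1).
  by apply: funext => w; rewrite div1r.
split.
- by rewrite -Gg; exact: contour_integral_functional.
- exact: two_pi_i_neq0.
- by move=> z [Ez [nEz _]//|[_ gl] [_ gE]]; move: gl; rewrite gE ltxx.
- by move=> z /Din; rewrite /cauchy_transform inv.
- by move=> z Dz Gz; rewrite /cauchy_transform inv; exact: Dout.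
Qed.

Lemma exists_winding l : 1 < l -> exists L, winding l L.
Proof.
move=> l1; have [|v [n [g Hg _]] _] := hb 0 (z := e0) l1; first by left.
by exists (contour_integral g); exact: winding_of_parametrization.
Qed.

Lemma level_interior_exhaust z : exists2 l, 1 < l & level_interior l z.
Proof.
have [Ez|Ez] := pselect (E z); first by exists 2; [rewrite ltr1n|left].
exists (expR (green z + 1)).
  by rewrite -expR0 ltr_expR addr_gt0// (green_gt0 hPhi).
by right; split=> //; rewrite expRK ltrDl.
Qed.

Lemma E_bounded : exists r : R, forall z, E z -> modulus z <= r.
Proof.
have [L wL] := exists_winding (ltr1n R 2).
have [r r0 Hr] := winds_around_bounded wL; exists r => z Ez.
by rewrite leNgt; apply/negP => /Hr[Dz _]; apply: Dz; left.
Qed.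

(** Two polynomials asymptotic to the same function differ by an entire
    function that vanishes at infinity. *)
Lemma horner_eq_of_asymptotic (p q : {poly (C R)}) (f : C R -> C R) :
  (forall e : R, 0 < e -> exists2 r : R, 0 < r &
    forall z, r < modulus z -> modulus (p.[z] - f z) <= e) ->
  (forall e : R, 0 < e -> exists2 r : R, 0 < r &
    forall z, r < modulus z -> modulus (q.[z] - f z) <= e) ->
  forall z, p.[z] = q.[z].
Proof.
move=> Hp Hq z; apply/eqP; rewrite -subr_eq0 -hornerN -hornerD; apply/eqP.
apply: (entire_vanishing_at_infinity (@derivable_complex_horner R (p - q))) => e e0'.
have e2 : 0 < e / 2 by rewrite divr_gt0.
have [r1 r10 H1] := Hp _ e2; have [r2 r20 H2] := Hq _ e2.
exists (Num.max r1 r2); first by rewrite lt_max r10.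
move=> w; rewrite gt_max => /andP[/H1 h1 /H2 h2].
rewrite hornerD hornerN.
have -> : p.[w] - q.[w] = (p.[w] - f w) - (q.[w] - f w) by move: p.[w] q.[w] (f w) => x y t; ring.
by apply: le_trans (modulusD _ _) _; rewrite modulusN [e]splitr lerD.
Qed.

Lemma exterior_asymptotic D G L c (f : C R -> C R) (q : {poly (C R)}) :
  winds_around D G L c -> continuous_at_points G f ->
  (forall z, ~ D z -> ~ G z -> cauchy_transform L f z = c * (q.[z] - f z)) ->
  forall e : R, 0 < e -> exists2 r : R, 0 < r &
    forall z, r < modulus z -> modulus (q.[z] - f z) <= e.
Proof.
move=> wL cf H e e0'; have c0 := wa_neq0 wL.
have c0' : 0 < modulus c by rewrite modulus_gt0.
have [r1 r10 H1] := winds_around_bounded wL.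
have [r2 r20 H2] := cauchy_transform_infty (wa_functional wL) cf (e := modulus c * e)
  ltac:(by rewrite mulr_gt0).
exists (Num.max r1 r2); first by rewrite lt_max r10.
move=> z; rewrite gt_max => /andP[/H1[Dz Gz] /H2[_]].
by rewrite H// modulusM ltr_pM2l// => /ltW.
Qed.

Lemma level_curve_off_E l z : level_curve l z -> ~ E z.
Proof. by case. Qed.

Lemma continuous_node_poly l k : continuous_at_points (level_curve l) (u k).
Proof.
by move=> z [Ez _]; exact: derivable_continuous (derivable_node_poly hPhi Ez).
Qed.

(** By the exterior Cauchy theorem the Cauchy integral defining [b k z] is a
    polynomial in [z] that is asymptotic to [u_k o Phi] at infinity.  This property
    determines it, so that neither the level nor the parametrization matters; outside
    the level curve the same integral gives the difference [b k - u_k o Phi]. *)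
Theorem faber_walsh_representation : exists P : nat -> {poly (C R)},
  [/\ forall k, (size (P k) <= k.+1)%N, forall k z, b k z = (P k).[z] &
    forall l L, winding l L -> forall k,
      (forall z, level_interior l z -> cauchy_transform L (u k) z = two_pi_i * b k z) /\
      (forall z, ~ level_interior l z -> ~ level_curve l z ->
         cauchy_transform L (u k) z = two_pi_i * (b k z - u k z))].
Proof.
have [r Er] := E_bounded.
have [rho rho1 Hrho] := Phi_growth hPhi Er.
have ext l L k : winding l L -> exists q : {poly (C R)}, [/\ (size q <= k.+1)%N,
    forall z, level_interior l z -> cauchy_transform L (u k) z = two_pi_i * q.[z] &
    forall z, ~ level_interior l z -> ~ level_curve l z ->
      cauchy_transform L (u k) z = two_pi_i * (q.[z] - u k z)].
  move=> wL; have dk (w : C R) : ~ E w -> derivable (u k) w 1.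
    move=> Ew.
    have H := @derivable_node_poly _ _ _ _ _ _ _ hPhi alpha w k Ew.
    exact: H.
  apply: (@cauchy_exterior R E _ _ L two_pi_i (u k) k (2 ^+ k) rho cE _ wL).
  - by move=> z Ez; left.
  - exact: dk.
  - move=> z zr; rewrite -exprMn.
    by have /andP[] := node_poly_growth halpha rho1 Hrho k zr.
have [L0 wL0] := exists_winding (ltr1n R 2).
have /choice[P HP] := fun k => ext 2 L0 k wL0.
have eqP l L k (q : {poly (C R)}) : winding l L ->
    (forall z, ~ level_interior l z -> ~ level_curve l z ->
      cauchy_transform L (u k) z = two_pi_i * (q.[z] - u k z)) ->
    forall z, q.[z] = (P k).[z].
  move=> wL Hq; have [_ _ HPk] := HP k.
  apply: (horner_eq_of_asymptotic (f := u k)).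
    exact: exterior_asymptotic wL (@continuous_node_poly l k) Hq.
  exact: exterior_asymptotic wL0 (@continuous_node_poly 2 k) HPk.
have bP k z : b k z = (P k).[z].
  have [l l1 Dz] := level_interior_exhaust z.
  have [v [n [g Hg vE]] ->] := hb k l1 Dz.
  have wg := winding_of_parametrization Hg.
  have [q [_ qin qout]] := ext l _ k wg.
  rewrite vE -(eqP l _ k q wg qout); have := qin z Dz.
  rewrite /cauchy_transform => ->.
  by rewrite mulKf// two_pi_i_neq0.
exists P; split=> //; first by move=> k; have [] := HP k.
move=> l L wL k; have [q [_ qin qout]] := ext l L k wL.
have qP := eqP l L k q wL qout.
by split=> [z Dz|z Dz Gz]; rewrite bP -qP; [exact: qin|exact: qout].
Qed.

Definition sublevel (s : R) : set (C R) := E `|` [set z | ~ E z /\ green z <= ln s].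

Lemma sublevel_closed s : closed (sublevel s).
Proof.
rewrite -openC; apply/open_modulusP => z Sz.
have Ez : ~ E z by move=> Ez; apply: Sz; left.
have gz : ln s < green z by rewrite ltNge; apply/negP => h; apply: Sz; right.
have [e e0' He] := (open_modulusP _).1 oE z Ez.
have := continuous_green hPhi oE Ez => /cvgrPdist_lt/(_ (green z - ln s)).
rewrite subr_gt0 => /(_ gz)/nbhs_modulusP[d d0 Hd].
exists (Num.min e d); first by rewrite lt_min e0'.
move=> w; rewrite lt_min => /andP[/He Ew /Hd h] [//|[_ wS]].
by move: h; rewrite ltr_norml ltrD2l ltrN2 => /andP[_]; rewrite ltNge wS.
Qed.

Lemma closure_level_interior s : closure (level_interior s) `<=` sublevel s.
Proof.
have sub : level_interior s `<=` sublevel s.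
  by move=> z [Ez|[Ez /ltW gz]]; [left|right].
by move=> z /(closure_subset sub); rewrite -((closure_id _).1 (@sublevel_closed s)).
Qed.

Lemma sublevel_sub_interior s l : 0 < s -> s < l -> sublevel s `<=` level_interior l.
Proof.
move=> s0 sl z [Ez|[Ez gz]]; [by left|right; split=> //; apply: le_lt_trans gz _].
by rewrite ltr_ln ?posrE// (lt_trans s0).
Qed.

Lemma sublevel_bounded s : 0 < s -> exists r : R, forall z, sublevel s z -> modulus z <= r.
Proof.
move=> s0; have l1 : 1 < 1 + s by rewrite ltrDl.
have [L wL] := exists_winding l1.
have [r r0 Hr] := winds_around_bounded wL; exists r => z Sz.
rewrite leNgt; apply/negP => /Hr[Dz _]; apply: Dz.
by apply: sublevel_sub_interior Sz; rewrite ?ltrDr.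
Qed.

(** Cauchy integral over the level curve [l], on which [|U o Phi|] is the
    constant [mu * l]. *)
Lemma faber_walsh_le s l : 0 < s -> s < l -> 1 < l ->
  exists C0 : R, forall k z, sublevel s z -> modulus (b k z) <= C0 * (mu * l) ^+ k.
Proof.
move=> s0 sl l1; have [L wL] := exists_winding l1.
have l0 : 0 < l by exact: lt_trans ltr01 l1.
have [P [_ _ HP]] := faber_walsh_representation.
have HL := wa_functional wL; have cG := cf_compact HL.
have [c c0 Hc] := node_poly_on_compact hPhi halpha cG (@level_curve_off_E l).
have [V V0 HV] := cf_bound HL.
have [|d d0 Hd] := compact_closed_distance cG (@sublevel_closed s).
  by move=> z Gz /(sublevel_sub_interior s0 sl) /(wa_disjoint wL).
have p0 : 0 < modulus (two_pi_i : C R) by rewrite modulus_gt0 two_pi_i_neq0.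
exists (V * (c / d) / modulus (two_pi_i : C R)) => k z Sz.
have [/(_ z (sublevel_sub_interior s0 sl Sz)) bE _] := HP l L wL k.
rewrite mulrAC ler_pdivlMr// mulrC -modulusM -bE.
have -> : V * (c / d) * (mu * l) ^+ k = V * (c * (mu * l) ^+ k / d) by ring.
have ml0 : 0 <= c * (mu * l) ^+ k.
  by apply: mulr_ge0; [exact: ltW|apply/exprn_ge0/mulr_ge0; apply/ltW => //; exact: (mu_gt0 hPhi)].
apply: (cauchy_transform_le HL (@continuous_node_poly l k) d0 ml0 _ _ HV).
  by move=> w Gw; exact: Hd.
move=> w Gw; have /andP[_] := Hc w k Gw.
by case: Gw => Ew gw; rewrite (absU_level hPhi Ew l0 gw).
Qed.

(** The remainder is a Cauchy integral over a level curve inside that of [z],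
    hence exponentially smaller than [u_k (Phi z)]. *)
Lemma faber_walsh_remainder s l z : 1 < l -> l < s -> ~ E z -> green z = ln s ->
  exists C0 : R, forall k, modulus (b k z - u k z) <= C0 * (mu * l) ^+ k.
Proof.
move=> l1 ls Ez gz; have [L wL] := exists_winding l1.
have l0 : 0 < l by exact: lt_trans ltr01 l1.
have lns : ln l < ln s by rewrite ltr_ln ?posrE// (lt_trans l0).
have [P [_ _ HP]] := faber_walsh_representation.
have HL := wa_functional wL; have cG := cf_compact HL.
have [c c0 Hc] := node_poly_on_compact hPhi halpha cG (@level_curve_off_E l).
have [V V0 HV] := cf_bound HL.
have Gz : ~ level_curve l z by move=> [_]; rewrite gz => h; rewrite h ltxx in lns.
have Dz : ~ level_interior l z by move=> [//|[_]]; rewrite gz ltNge (ltW lns).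
have [d d0 Hd] := ball_off_compact cG Gz.
have p0 : 0 < modulus (two_pi_i : C R) by rewrite modulus_gt0 two_pi_i_neq0.
exists (V * (c / d) / modulus (two_pi_i : C R)) => k.
have [_ /(_ z Dz Gz) bE] := HP l L wL k.
rewrite mulrAC ler_pdivlMr// mulrC -modulusM -bE.
have -> : V * (c / d) * (mu * l) ^+ k = V * (c * (mu * l) ^+ k / d) by ring.
have ml0 : 0 <= c * (mu * l) ^+ k.
  by apply: mulr_ge0; [exact: ltW|apply/exprn_ge0/mulr_ge0; apply/ltW => //; exact: (mu_gt0 hPhi)].
apply: (cauchy_transform_le HL (@continuous_node_poly l k) d0 ml0 _ _ HV).
  by move=> w Gw; apply: Hd Gw; rewrite subrr modulus0.
move=> w Gw; have /andP[_] := Hc w k Gw.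
by case: Gw => Ew gw; rewrite (absU_level hPhi Ew l0 gw).
Qed.

Lemma node_poly_at_level s z : 0 < s -> ~ E z -> green z = ln s ->
  exists2 c : R, 0 < c & forall k,
    c^-1 * (mu * s) ^+ k <= modulus (u k z) <= c * (mu * s) ^+ k.
Proof.
move=> s0 Ez gz; have zE w : [set z] w -> ~ E w by move=> ->.
have [c c0 Hc] := node_poly_on_compact hPhi halpha (@compact_set1 _ z) zE.
by exists c => // k; have := Hc z k erefl; rewrite (absU_level hPhi Ez s0 gz).
Qed.

(** The term [u_k (Phi z)], of size [(mu * s) ^ k], dominates the remainder. *)
Lemma faber_walsh_growth s z : 1 < s -> ~ E z -> green z = ln s ->
  exists c C0 : R, [/\ 0 < c, 0 < C0, forall k, modulus (b k z) <= C0 * (mu * s) ^+ k &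
    \forall k \near \oo, c * (mu * s) ^+ k <= modulus (b k z)].
Proof.
move=> s1 Ez gz; have s0 : 0 < s by exact: lt_trans s1.
have mu0 := mu_gt0 hPhi.
pose l := (1 + s) / 2.
have l1 : 1 < l by rewrite /l; lra.
have ls : l < s by rewrite /l; lra.
have l0 : 0 < l by exact: lt_trans l1.
have [C1 HC1] := faber_walsh_remainder l1 ls Ez gz.
have [c c0 Hc] := node_poly_at_level s0 Ez gz.
have ml : 0 <= mu * l < mu * s.
  by rewrite mulr_ge0 ?(ltW mu0) ?(ltW l0)//= ltr_pM2l.
have C10 : 0 <= C1 by have := HC1 0%N; rewrite expr0 mulr1; apply: le_trans; exact: modulus_ge0.
exists (c^-1 / 2), (c + C1); split.
- by rewrite divr_gt0// invr_gt0.
- by rewrite ltr_wpDr.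
- move=> k; rewrite -[b k z](subrK (u k z)) mulrDl addrC.
  apply: le_trans (modulusD _ _) _; apply: lerD; first by have /andP[] := Hc k.
  apply: le_trans (HC1 k) _; rewrite ler_wpM2l//.
  by case/andP: ml => h1 h2; rewrite lerXn2r ?nnegrE ?(ltW h2)// (le_trans h1 (ltW h2)).
apply: filterS (absorb_constant (2 * c * C1) ml) => k hk.
have /andP[h1 _] := Hc k; have h2 := HC1 k.
have h3 := modulusBl (u k z) (u k z - b k z); rewrite subKr modulusB in h3.
have h4 : C1 * (mu * l) ^+ k <= c^-1 / 2 * (mu * s) ^+ k.
  rewrite -invfM [leRHS]mulrC ler_pdivlMr ?mulr_gt0//; apply: le_trans hk.
  by rewrite le_eqVlt; apply/orP; left; apply/eqP; ring.
have -> : c^-1 / 2 * (mu * s) ^+ k = c^-1 * (mu * s) ^+ k - c^-1 / 2 * (mu * s) ^+ k.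
  by field; rewrite gt_eqF.
move: h1 h2 h3 h4.
move: (c^-1 * _) (c^-1 / 2 * _) (C1 * _) => x y t.
by move: (modulus _) (modulus _) (modulus _) => i j n; lra.
Qed.

(** Over an empty contour every integral vanishes, but the winding number
    around a point of [E] does not. *)
Lemma level_curve_nonempty l : 1 < l -> exists z, level_curve l z.
Proof.
move=> l1; have [L wL] := exists_winding l1.
apply: contrapT => H; have HL := wa_functional wL.
have G0 z : ~ level_curve l z by move=> Gz; apply: H; exists z.
have [V V0 HV] := cf_bound HL.
have h1 := HV (fun w => 1 / (w - e0)) 0 (lexx _) (fun z Gz => False_ind _ (G0 z Gz))
  (fun z Gz => False_ind _ (G0 z Gz)).
have p0 := two_pi_i_neq0; rewrite -modulus_gt0 in p0.
move: p0; rewrite ltNge => /negP; apply.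
rewrite -(wa_inside wL (z := e0) (or_introl Ee0)).
by apply: le_trans h1 _; rewrite mulr0.
Qed.

(** The function [p ^+ n / u_(k n)] is holomorphic off [E] and bounded at
    infinity, so after division by [z - e0] its value at [z0] is given by its
    values on the level curve.  The constants are independent of [n], hence
    disappear when [n]-th roots are taken. *)
Theorem bernstein_walsh k (p : {poly (C R)}) s s0 z0 (B : R) :
  1 < s -> s < s0 -> ~ E z0 -> green z0 = ln s0 -> (size p <= k.+1)%N -> 0 <= B ->
  (forall z, level_curve s z -> modulus p.[z] <= B) ->
  modulus p.[z0] <= (s0 / s) ^+ k * B.
Proof.
move=> s1 ss0 Ez0 gz0 sp B0 pB.
have sp0 : 0 < s by exact: lt_trans s1.
have s00 : 0 < s0 by exact: lt_trans ss0.
have mu0 := mu_gt0 hPhi.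
have [L wL] := exists_winding s1.
have HL := wa_functional wL; have cG := cf_compact HL.
have [V V0 HV] := cf_bound HL.
have lns : ln s < ln s0 by rewrite ltr_ln ?posrE.
have Gz0 : ~ level_curve s z0 by move=> [_]; rewrite gz0 => h; rewrite h ltxx in lns.
have Dz0 : ~ level_interior s z0 by move=> [//|[_]]; rewrite gz0 ltNge (ltW lns).
have Ge0 : ~ level_curve s e0 by case.
have [d d0 Hd] := ball_off_compact cG Gz0.
have [d' d'0 Hd'] := ball_off_compact cG Ge0.
have [c c0 Hc] := node_poly_on_compact hPhi halpha cG (@level_curve_off_E s).
have [c' c'0 Hc'] := node_poly_at_level s00 Ez0 gz0.
have p0 : 0 < modulus (two_pi_i : C R) by rewrite modulus_gt0 two_pi_i_neq0.
have z0e0 : z0 != e0 by apply/eqP => h; apply: Ez0; rewrite h.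
have z0e0' : 0 < modulus (z0 - e0) by rewrite modulus_gt0 subr_eq0.
have ugt0 w i : ~ E w -> 0 < modulus (node_poly alpha i (Phi w)).
  by move=> Ew; rewrite modulus_gt0; have := node_poly_neq0 hPhi halpha i Ew.
(* All factors that do not depend on the exponent [n]. *)
pose K := V * (c / d' / d) / modulus (two_pi_i : C R) * modulus (z0 - e0) * c'.
apply: (@power_bounded_le _ _ _ K); rewrite ?modulus_ge0//.
  by rewrite mulr_ge0// exprn_ge0// divr_ge0// ltW.
move=> n; pose h z := p.[z] ^+ n * ((node_poly alpha (k * n) (Phi z))^-1 * (z - e0)^-1).
have dh z : ~ E z -> derivable h z 1.
  move=> Ez; have ze0 : z - e0 != 0 by rewrite subr_eq0; apply/eqP => zE; apply: Ez; rewrite zE.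
  have d1 := derivable_funV (f := fun z => node_poly alpha (k * n) (Phi z))
    (node_poly_neq0 hPhi halpha (k * n)%N Ez)
    (@derivable_node_poly _ _ _ _ _ _ _ hPhi alpha z (k * n) Ez).
  have d2 := derivable_funV (f := fun z => z - e0) ze0 (@derivable_affine_sub R e0 z).
  have d3 : derivable (fun z => p.[z] ^+ n) z 1.
    rewrite (_ : (fun z => p.[z] ^+ n) = horner (p ^+ n)); first exact: derivable_complex_horner.
    by apply: funext => w; rewrite horner_exp.
  exact: derivable_funM d3 (derivable_funM d1 d2).
have ch : continuous_at_points (level_curve s) h.
  by move=> z [Ez _]; exact: derivable_continuous (dh z Ez).
have [r Er] := E_bounded.
have [rho rho1 Hrho] := Phi_growth hPhi Er.
have [S S0 HS] := horner_growth sp.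
pose M := S ^+ n * 2 ^+ (k * n) * 2.
have M0 : 0 <= M by rewrite !mulr_ge0 ?exprn_ge0.
have e00 := modulus_ge0 e0.
have growth z : rho + 2 * modulus e0 < modulus z -> modulus (h z) <= M / modulus z.
  move=> zr; have zrho : rho < modulus z by apply: le_lt_trans zr; rewrite lerDl mulr_ge0.
  have z1 : 1 < modulus z by exact: lt_trans zrho.
  have zp : 0 < modulus z by exact: lt_trans z1.
  rewrite /h !modulusM !modulusV modulusX.
  have -> : M / modulus z = (S * modulus z ^+ k) ^+ n *
      (((modulus z / 2) ^+ (k * n))^-1 * (modulus z / 2)^-1).
    rewrite exprMn -exprM expr_div_n /M; field.
    by rewrite !expf_neq0 ?gt_eqF// pnatr_eq0.
  apply: ler_pM; rewrite ?exprn_ge0 ?modulus_ge0 ?mulr_ge0 ?invr_ge0 ?modulus_ge0//.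
    by rewrite lerXn2r ?nnegrE ?modulus_ge0 ?mulr_ge0 ?exprn_ge0 ?(ltW zp)// HS// ltW.
  have [Ez _] := Hrho z zrho.
  apply: ler_pM; rewrite ?invr_ge0 ?modulus_ge0//.
    rewrite lef_pV2 ?posrE ?exprn_gt0 ?divr_gt0//.
      by have /andP[] := node_poly_growth halpha rho1 Hrho (k * n) zrho.
    by exact: ugt0 Ez.
  have h1 : modulus z / 2 <= modulus (z - e0).
    by have := modulusBl z e0; lra.
  rewrite lef_pV2 ?posrE ?divr_gt0//.
  by apply: lt_le_trans h1; rewrite divr_gt0.
have rp : 0 <= rho + 2 * modulus e0 by lra.
have [||q [sq _ qout]] := @cauchy_exterior R E _ _ L two_pi_i h 0 M
  (rho + 2 * modulus e0) cE _ wL dh.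
- by move=> z Ez; left.
- move=> z zr; rewrite expr0 mulr1; apply: le_trans (growth z zr) _.
  have z1 : 1 < modulus z by apply: le_lt_trans zr; lra.
  by rewrite ler_pdivrMr ?(lt_trans ltr01)// ler_peMr// ltW.
(* [h] vanishes at infinity, and so does the polynomial asymptotic to it. *)
have q0 : q.[z0] = 0.
  rewrite -[RHS](horner0 z0); apply: (horner_eq_of_asymptotic (f := h)).
    exact: exterior_asymptotic wL ch qout.
  move=> e e0''; exists (rho + 2 * modulus e0 + M / e).
    by rewrite ltr_pwDl ?divr_ge0 ?(ltW e0'')//; lra.
  move=> z zr; have zr' : rho + 2 * modulus e0 < modulus z.
    by apply: le_lt_trans zr; rewrite lerDl divr_ge0// ltW.
  have zp : 0 < modulus z by exact: le_lt_trans rp zr'.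
  rewrite horner0 sub0r modulusN; apply: le_trans (growth z zr') _.
  rewrite ler_pdivrMr// mulrC -ler_pdivrMr//.
  by apply: le_trans (ltW zr); rewrite lerDr.
have hz0 := qout z0 Dz0 Gz0; rewrite q0 sub0r in hz0.
have ms0 : 0 < (mu * s) ^+ (k * n) by rewrite exprn_gt0// mulr_gt0.
pose T := B ^+ n * (c / (mu * s) ^+ (k * n) / d').
have T0 : 0 <= T by rewrite mulr_ge0 ?exprn_ge0// !divr_ge0// ltW.
have hT w : level_curve s w -> modulus (h w) <= T.
  move=> Gw; have /andP[h1 _] := Hc w (k * n)%N Gw.
  have Ew := level_curve_off_E Gw.
  rewrite (absU_level hPhi Ew sp0) in h1; last by case: Gw.
  rewrite /h !modulusM !modulusV modulusX; apply: ler_pM.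
  - by rewrite exprn_ge0 ?modulus_ge0.
  - by rewrite mulr_ge0 ?invr_ge0 ?modulus_ge0.
  - by rewrite lerXn2r ?nnegrE ?modulus_ge0// pB.
  apply: ler_pM; rewrite ?invr_ge0 ?modulus_ge0//.
    rewrite -[leRHS]invrK invf_div lef_pV2 ?posrE ?divr_gt0//; last first.
      by exact: ugt0 Ew.
    by rewrite mulrC.
  have h2 := Hd' e0 w ltac:(by rewrite subrr modulus0) Gw.
  by rewrite lef_pV2 ?posrE// (lt_le_trans d'0).
have hz0le : modulus (h z0) * modulus (two_pi_i : C R) <= V * (T / d).
  rewrite mulrC -modulusM -modulusN -mulrN -hz0.
  apply: (cauchy_transform_le HL ch d0 T0 _ hT HV) => w Gw.
  by apply: Hd Gw; rewrite subrr modulus0.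
rewrite -ler_pdivlMr// in hz0le.
have u0 : 0 < modulus (node_poly alpha (k * n) (Phi z0)).
  by exact: ugt0 Ez0.
have -> : modulus p.[z0] ^+ n = modulus (h z0) * modulus (z0 - e0) *
    modulus (node_poly alpha (k * n) (Phi z0)).
  rewrite /h !modulusM !modulusV modulusX; field.
  by rewrite !gt_eqF.
have -> : K * ((s0 / s) ^+ k * B) ^+ n = V * (T / d) / modulus (two_pi_i : C R) *
    modulus (z0 - e0) * (c' * (mu * s0) ^+ (k * n)).
  rewrite /K /T exprMn -exprM !exprMn exprVn.
  by field; rewrite !expf_neq0 ?gt_eqF.
have /andP[_ hc'] := Hc' (k * n)%N.
apply: ler_pM => //.
- by rewrite mulr_ge0 ?modulus_ge0.
- exact: modulus_ge0.
- by rewrite ler_pM2r.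
Qed.

(** The level curves shrink to [E]: on the compact set where [|p|] exceeds its
    bound on [E] by a fixed amount the Green's function has a positive minimum, and
    the estimate applies to any lower level. *)
Theorem bernstein_walsh_E k (p : {poly (C R)}) s0 z0 (B : R) :
  1 < s0 -> ~ E z0 -> green z0 = ln s0 -> (size p <= k.+1)%N -> 0 <= B ->
  (forall z, E z -> modulus p.[z] <= B) -> modulus p.[z0] <= s0 ^+ k * B.
Proof.
move=> s01 Ez0 gz0 sp B0 pB; have s00 : 0 < s0 by exact: lt_trans s01.
apply/ler_addgt0Pr => e e0'.
have s0k : 0 < s0 ^+ k by rewrite exprn_gt0.
pose d := e / s0 ^+ k; have d0 : 0 < d by rewrite divr_gt0.
(* The compact part of the sublevel set on which [|p|] is too large. *)
pose S := sublevel s0 `&` [set z | B + d <= modulus p.[z]].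
have cS : compact S.
  have [r Hr] := sublevel_bounded s00.
  apply: (@bounded_closed_complex_compact _ _ r); last by move=> z [/Hr].
  apply: closedI; first exact: sublevel_closed.
  rewrite -openC; apply/open_modulusP => z /negP; rewrite -ltNge => zS.
  have cp := derivable_continuous (@derivable_complex_horner R p z).
  have [f f0 Hf] := (continuous_modulusP _ _).1 cp (B + d - modulus p.[z])
    ltac:(by rewrite subr_gt0).
  exists f => // w /Hf h /=; apply/negP; rewrite -ltNge.
  by have := le_lt_trans (modulusBl _ _) h; rewrite ltrBlDr subrK.
have SE z : S z -> ~ E z.
  by move=> [_ /= h] /pB; rewrite leNgt => /negP; apply; apply: lt_le_trans h; rewrite ltrDl.
have [eta eta0 Heta] := compact_positive_lower_bound cS
  (fun z Sz => continuous_green hPhi oE (SE z Sz)) (fun z Sz => green_gt0 hPhi (SE z Sz)).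
have e1 : 1 < expR eta by rewrite -expR0 ltr_expR.
have [s [s1 ss0 se]] : exists s, [/\ 1 < s, s < s0 & s < expR eta].
  exists ((1 + Num.min s0 (expR eta)) / 2).
  have m1 : 1 < Num.min s0 (expR eta) by rewrite lt_min s01.
  have : Num.min s0 (expR eta) <= s0 by rewrite ge_min lexx.
  have : Num.min s0 (expR eta) <= expR eta by rewrite ge_min lexx orbT.
  move: (Num.min _ _) m1 => x m1 h1 h2; split; lra.
have sp0 : 0 < s by exact: lt_trans s1.
have Bd : 0 <= B + d by rewrite addr_ge0// ltW.
have pBd z : level_curve s z -> modulus p.[z] <= B + d.
  move=> [Ez gz]; rewrite leNgt; apply/negP => h.
  have Sz : S z.
    split; last exact: ltW.
    by right; split=> //; rewrite gz ler_ln ?posrE// ltW.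
  have := Heta z Sz; rewrite gz leNgt => /negP; apply.
  by rewrite -[ltRHS](expRK eta) ltr_ln ?posrE// expR_gt0.
apply: le_trans (bernstein_walsh s1 ss0 Ez0 gz0 sp Bd pBd) _.
apply: (@le_trans _ _ (s0 ^+ k * (B + d))).
  rewrite ler_wpM2r// expr_div_n ler_pdivrMr ?exprn_gt0//.
  by rewrite ler_peMr ?(ltW s0k)// exprn_ege1// ltW.
by rewrite mulrDr lerD2l /d mulrC divfK// gt_eqF.
Qed.

Section AtPoint.
Context (z0 : C R) (s0 : R) (s01 : 1 < s0) (Ez0 : ~ E z0) (gz0 : green z0 = ln s0).

Let s00 : 0 < s0. Proof. exact: lt_trans s01. Qed.

Lemma faber_walsh_neq0 : \forall k \near \oo, b k z0 != 0.
Proof.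
have [c [C0 [c0 _ _ H]]] := faber_walsh_growth s01 Ez0 gz0.
apply: filterS H => k; rewrite -modulus_gt0; apply: lt_le_trans.
by rewrite mulr_gt0// exprn_gt0// mulr_gt0// (mu_gt0 hPhi).
Qed.

(** Growth rates are measured relative to [mu], as [|b k|] grows like
    [(mu * s) ^ k] on the level curve [s]. *)
Definition growth_at_most (S : set (C R)) (s : R) :=
  forall l, s < l -> exists C0 : R, forall k z, S z -> modulus (b k z) <= C0 * (mu * l) ^+ k.

Definition faber_walsh_normalized k z := b k z / b k z0.

Lemma growth_ratio S s : 0 < s -> growth_at_most S s -> forall t, s / s0 < t ->
  exists c : R, \forall k \near \oo, max_norm S (b k) / modulus (b k z0) <= c * t ^+ k.
Proof.
move=> sp0 HS t st; have t0 : 0 < t by apply: lt_trans st; rewrite divr_gt0.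
move: st; rewrite ltr_pdivrMr// => /HS[C0 HC0].
have mu0 := mu_gt0 hPhi.
have [c [C1 [c0 _ _ H]]] := faber_walsh_growth s01 Ez0 gz0.
exists (`|C0| / c); apply: filterS H => k hk.
have m0 : 0 < (mu * s0) ^+ k by rewrite exprn_gt0// mulr_gt0.
have b0 : 0 < modulus (b k z0) by apply: lt_le_trans hk; rewrite mulr_gt0.
rewrite ler_pdivrMr//.
apply: (@le_trans _ _ (`|C0| * (mu * (t * s0)) ^+ k)).
  have ge0 : 0 <= (mu * (t * s0)) ^+ k by rewrite exprn_ge0// !mulr_ge0// ltW.
  apply: max_norm_le; first by rewrite mulr_ge0.
  by move=> z Sz; apply: le_trans (HC0 k z Sz) _; rewrite ler_wpM2r// ler_norm.
have -> : `|C0| * (mu * (t * s0)) ^+ k = `|C0| / c * t ^+ k * (c * (mu * s0) ^+ k).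
  by rewrite mulrCA !exprMn; field; rewrite gt_eqF.
by rewrite ler_wpM2l// mulr_ge0 ?exprn_ge0 ?(ltW t0)// divr_ge0// ltW.
Qed.

Lemma max_norm_normalized S s k : growth_at_most S s -> b k z0 != 0 ->
  max_norm S (faber_walsh_normalized k) <= max_norm S (b k) / modulus (b k z0).
Proof.
move=> /(_ (s + 1)); rewrite ltrDl ltr01 => /(_ isT)[C0 HC0] bz0.
apply: max_norm_le; first by rewrite divr_ge0 ?modulus_ge0// max_norm_ge0.
move=> z Sz; rewrite modulusM modulusV ler_wpM2r ?invr_ge0 ?modulus_ge0//.
exact: le_max_norm (HC0 k) Sz.
Qed.

Lemma faber_walsh_normalizedP :
  \forall k \near \oo, normalized_polys k z0 (faber_walsh_normalized k).
Proof.
have [P [sP bP _]] := faber_walsh_representation.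
apply: filterS faber_walsh_neq0 => k bz0; apply/normalized_polysP.
exists ((b k z0)^-1 *: P k); split.
- exact: leq_trans (size_scale_leq _ _) (sP k).
- by rewrite hornerZ -bP mulVf.
- by move=> z; rewrite hornerZ -bP mulrC.
Qed.

Definition min_growth_at_least (S : set (C R)) (l : R) :=
  forall t, 0 < t < l -> forall k q, normalized_polys k z0 q -> t ^+ k <= max_norm S q.

Lemma faber_walsh_optimal S s : 0 < s -> growth_at_most S s -> min_growth_at_least S (s / s0) ->
  convergence_factor z0 S = s / s0 /\ asymptotically_optimal z0 S faber_walsh_normalized.
Proof.
move=> sp0 HS lo; apply: asymptotically_optimal_of_bounds => //.
- by rewrite divr_gt0.
- exact: faber_walsh_normalizedP.
- move=> t /(growth_ratio sp0 HS)[c Hc]; exists c.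
  apply: filterS2 Hc faber_walsh_neq0 => k hk bz0; apply: le_trans hk.
  exact: max_norm_normalized HS bz0.
Qed.

Lemma min_growth_at_least_E : min_growth_at_least E (1 / s0).
Proof.
move=> t /andP[t0 ts] k q /normalized_polysP[p [sp p1 qp]].
have [r Er] := E_bounded.
have [B B0 HB] := horner_bounded p r.
have bq z : E z -> modulus p.[z] <= max_norm E q.
  move=> Ez; rewrite -qp; apply: (@le_max_norm _ E q B) => // w Ew.
  by rewrite qp; apply: HB; exact: Er.
have := bernstein_walsh_E s01 Ez0 gz0 sp (max_norm_ge0 E q) bq.
rewrite p1 modulus1 -ler_pdivrMl ?exprn_gt0// mulr1; apply: le_trans.
rewrite -exprVn lerXn2r ?nnegrE ?invr_ge0 ?(ltW t0) ?(ltW s00)//.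
by rewrite -div1r ltW.
Qed.

(** The level curves of level below [s] lie in the interior of the level
    curve [s], and the estimate applies to each of them. *)
Lemma min_growth_at_least_interior s : 1 < s <= s0 ->
  min_growth_at_least (closure (level_interior s)) (s / s0).
Proof.
move=> /andP[s1 ss0] t /andP[t0 ts] k q /normalized_polysP[p [sp p1 qp]].
have sp0 : 0 < s by exact: lt_trans s1.
have [r Hr] := sublevel_bounded sp0.
have [B B0 HB] := horner_bounded p r.
pose s' := Num.max (t * s0) ((1 + s) / 2).
have s's : s' < s by rewrite gt_max -ltr_pdivlMr// ts /=; lra.
have s'1 : 1 < s' by rewrite lt_max; apply/orP; right; lra.
have s'0 : 0 < s' by exact: lt_trans s'1.
have bq z : level_curve s' z -> modulus p.[z] <= max_norm (closure (level_interior s)) q.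
  move=> [Ez gz]; rewrite -qp; apply: (@le_max_norm _ _ q B).
    by move=> w /closure_level_interior Sw; rewrite qp; apply: HB; exact: Hr.
  by apply: subset_closure; right; split=> //; rewrite gz ltr_ln ?posrE.
have := bernstein_walsh s'1 (lt_le_trans s's ss0) Ez0 gz0 sp (max_norm_ge0 _ q) bq.
rewrite p1 modulus1 -ler_pdivrMl ?exprn_gt0 ?divr_gt0// mulr1; apply: le_trans.
rewrite -exprVn invf_div lerXn2r ?nnegrE ?(ltW t0) ?divr_ge0 ?(ltW s00) ?(ltW s'0)//.
by rewrite ler_pdivlMr// le_max lexx.
Qed.

Lemma growth_sublevel s : 1 <= s -> growth_at_most (sublevel s) s.
Proof.
move=> s1 l sl; have l1 : 1 < l by exact: le_lt_trans sl.
by apply: faber_walsh_le => //; exact: lt_le_trans s1.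
Qed.

Lemma growth_sub S S' s : S `<=` S' -> growth_at_most S' s -> growth_at_most S s.
Proof.
by move=> SS H l /H[C0 HC0]; exists C0 => k z /SS; exact: HC0.
Qed.

Lemma sub_sublevel_E s : E `<=` sublevel s. Proof. by move=> z; left. Qed.

Lemma cvg_ratio_E :
  (fun k => (max_norm E (b k) / modulus (b k z0)) `^ k%:R^-1) @ \oo --> 1 / s0.
Proof.
have HE : growth_at_most E 1 by exact: growth_sub (@sub_sublevel_E 1) (growth_sublevel (lexx 1)).
apply: cvg_root; first by rewrite divr_gt0.
  exact: growth_ratio HE.
move=> t ts; exists 1 => //.
apply: filterS2 faber_walsh_neq0 faber_walsh_normalizedP => k bz0 np; rewrite mul1r.
by apply: le_trans (max_norm_normalized HE bz0); exact: min_growth_at_least_E ts k _ np.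
Qed.

Lemma cvg_ratio_level_curve s : 1 < s ->
  (fun k => (max_norm (level_curve s) (b k) / modulus (b k z0)) `^ k%:R^-1) @ \oo --> s / s0.
Proof.
move=> s1; have sp0 : 0 < s by exact: lt_trans s1.
have mu0 := mu_gt0 hPhi.
have HG : growth_at_most (level_curve s) s.
  apply: growth_sub (growth_sublevel (ltW s1)) => z [Ez gz].
  by right; split=> //; rewrite gz.
apply: cvg_root; first by rewrite divr_gt0.
  exact: growth_ratio HG.
have [z1 Gz1] := level_curve_nonempty s1; have [Ez1 gz1] := Gz1.
have [c [_ [c0 _ _ H1]]] := faber_walsh_growth s1 Ez1 gz1.
have [_ [C0 [_ C00 H2 _]]] := faber_walsh_growth s01 Ez0 gz0.
move=> t /andP[t0 ts]; exists (c / C0); first by rewrite divr_gt0.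
have [|B HB] := HG (s + 1); first by rewrite ltrDl.
apply: filterS2 faber_walsh_neq0 H1 => k bz0 h1.
have b0 : 0 < modulus (b k z0) by rewrite modulus_gt0.
rewrite ler_pdivlMr//; apply: le_trans (le_max_norm (HB k) Gz1); apply: le_trans h1.
apply: (@le_trans _ _ (c / C0 * t ^+ k * (C0 * (mu * s0) ^+ k))).
  by rewrite ler_wpM2l// mulr_ge0 ?exprn_ge0 ?(ltW t0)// divr_ge0// ltW.
have -> : c / C0 * t ^+ k * (C0 * (mu * s0) ^+ k) = c * (mu * (t * s0)) ^+ k.
  by rewrite mulrCA !exprMn; field; rewrite gt_eqF.
rewrite ler_wpM2l ?(ltW c0)// lerXn2r ?nnegrE ?mulr_ge0
  ?(ltW mu0) ?(ltW t0) ?(ltW s00) ?(ltW sp0)//.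
by rewrite ler_pM2l// ltW// -ltr_pdivlMr.
Qed.

End AtPoint.

End FaberWalsh.

Theorem proposition3p6 (R : realType) (N : nat) (Ej : 'I_N -> set (C R))
  (a : 'I_N -> C R) (m : 'I_N -> R) (mu : R) (Phi : C R -> C R)
  (alpha : nat -> C R) (b : nat -> C R -> C R) (z0 : C R) (sigma0 : R)
  (E := \bigcup_j Ej j)
  (Gamma := level_curve E a m mu Phi)
  (int_Gamma := level_interior E a m mu Phi)
  (hN : (1 <= N)%N)
  (hEj : forall j, nondegenerate_simply_connected_compact (Ej j))
  (hdisj : forall i j, i != j -> Ej i `&` Ej j = set0)
  (hPhi : is_lemniscatic_map E a m mu Phi)
  (halpha : admissible a m alpha)
  (hb : faber_walsh E a m mu Phi alpha b)
  (hz0 : ~ E z0)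
  (hsigma0 : 1 < sigma0)
  (hz0sigma0 : Gamma sigma0 z0) :
  [/\ convergence_factor z0 E = 1 / sigma0,
      forall sigma, 1 < sigma <= sigma0 ->
        convergence_factor z0 (closure (int_Gamma sigma)) = sigma / sigma0,
      (\forall k \near \oo, b k z0 != 0),
      (fun k => (max_norm E (b k) / modulus (b k z0)) `^ k%:R^-1) @ \oo
        --> 1 / sigma0
    & forall sigma, 1 < sigma ->
        (fun k => (max_norm (Gamma sigma) (b k) / modulus (b k z0))
                    `^ k%:R^-1) @ \oo --> sigma / sigma0]
  /\
  [/\ asymptotically_optimal z0 E (fun k z => b k z / b k z0)
    & forall sigma, 1 < sigma <= sigma0 ->
        asymptotically_optimal z0 (closure (int_Gamma sigma))
          (fun k z => b k z / b k z0)].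
Proof.
have [e0 Ee0] : exists e0, E e0.
  have [_ _ _ [e [_ [Ee _ _]]]] := hEj (Ordinal hN).
  by exists e; exists (Ordinal hN).
have cE : closed E.
  apply: compact_complex_closed.
  rewrite (_ : E = \big[setU/set0]_(j < N) Ej j).
    by apply: bigsetU_compact => j _; have [] := hEj j.
  rewrite /E -bigcup_seq; apply: eq_bigcupl; split=> // j _.
  by rewrite /= mem_index_enum.
have [_ gz0] := hz0sigma0.
have optE := faber_walsh_optimal hPhi halpha hb cE Ee0 hsigma0 hz0 gz0 ltr01
  (growth_sub (@sub_sublevel_E _ _ _ _ _ _ _ 1) (growth_sublevel hPhi halpha hb cE Ee0 (lexx 1)))
  (min_growth_at_least_E hPhi halpha hb cE Ee0 hsigma0 hz0 gz0).
have optG s : 1 < s <= sigma0 -> convergence_factor z0 (closure (int_Gamma s)) = s / sigma0 /\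
    asymptotically_optimal z0 (closure (int_Gamma s)) (fun k z => b k z / b k z0).
  move=> hs; have /andP[s1 _] := hs.
  apply: (faber_walsh_optimal hPhi halpha hb cE Ee0 hsigma0 hz0 gz0 (lt_trans ltr01 s1)).
    apply: growth_sub (growth_sublevel hPhi halpha hb cE Ee0 (ltW s1)).
    exact: closure_level_interior.
  have lo := min_growth_at_least_interior hPhi halpha hb cE Ee0 hsigma0 hz0 gz0 hs.
  exact: lo.
split; split.
- exact: optE.1.
- by move=> s /optG[].
- by have := faber_walsh_neq0 hPhi halpha hb cE Ee0 hsigma0 hz0 gz0.
- by have := cvg_ratio_E hPhi halpha hb cE Ee0 hsigma0 hz0 gz0.
- move=> s s1.
  by have := cvg_ratio_level_curve hPhi halpha hb cE Ee0 hsigma0 hz0 gz0 s1.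
- exact: optE.2.
- by move=> s /optG[].
Qed.
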